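(* Let $n\ge 1$ and let $(\mathcal{C},\mathbb{E},\mathfrak{s})$ be an $n$-exangulated category with enough projectives and enough injectives. Assume that $\mathcal{C}$ is a dualizing $k$-variety. Then there exists an equivalence $\tau\colon\underline{\mathcal{C}}\to\overline{\mathcal{C}}$ satisfying the following properties: (1) for every distinguished $n$-exangle $\langle X^\bullet,\delta\rangle$ one has $D\check{\delta}\cong\widetilde{\delta}\,\tau^{-1}$ and $D\widetilde{\delta}\cong\check{\delta}\,\tau$ (isomorphisms of functors); (2) for every object $X\in\mathcal{C}$ one has isomorphisms of functors $D\mathbb{E}(-,X)\cong\underline{\mathcal{C}}(\tau^{-1}X,-)$ and $D\mathbb{E}(X,-)\cong\overline{\mathcal{C}}(-,\tau X)$.
   Context: **$n$-exangulated categories.** Let $n\ge1$, $\mathcal{C}$ an additive category, $\mathbb{E}\colon\mathcal{C}^{op}\times\mathcal{C}\to\mathsf{Ab}$ an additive bifunctor. For $\delta\in\mathbb{E}(C,A)$, $a\colon A\to A'$, $c\colon C'\to C$, put $a_*\delta=\mathbb{E}(C,a)(\delta)$ and $c^*\delta=\mathbb{E}(c,A)(\delta)$. A morphism $(a,c)\colon\delta\to\rho$ from $\delta\in\mathbb{E}(C,A)$ to $\rho\in\mathbb{E}(C',A')$ is a pair $a\colon A\to A'$, $c\colon C\to C'$ with $a_*\delta=c^*\rho$. Consider complexes $X^\bullet=(X^0\xrightarrow{d_X^0}X^1\to\cdots\xrightarrow{d_X^n}X^{n+1})$ in $\mathcal{C}$ with the usual chain maps and homotopies. An $n$-exangle is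 a pair $\langle X^\bullet,\delta\rangle$ with $\delta\in\mathbb{E}(X^{n+1},X^0)$, $(d_X^0)_*\delta=0$, $(d_X^n)^*\delta=0$, such that $\mathcal{C}(-,X^0)\to\cdots\to\mathcal{C}(-,X^{n+1})\to\mathbb{E}(-,X^0)$ (last map $f\mapsto f^*\delta$) and $\mathcal{C}(X^{n+1},-)\to\cdots\to\mathcal{C}(X^0,-)\to\mathbb{E}(X^{n+1},-)$ (last map $g\mapsto g_*\delta$) are exact. For fixed $A,C$, let $[X^\bullet]$ be the homotopy equivalence class of a complex with $X^0=A$, $X^{n+1}=C$, with respect to chain maps that are the identity on $A$ and $C$. An exact realization $\mathfrak{s}$ assigns to each $\delta\in\mathbb{E}(C,A)$ a class $\mathfrak{s}(\delta)=[X^\bullet]$ with ends $A,C$ such that: (R0) if $\mathfrak{s}(\delta)=[X^\bullet]$, $\mathfrak{s}(\rho)=[Y^\bullet]$, each morphism $(a,c)\colon\delta\to\rho$ has a lift, i.e. a chain map $(a,f^1,\dots,f^n,c)\colon X^\bullet\to Y^\bullet$; (R1) if $\mathfrak{s}(\delta)=[X^\bullet]$ then $\langle X^\bullet,\delta\rangle$ is an $n$-exangle; (R2) $\mathfrak{s}(0\in\mathbb{E}(0,A))=[A\xrightarrow{1}A\to0\to\cdots\to0]$ and $\mathfrak{s}(0\in\mathbb{E}(A,0))=[0\to\cdots\to0\to A\xrightarrow{1}A]$. If $\mathfrak{s}(\delta)=[X^\bullet]$, then $\langle X^\bullet,\delta\rangle$ is called a distinguished $n$-exangle, $X^\bullet$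 a conflation, $d_X^0$ an inflation, $d_X^n$ a deflation. $(\mathcal{C},\mathbb{E},\mathfrak{s})$ is $n$-exangulated if: (EA1) inflations are closed under composition and so are deflations; (EA2) for $\rho\in\mathbb{E}(D,A)$, $c\colon C\to D$ and distinguished $\langle X^\bullet,c^*\rho\rangle$, $\langle Y^\bullet,\rho\rangle$, the morphism $(1_A,c)$ has a lift $f^\bullet$ whose mapping cone $X^1\to X^2\oplus Y^1\to\cdots\to X^{n+1}\oplus Y^n\to Y^{n+1}$ (differentials $\begin{bmatrix}-d_X^1\\ f^1\end{bmatrix}$, $\begin{bmatrix}-d_X^{i+1}&0\\ f^{i+1}&d_Y^i\end{bmatrix}$, $\begin{bmatrix}f^{n+1}&d_Y^n\end{bmatrix}$) together with $(d_X^0)_*\rho$ is a distinguished $n$-exangle; (EA2$^{op}$) the dual of (EA2), with mapping cocones. **Projectives, injectives, stable categories.** $P$ is projective if for each distinguished $n$-exangle $\langle X^\bullet,\delta\rangle$ every morphism $P\to X^{n+1}$ factors through $d_X^n$; $I$ is injective if every morphism $X^0\to I$ factors through $d_X^0$. $\mathcal{P}$ and $\mathcal{I}$ denote the full subcategories of projectives and injectives. $\mathcal{C}$ has enough projectives if each object $C$ admits a distinguished $n$-exangle $A\to P^1\to\cdots\to P^n\to C\dashrightarrow$ with all $P^i\in\mathcal{P}$; enough injectives is dual ($C\to I^1\to\cdots\to I^n\to B\dashrightarrow$ with all $I^i\in\mathcal{I}$). $\underline{\mathcal{C}}=\mathcal{C}/[\mathcal{P}]$ and $\overline{\mathcal{C}}=\mathcal{C}/[\mathcal{I}]$,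 where $[\mathcal{X}]$ is the ideal of morphisms factoring through an object of $\mathcal{X}$. **Defects.** For a distinguished $n$-exangle $\langle X^\bullet,\delta\rangle$, the contravariant defect is $\widetilde{\delta}=\mathrm{Coker}(\mathcal{C}(-,X^n)\xrightarrow{\mathcal{C}(-,d_X^n)}\mathcal{C}(-,X^{n+1}))$ and the covariant defect is $\check{\delta}=\mathrm{Coker}(\mathcal{C}(X^1,-)\xrightarrow{\mathcal{C}(d_X^0,-)}\mathcal{C}(X^0,-))$. The functor $\widetilde\delta$ vanishes on projectives and $\check\delta$ vanishes on injectives; they are regarded as functors $\underline{\mathcal{C}}^{op}\to\mathsf{Ab}$ and $\overline{\mathcal{C}}\to\mathsf{Ab}$, respectively. **Dualizing varieties.** $k$ is a commutative Artin ring, $E$ the injective envelope of $k$ (i.e. of $k/\mathrm{rad}\,k$), $D=\mathrm{Hom}_k(-,E)$, applied objectwise to functors. For an additive category $\mathcal{A}$, $\mathrm{mod}\,\mathcal{A}$ is the category of finitely presented functors $\mathcal{A}^{op}\to\mathsf{Ab}$. A $k$-linear additive category $\mathcal{C}$ is a dualizing $k$-variety if it is Hom-finite and Krull–Schmidt, $DF\in\mathrm{mod}(\mathcal{C}^{op})$ for all $F\in\mathrm{mod}\,\mathcal{C}$, and $DG\in\mathrm{mod}\,\mathcal{C}$ for all $G\in\mathrm{mod}(\mathcal{C}^{op})$. $\tau^{-1}$ denotes a quasi-inverse of $\tau$. *)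

(* Defs.v *)
From HB Require Import structures.
From mathcomp Require Import all_boot all_algebra.
From mathcomp Require Import boolp.

Set Implicit Arguments.
Unset Strict Implicit.
Unset Printing Implicit Defensive.

Import GRing.Theory.
Local Open Scope ring_scope.
Local Open Scope quotient_scope.

Record submodule (k : comPzRingType) (M : lmodType k) := Submodule {
  smem :> M -> Prop;
  smem0 : smem 0;
  smemD : forall x y, smem x -> smem y -> smem (x + y);
  smemZ : forall a x, smem x -> smem (a *: x) }.

Section QuotientModule.
Variables (k : comPzRingType) (M : lmodType k) (S : submodule M).

Definition smem_pred : {pred M} := fun x => `[< S x >].

Lemma smem_predE x : (x \in smem_pred) = `[< S x >]. Proof. by []. Qed.

Lemma smemB x y : S x -> S y -> S (x - y).
Proof. by move=> Sx Sy; rewrite -scaleN1r; apply: smemD => //; apply: smemZ. Qed.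

Lemma smem_pred_zmod : zmod_closed smem_pred.
Proof.
split=> [|x y]; rewrite !smem_predE; first exact/asboolP/smem0.
by move=> /asboolP Sx /asboolP Sy; apply/asboolP/smemB.
Qed.

HB.instance Definition _ := GRing.isZmodClosed.Build M smem_pred smem_pred_zmod.

Definition lquot : Type := Quotient.quot smem_pred.
HB.instance Definition _ := GRing.Zmodule.on lquot.

Definition qclass (x : M) : lquot := \pi_(Quotient.quot smem_pred) x.
Definition qrepr (x : lquot) : M := repr (x : Quotient.quot smem_pred).

Lemma qreprK x : qclass (qrepr x) = x. Proof. exact: reprK. Qed.

Lemma qclass_eq x y : qclass x = qclass y <-> S (x - y).
Proof.
split=> [/eqP|Sxy].
  by rewrite -(Quotient.idealrBE smem_pred) smem_predE => /asboolP.
by apply/eqP; rewrite -(Quotient.idealrBE smem_pred) smem_predE; apply/asboolP.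
Qed.

Lemma qclassD x y : qclass (x + y) = qclass x + qclass y.
Proof. exact: (Quotient.pi_add smem_pred). Qed.

Lemma qclass_eq0 x : qclass x = 0 <-> S x.
Proof.
have <- : qclass 0 = 0 by apply: (addrI (qclass 0)); rewrite -qclassD !addr0.
by rewrite qclass_eq subr0.
Qed.

Lemma qrepr_class x : S (qrepr (qclass x) - x).
Proof. by apply/qclass_eq; rewrite qreprK. Qed.

Definition qscale (a : k) (x : lquot) : lquot := qclass (a *: qrepr x).

Lemma qscale_class a x : qscale a (qclass x) = qclass (a *: x).
Proof. by apply/qclass_eq; rewrite -scalerBr; apply/smemZ/qrepr_class. Qed.

Lemma qscaleA a b x : qscale a (qscale b x) = qscale (a * b) x.
Proof. by rewrite -(qreprK x) !qscale_class scalerA. Qed.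
Lemma qscale1 : left_id 1 qscale.
Proof. by move=> x; rewrite -(qreprK x) !qscale_class scale1r. Qed.
Lemma qscaleDr : right_distributive qscale +%R.
Proof.
by move=> a x y; rewrite -(qreprK x) -(qreprK y) -qclassD !qscale_class scalerDr qclassD.
Qed.
Lemma qscaleDl x : {morph qscale^~ x : a b / a + b}.
Proof. by move=> a b; rewrite /= -(qreprK x) !qscale_class scalerDl qclassD. Qed.

HB.instance Definition _ :=
  GRing.Zmodule_isLmodule.Build k lquot qscaleA qscale1 qscaleDr qscaleDl.

Lemma qclassZ a x : qclass (a *: x) = a *: qclass x.
Proof. by rewrite -qscale_class. Qed.

End QuotientModule.

Definition lhom (k : comPzRingType) (V W : lmodType k) : Type := {linear V -> W}.

Section LinearMaps.
Variables (k : comPzRingType) (V W : lmodType k).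

HB.instance Definition _ := gen_eqMixin (lhom V W).
HB.instance Definition _ := gen_choiceMixin (lhom V W).

Definition lfun_of (f : lhom V W) : V -> W := (f : {linear V -> W}).
Coercion lfun_of : lhom >-> Funclass.

Lemma lhomP (f g : lhom V W) : (forall x, f x = g x) -> f = g.
Proof.
case: f g => [f [[f1] [f2]]] [g [[g1] [g2]]] fg; have E : f = g by apply/funext.
by subst g; rewrite (Prop_irrelevance f1 g1) (Prop_irrelevance f2 g2).
Qed.

Definition lhom0 : lhom V W := (\0 : {linear V -> W}).
Definition lhom_opp (f : lhom V W) : lhom V W := (\- f : {linear V -> W}).
Definition lhom_add (f g : lhom V W) : lhom V W := (f \+ g : {linear V -> W}).

Lemma lhom_addA : associative lhom_add.
Proof. by move=> f g h; apply: lhomP => x; apply: addrA. Qed.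
Lemma lhom_addC : commutative lhom_add.
Proof. by move=> f g; apply: lhomP => x; apply: addrC. Qed.
Lemma lhom_add0 : left_id lhom0 lhom_add.
Proof. by move=> f; apply: lhomP => x; apply: add0r. Qed.
Lemma lhom_addN : left_inverse lhom0 lhom_opp lhom_add.
Proof. by move=> f; apply: lhomP => x; apply: addNr. Qed.

End LinearMaps.

HB.instance Definition _ (k : comPzRingType) (V W : lmodType k) :=
  GRing.isZmodule.Build (lhom V W) (@lhom_addA k V W) (@lhom_addC k V W)
    (@lhom_add0 k V W) (@lhom_addN k V W).

Section ArtinRings.
Variable k : comPzRingType.

Definition is_ideal (I : k -> Prop) : Prop :=
  [/\ I 0, forall x y, I x -> I y -> I (x + y) & forall a x, I x -> I (a * x)].

Definition artinian : Prop :=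
  forall I : nat -> k -> Prop,
    (forall i, is_ideal (I i)) -> (forall i x, I i.+1 x -> I i x) ->
  exists N, forall i, (N <= i)%N -> forall x, I N x -> I i x.

Definition maximal_ideal (I : k -> Prop) : Prop :=
  [/\ is_ideal I, ~ I 1 &
      forall K, is_ideal K -> (forall x, I x -> K x) -> ~ K 1 -> forall x, K x -> I x].

Definition jacobson_radical (x : k) : Prop := forall I, maximal_ideal I -> I x.

Definition injective_module (J : lmodType k) : Prop :=
  forall (M N : lmodType k) (i : {linear M -> N}) (f : {linear M -> J}),
    injective i -> exists g : {linear N -> J}, forall x, g (i x) = f x.

Definition injective_envelope (M J : lmodType k) (i : {linear M -> J}) : Prop :=
  [/\ injective i, injective_module J &
      forall S : submodule J, (forall x, S (i x) -> x = 0) -> forall y, S y -> y = 0].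

(* The module k / rad k is given by its quotient map p. *)
Definition injective_envelope_of_residue_ring (J : lmodType k) : Prop :=
  exists (M : lmodType k) (p : {linear k^o -> M}) (i : {linear M -> J}),
    [/\ forall y, exists x, y = p x,
        forall x, p x = 0 <-> jacobson_radical x
      & injective_envelope i].

End ArtinRings.

Record lincat (k : comPzRingType) := LinCat {
  ob :> Type;
  hom : ob -> ob -> lmodType k;
  idm : forall A, hom A A;
  mcomp : forall A B C, hom B C -> hom A B -> hom A C;
  mcompP : forall A B C (f : hom A B) a (g g' : hom B C),
    mcomp (a *: g + g') f = a *: mcomp g f + mcomp g' f;
  mcompPr : forall A B C (g : hom B C) a (f f' : hom A B),
    mcomp g (a *: f + f') = a *: mcomp g f + mcomp g f';
  mcomp1m : forall A B (f : hom A B), mcomp (idm B) f = f;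
  mcompm1 : forall A B (f : hom A B), mcomp f (idm A) = f;
  mcompA : forall A B C D (h : hom C D) (g : hom B C) (f : hom A B),
    mcomp h (mcomp g f) = mcomp (mcomp h g) f }.

Arguments hom {k l} _ _.
Arguments idm {k l} _.
Arguments mcomp {k l A B C} _ _.

Reserved Notation "g \oc f" (at level 40, left associativity).
Notation "g \oc f" := (mcomp g f) : ring_scope.

Section LinCatTheory.
Variables (k : comPzRingType) (C : lincat k).
Implicit Types A B X Y Z : C.

Lemma mcompDl X Y Z (f : hom X Y) (g g' : hom Y Z) :
  (g + g') \oc f = g \oc f + g' \oc f.
Proof. by have := mcompP f 1 g g'; rewrite !scale1r. Qed.
Lemma mcompDr X Y Z (g : hom Y Z) (f f' : hom X Y) :
  g \oc (f + f') = g \oc f + g \oc f'.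
Proof. by have := mcompPr g 1 f f'; rewrite !scale1r. Qed.
Lemma mcomp0m X Y Z (f : hom X Y) : (0 : hom Y Z) \oc f = 0.
Proof. by apply: (addrI (0 \oc f)); rewrite -mcompDl !addr0. Qed.
Lemma mcompm0 X Y Z (g : hom Y Z) : g \oc (0 : hom X Y) = 0.
Proof. by apply: (addrI (g \oc 0)); rewrite -mcompDr !addr0. Qed.
Lemma mcompZl X Y Z a (f : hom X Y) (g : hom Y Z) : (a *: g) \oc f = a *: (g \oc f).
Proof. by have := mcompP f a g 0; rewrite mcomp0m !addr0. Qed.
Lemma mcompZr X Y Z a (g : hom Y Z) (f : hom X Y) : g \oc (a *: f) = a *: (g \oc f).
Proof. by have := mcompPr g a f 0; rewrite mcompm0 !addr0. Qed.
Lemma mcompNl X Y Z (f : hom X Y) (g : hom Y Z) : (- g) \oc f = - (g \oc f).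
Proof. by rewrite -scaleN1r mcompZl scaleN1r. Qed.
Lemma mcompNr X Y Z (g : hom Y Z) (f : hom X Y) : g \oc (- f) = - (g \oc f).
Proof. by rewrite -scaleN1r mcompZr scaleN1r. Qed.
Lemma mcompBl X Y Z (f : hom X Y) (g g' : hom Y Z) :
  (g - g') \oc f = g \oc f - g' \oc f.
Proof. by rewrite mcompDl mcompNl. Qed.
Lemma mcompBr X Y Z (g : hom Y Z) (f f' : hom X Y) :
  g \oc (f - f') = g \oc f - g \oc f'.
Proof. by rewrite mcompDr mcompNr. Qed.

(* The identity of A, seen as a morphism A -> B along an equality A = B. *)
Definition eqm A B (e : A = B) : hom A B := match e in _ = X return hom A X with erefl => idm A end.

Definition op : lincat k := @LinCat k C (fun A B => hom B A) (@idm k C)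
  (fun X Y Z g f => f \oc g)
  (fun X Y Z f => mcompPr f) (fun X Y Z g => mcompP g)
  (fun A B f => mcompm1 f) (fun A B f => mcomp1m f)
  (fun X Y Z W h g f => esym (mcompA f g h)).

Record cat_ideal := CatIdeal {
  cmem :> forall A B, submodule (hom A B);
  cmem_l : forall X Y Z (g : hom Y Z) (f : hom X Y), cmem X Y f -> cmem X Z (g \oc f);
  cmem_r : forall X Y Z (g : hom Y Z) (f : hom X Y), cmem Y Z g -> cmem X Z (g \oc f) }.

Variable I : cat_ideal.

Definition quot_hom A B : lmodType k := lquot (I A B).

Definition quot_comp X Y Z (g : quot_hom Y Z) (f : quot_hom X Y) : quot_hom X Z :=
  qclass (I X Z) (qrepr g \oc qrepr f).

Lemma quot_compE X Y Z (g : hom Y Z) (f : hom X Y) :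
  quot_comp (qclass (I Y Z) g) (qclass (I X Y) f) = qclass (I X Z) (g \oc f).
Proof.
apply/qclass_eq; set g' := qrepr _; set f' := qrepr _.
have -> : g' \oc f' - g \oc f = g' \oc (f' - f) + (g' - g) \oc f.
  by rewrite mcompBr mcompBl addrA subrK.
by apply: smemD; [apply: cmem_l | apply: cmem_r]; apply: qrepr_class.
Qed.

Definition quot_cat : lincat k.
Proof.
refine (@LinCat k C quot_hom (fun A => qclass (I A A) (idm A)) quot_comp _ _ _ _ _).
- move=> X Y Z f a g g'; rewrite -(qreprK f) -(qreprK g) -(qreprK g').
  by rewrite -qclassZ -qclassD !quot_compE mcompP qclassD qclassZ.
- move=> X Y Z g a f f'; rewrite -(qreprK f) -(qreprK g) -(qreprK f').
  by rewrite -qclassZ -qclassD !quot_compE mcompPr qclassD qclassZ.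
- by move=> X Y f; rewrite -(qreprK f) quot_compE mcomp1m.
- by move=> X Y f; rewrite -(qreprK f) quot_compE mcompm1.
- move=> X Y Z W h g f; rewrite -(qreprK f) -(qreprK g) -(qreprK h).
  by rewrite !quot_compE mcompA.
Defined.

End LinCatTheory.

Record addcat (k : comPzRingType) := AddCat {
  acat :> lincat k;
  zob : acat;
  zob_to : forall A (f : hom A zob), f = 0;
  zob_from : forall A (f : hom zob A), f = 0;
  bip : acat -> acat -> acat;
  inl_ : forall A B, hom A (bip A B);
  inr_ : forall A B, hom B (bip A B);
  prl : forall A B, hom (bip A B) A;
  prr : forall A B, hom (bip A B) B;
  prl_inl : forall A B, prl A B \oc inl_ A B = idm A;
  prr_inr : forall A B, prr A B \oc inr_ A B = idm B;
  prl_inr : forall A B, prl A B \oc inr_ A B = 0;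
  prr_inl : forall A B, prr A B \oc inl_ A B = 0;
  bip_id : forall A B, inl_ A B \oc prl A B + inr_ A B \oc prr A B = idm (bip A B) }.

Arguments zob {k a}.
Arguments bip {k a} _ _.
Arguments inl_ {k a} A B.
Arguments inr_ {k a} A B.
Arguments prl {k a} A B.
Arguments prr {k a} A B.

Section Biproducts.
Variables (k : comPzRingType) (C : addcat k) (A B X : C).

Lemma prl_inlK (f : hom X A) : prl A B \oc (inl_ A B \oc f) = f.
Proof. by rewrite mcompA prl_inl mcomp1m. Qed.
Lemma prr_inrK (f : hom X B) : prr A B \oc (inr_ A B \oc f) = f.
Proof. by rewrite mcompA prr_inr mcomp1m. Qed.
Lemma prl_inrK (f : hom X B) : prl A B \oc (inr_ A B \oc f) = 0.
Proof. by rewrite mcompA prl_inr mcomp0m. Qed.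
Lemma prr_inlK (f : hom X A) : prr A B \oc (inl_ A B \oc f) = 0.
Proof. by rewrite mcompA prr_inl mcomp0m. Qed.

End Biproducts.

Definition mcomp_simp (k : comPzRingType) (C : addcat k) :=
  (@mcompDl k C, @mcompDr k C, @mcompNl k C, @mcompNr k C, @mcompm0 k C, @mcomp0m k C,
   (@prl_inlK k C, @prr_inrK k C, @prl_inrK k C, @prr_inlK k C),
   (oppr0, @opprK, addr0, add0r, addNr, addrN)).

(* Functors between k-linear categories, and functors to abelian groups.      *)
(* All functors are additive; none is required to be k-linear. A              *)
(* contravariant functor on C is a functor on op C.                           *)
Record functor (k : comPzRingType) (C D : lincat k) := Functor {
  fob :> C -> D;
  fmap : forall A B, hom A B -> hom (fob A) (fob B);
  fmapD : forall A B (f g : hom A B), fmap (f + g) = fmap f + fmap g;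
  fmap1 : forall A, fmap (idm A) = idm (fob A);
  fmapM : forall X Y Z (g : hom Y Z) (f : hom X Y), fmap (g \oc f) = fmap g \oc fmap f }.

Record abfun (k : comPzRingType) (C : lincat k) := AbFun {
  aob :> C -> zmodType;
  amap : forall A B, hom A B -> aob A -> aob B;
  amap_add : forall A B (f : hom A B) x y, amap f (x + y) = amap f x + amap f y;
  amapD : forall A B (f g : hom A B) x, amap (f + g) x = amap f x + amap g x;
  amap1 : forall A x, amap (idm A) x = x;
  amapM : forall X Y Z (g : hom Y Z) (f : hom X Y) x,
    amap (g \oc f) x = amap g (amap f x) }.

Section Functors.
Variable k : comPzRingType.

Section Basic.
Variables (C D K : lincat k).

Definition fid : functor C C := @Functor k C C id (fun _ _ f => f)
  (fun _ _ _ _ => erefl) (fun _ => erefl) (fun _ _ _ _ _ => erefl).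

Definition fcomp (G : functor D K) (F : functor C D) : functor C K.
Proof.
refine (@Functor k C K (fun A => G (F A)) (fun A B f => fmap G (fmap F f)) _ _ _).
- by move=> A B f g; rewrite !fmapD.
- by move=> A; rewrite !fmap1.
- by move=> X Y Z g f; rewrite !fmapM.
Defined.

Definition opfun (F : functor C D) : functor (op C) (op D) :=
  @Functor k (op C) (op D) F (fun A B f => fmap F (f : @hom k C B A))
    (fun A B f g => fmapD F f g) (fmap1 F) (fun X Y Z g f => fmapM F f g).

Definition nat_iso (F G : functor C D) : Prop :=
  exists (eta : forall A, hom (F A) (G A)) (theta : forall A, hom (G A) (F A)),
    [/\ forall A B (f : hom A B), eta B \oc fmap F f = fmap G f \oc eta A,
        forall A, theta A \oc eta A = idm (F A)
      & forall A, eta A \oc theta A = idm (G A)].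

Definition quotfun (I : cat_ideal C) : functor C (quot_cat I) :=
  @Functor k C (quot_cat I) id (fun A B f => qclass (I A B) f)
    (fun A B f g => qclassD (I A B) f g) (fun A => erefl)
    (fun X Y Z g f => esym (quot_compE I g f)).

Definition ab_iso (F G : abfun C) : Prop :=
  exists eta : forall A, F A -> G A,
    [/\ forall A x y, eta A (x + y) = eta A x + eta A y,
        forall A, bijective (eta A)
      & forall A B (f : hom A B) x, eta B (amap f x) = amap f (eta A x)].

Definition abcomp (F : abfun D) (T : functor C D) : abfun C.
Proof.
refine (@AbFun k C (fun A => F (T A)) (fun A B f => amap (fmap T f)) _ _ _ _).
- by move=> A B f x y; rewrite amap_add.
- by move=> A B f g x; rewrite fmapD amapD.
- by move=> A x; rewrite fmap1 amap1.
- by move=> X Y Z g f x; rewrite fmapM amapM.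
Defined.

Definition corep (X : C) : abfun C :=
  @AbFun k C (fun A => hom X A) (fun A B f x => f \oc x)
    (fun A B f x y => mcompDr f x y) (fun A B f g x => mcompDl x f g)
    (fun A x => mcomp1m x) (fun X Y Z g f x => esym (mcompA g f x)).

Definition unop (F : abfun (op (op C))) : abfun C :=
  @AbFun k C F (fun A B f => @amap _ _ F A B f) (@amap_add _ _ F) (@amapD _ _ F)
    (@amap1 _ _ F) (@amapM _ _ F).

End Basic.

Definition quasi_inverse (C D : lincat k) (F : functor C D) (G : functor D C) : Prop :=
  nat_iso (fcomp G F) (fid C) /\ nat_iso (fcomp F G) (fid D).

Section Cokernel.
Variables (C : lincat k) (X Y : C) (f : hom X Y).

Definition precomp_image A : submodule (hom X A).
Proof.
refine (@Submodule _ _ (fun x => exists y : hom Y A, x = y \oc f) _ _ _).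
- by exists 0; rewrite mcomp0m.
- by move=> _ _ [x ->] [y ->]; exists (x + y); rewrite mcompDl.
- by move=> a _ [x ->]; exists (a *: x); rewrite mcompZl.
Defined.

Definition coker_map A B (g : hom A B) (x : lquot (precomp_image A)) :
  lquot (precomp_image B) := qclass _ (g \oc qrepr x).

Lemma coker_mapE A B (g : hom A B) x :
  coker_map g (qclass _ x) = qclass _ (g \oc x).
Proof.
apply/qclass_eq; rewrite -mcompBr.
by have [y ->] := qrepr_class (precomp_image A) x; exists (g \oc y); rewrite mcompA.
Qed.

(* Coker (C(Y,-) -> C(X,-)), the map being composition with f. *)
Definition coker_fun : abfun C.
Proof.
refine (@AbFun k C (fun A => lquot (precomp_image A)) coker_map _ _ _ _).
- move=> A B g x y; rewrite -(qreprK x) -(qreprK y) -qclassD !coker_mapE.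
  by rewrite mcompDr qclassD.
- by move=> A B g h x; rewrite -(qreprK x) !coker_mapE mcompDl qclassD.
- by move=> A x; rewrite -(qreprK x) coker_mapE mcomp1m.
- by move=> U V W h g x; rewrite -(qreprK x) !coker_mapE mcompA.
Defined.

End Cokernel.

(* Every functor F : C -> Ab takes values in k-modules, a in k acting on F A  *)
(* as the image under F of a *: id_A; this is the structure used to form D F. *)
(* In particular D E(-,X) is formed with the action through the first        *)
(* argument of E, and D E(X,-) with the action through the second one.       *)
Definition kmod (C : lincat k) (F : abfun C) (A : C) : Type := F A.

Section KMod.
Variables (C : lincat k) (F : abfun C) (A : C).

HB.instance Definition _ := GRing.Zmodule.on (kmod F A).

Definition kact (a : k) (x : kmod F A) : kmod F A := amap (a *: idm A) x.

Lemma kactA a b x : kact a (kact b x) = kact (a * b) x.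
Proof. by rewrite /kact -amapM mcompZl mcomp1m scalerA. Qed.
Lemma kact1 : left_id 1 kact.
Proof. by move=> x; rewrite /kact scale1r amap1. Qed.
Lemma kactDr : right_distributive kact +%R.
Proof. by move=> a x y; apply: amap_add. Qed.
Lemma kactDl x : {morph kact^~ x : a b / a + b}.
Proof. by move=> a b; rewrite /kact /= scalerDl amapD. Qed.

HB.instance Definition _ :=
  GRing.Zmodule_isLmodule.Build k (kmod F A) kactA kact1 kactDr kactDl.

End KMod.

Section Duality.
Variables (J : lmodType k) (C : lincat k) (F : abfun C).

Definition kdual_map_fun A B (f : hom B A) (phi : lhom (kmod F A) J) :
  kmod F B -> J := fun x => phi (amap f x).

Lemma kdual_map_linear A B (f : hom B A) phi : linear (@kdual_map_fun A B f phi).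
Proof.
move=> a x y; rewrite /kdual_map_fun amap_add.
have -> : amap f (a *: x : kmod F B) = a *: (amap f x : kmod F A).
  rewrite -[a *: x]/(kact a x) -[RHS]/(kact a _) /kact -!amapM.
  by rewrite mcompZr mcompZl mcompm1 mcomp1m.
by rewrite -linearP.
Qed.

HB.instance Definition _ A B (f : hom B A) phi :=
  GRing.isLinear.Build k (kmod F B) J _ (@kdual_map_fun A B f phi)
    (@kdual_map_linear A B f phi).

Definition kdual_map A B (f : hom B A) (phi : lhom (kmod F A) J) : lhom (kmod F B) J :=
  (kdual_map_fun f phi : {linear kmod F B -> J}).

Definition kdual : abfun (op C).
Proof.
refine (@AbFun k (op C) (fun A => lhom (kmod F A) J) kdual_map _ _ _ _).
- by move=> A B f x y; apply: lhomP.
- move=> A B f g x; apply: lhomP => y.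
  by rewrite /= -[LHS]/(x (amap (f + g : @hom k C B A) y)) amapD raddfD.
- by move=> A x; apply: lhomP => y; rewrite -[LHS]/(x (amap (@idm k C A) y)) amap1.
- move=> X Y Z g f x; apply: lhomP => y.
  by rewrite -[LHS]/(x (amap ((f : @hom k C Y X) \oc (g : @hom k C Z Y)) y)) amapM.
Defined.

End Duality.

Definition finitely_presented (C : lincat k) (F : abfun C) : Prop :=
  exists (X Y : C) (f : hom X Y), ab_iso F (coker_fun f).

Section Descent.
Variables (C : lincat k) (I : cat_ideal C).

Section Covariant.
Variable F : abfun C.
Hypothesis F0 : forall A B (f : hom A B), I A B f -> forall x, @amap _ _ F A B f x = 0.

Lemma amap_qrepr A B (f : hom A B) x : 
  @amap _ _ F A B (qrepr (qclass (I A B) f)) x = @amap _ _ F A B f x.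
Proof.
by rewrite -[qrepr _](subrK f) amapD F0 ?add0r //; apply: qrepr_class.
Qed.

Definition descend : abfun (quot_cat I).
Proof.
refine (@AbFun k (quot_cat I) F (fun A B (f : quot_hom I A B) => amap (qrepr f)) _ _ _ _).
- by move=> A B f x y; rewrite amap_add.
- by move=> A B f g x; rewrite -(qreprK f) -(qreprK g) -qclassD !amap_qrepr amapD.
- by move=> A x; rewrite amap_qrepr amap1.
- by move=> X Y Z g f x; rewrite amap_qrepr amapM.
Defined.
End Covariant.

Section Contravariant.
Variable F : abfun (op C).
Hypothesis F0 :
  forall (A B : C) (f : hom A B), I A B f -> forall x, @amap _ _ F B A f x = 0.

Lemma amap_qrepr_op (A B : C) (f : hom A B) x :
  @amap _ _ F B A (qrepr (qclass (I A B) f)) x = @amap _ _ F B A f x.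
Proof.
rewrite -[qrepr _](subrK f) (@amapD k (op C) F B A (_ - f) f).
by rewrite F0 ?add0r //; apply: qrepr_class.
Qed.

Definition descend_op : abfun (op (quot_cat I)).
Proof.
refine (@AbFun k (op (quot_cat I)) F
  (fun A B (f : quot_hom I B A) => @amap _ _ F A B (qrepr f)) _ _ _ _).
- by move=> A B f x y; rewrite amap_add.
- move=> A B f g x; rewrite -(qreprK f) -(qreprK g) -qclassD !amap_qrepr_op.
  by rewrite (@amapD k (op C) F A B).
- by move=> A x; rewrite amap_qrepr_op (@amap1 k (op C) F).
- by move=> X Y Z g f x; rewrite amap_qrepr_op (@amapM k (op C) F X Y Z).
Defined.
End Contravariant.

End Descent.

End Functors.

Section DualizingVariety.
Variables (k : comPzRingType) (J : lmodType k) (C : lincat k).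

Definition hom_finite : Prop :=
  forall A B : C, exists (m : nat) (g : 'I_m -> hom A B),
    forall f, exists c : 'I_m -> k, f = \sum_(i < m) c i *: g i.

Definition isomorphism (A B : C) (f : hom A B) : Prop :=
  exists g, g \oc f = idm A /\ f \oc g = idm B.

Definition local_endomorphism_ring (A : C) : Prop :=
  idm A <> 0 /\
  forall f g : hom A A, ~ isomorphism f -> ~ isomorphism g -> ~ isomorphism (f + g).

Definition krull_schmidt : Prop :=
  forall A : C, exists (m : nat) (Y : 'I_m -> C)
      (i : forall j, hom (Y j) A) (p : forall j, hom A (Y j)),
    [/\ forall j, local_endomorphism_ring (Y j),
        forall j, p j \oc i j = idm (Y j),
        forall j l, j != l -> p j \oc i l = 0
      & \sum_(j < m) i j \oc p j = idm A].

Definition dualizing_variety : Prop :=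
  [/\ hom_finite, krull_schmidt,
      forall F : abfun (op C), finitely_presented F ->
        finitely_presented (unop (kdual J F))
    & forall G : abfun C, finitely_presented G -> finitely_presented (kdual J G)].

End DualizingVariety.

(* ext C A is E(C,A), push a is a_*, pull c is c^*. *)
Record bifunctor (k : comPzRingType) (C : lincat k) := Bifunctor {
  ext :> C -> C -> zmodType;
  push : forall D A B : C, hom A B -> ext D A -> ext D B;
  pull : forall C' D A : C, hom C' D -> ext D A -> ext C' A;
  push_add : forall D A B (a : hom A B) (x y : ext D A), push a (x + y) = push a x + push a y;
  pushD : forall D A B (a a' : hom A B) (x : ext D A), push (a + a') x = push a x + push a' x;
  push1 : forall D A (x : ext D A), push (idm A) x = x;
  pushM : forall D A B B' (b : hom B B') (a : hom A B) (x : ext D A),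
    push (b \oc a) x = push b (push a x);
  pull_add : forall C' D A (c : hom C' D) (x y : ext D A), pull c (x + y) = pull c x + pull c y;
  pullD : forall C' D A (c c' : hom C' D) (x : ext D A), pull (c + c') x = pull c x + pull c' x;
  pull1 : forall D A (x : ext D A), pull (idm D) x = x;
  pullM : forall C' C'' D A (c : hom C' D) (c' : hom C'' C') (x : ext D A),
    pull (c \oc c') x = pull c' (pull c x);
  push_pull : forall C' D A B (a : hom A B) (c : hom C' D) (x : ext D A),
    push a (pull c x) = pull c (push a x) }.

Arguments push {k C b D A B} _ _ : rename.
Arguments pull {k C b C' D A} _ _ : rename.

Section ExtFunctors.
Variables (k : comPzRingType) (C : lincat k) (E : bifunctor C) (X : C).

Definition ext_co : abfun C :=
  @AbFun k C (E X) (fun A B f => push f) (fun A B => @push_add _ _ E X A B)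
    (fun A B => @pushD _ _ E X A B) (@push1 _ _ E X)
    (fun A B D g f => @pushM _ _ E X A B D g f).

Definition ext_contra : abfun (op C) :=
  @AbFun k (op C) (fun A => E A X) (fun A B (f : @hom k C B A) => pull f)
    (fun A B => @pull_add _ _ E B A X) (fun A B => @pullD _ _ E B A X)
    (fun A => @pull1 _ _ E A X) (fun A B D g f => @pullM _ _ E B D A X f g).

End ExtFunctors.

Section Complexes.
Variables (k : comPzRingType) (C : addcat k) (n : nat).
Implicit Types A B D : C.

(* Complexes X^0 -> ... -> X^{n+1} with X^0 = A and X^{n+1} = D. Only the    *)
(* objects X^i with i <= n + 1 and the differentials d^i with i <= n are     *)
(* meaningful: every condition below is limited to these.                    *)
Record cplx A D := Cplx {
  cob :> nat -> C;
  cd : forall i, hom (cob i) (cob i.+1);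
  cd_cd : forall i, (i < n)%N -> cd i.+1 \oc cd i = 0;
  cob_first : cob 0 = A;
  cob_last : cob n.+1 = D }.

Definition dfirst A D (X : cplx A D) : hom A (X 1) :=
  cd X 0 \oc eqm (esym (cob_first X)).
Definition dlast A D (X : cplx A D) : hom (X n) D :=
  eqm (cob_last X) \oc cd X n.

Record chain_map A D (X : cplx A D) A' D' (Y : cplx A' D') := ChainMap {
  cm :> forall i, hom (X i) (Y i);
  cm_cd : forall i, (i <= n)%N -> cd Y i \oc cm i = cm i.+1 \oc cd X i }.

Section ChainMaps.
Variables (A D A' D' : C) (X : cplx A D) (Y : cplx A' D').

Definition cm_first (f : chain_map X Y) : hom A A' :=
  eqm (cob_first Y) \oc f 0%N \oc eqm (esym (cob_first X)).
Definition cm_last (f : chain_map X Y) : hom D D' :=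
  eqm (cob_last Y) \oc f n.+1 \oc eqm (esym (cob_last X)).

(* f is a chain map of the form (a, f^1, ..., f^n, c). *)
Definition lifts (f : chain_map X Y) (a : hom A A') (c : hom D D') : Prop :=
  cm_first f = a /\ cm_last f = c.

(* phi i is the component X^{i+1} -> Y^i of a homotopy. *)
Definition homotopic (f g : forall i, hom (X i) (Y i)) : Prop :=
  exists phi : forall i, hom (X i.+1) (Y i),
    [/\ f 0%N - g 0%N = phi 0%N \oc cd X 0,
        forall i, (i < n)%N ->
          f i.+1 - g i.+1 = cd Y i \oc phi i + phi i.+1 \oc cd X i.+1
      & f n.+1 - g n.+1 = cd Y n \oc phi n].

End ChainMaps.

Definition homotopy_equivalent A D (X Y : cplx A D) : Prop :=
  exists (f : chain_map X Y) (g : chain_map Y X),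
    [/\ lifts f (idm A) (idm D), lifts g (idm A) (idm D),
        homotopic (fun i => g i \oc f i) (fun i => idm (X i))
      & homotopic (fun i => f i \oc g i) (fun i => idm (Y i))].

Definition is_exangle (E : bifunctor C) A D (X : cplx A D) (delta : E D A) : Prop :=
  [/\ push (dfirst X) delta = 0, pull (dlast X) delta = 0,
      (* C(-,X^0) -> ... -> C(-,X^{n+1}) -> E(-,X^0) is exact *)
      (forall W i, (i < n)%N -> forall g : hom W (X i.+1),
          cd X i.+1 \oc g = 0 <-> exists h, g = cd X i \oc h) /\
      (forall W (g : hom W D), pull g delta = 0 <-> exists h, g = dlast X \oc h)
    & (* C(X^{n+1},-) -> ... -> C(X^0,-) -> E(X^{n+1},-) is exact *)
      (forall W i, (i < n)%N -> forall g : hom (X i.+1) W,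
          g \oc cd X i = 0 <-> exists h, g = h \oc cd X i.+1) /\
      (forall W (g : hom A W), push g delta = 0 <-> exists h, g = h \oc dfirst X)].

Section MappingCone.
Variables (A D A' D' : C) (X : cplx A D) (Y : cplx A' D') (f : chain_map X Y).

(* X^1 -> X^2 (+) Y^1 -> ... -> X^{n+1} (+) Y^n -> Y^{n+1} *)
Definition cone_ob (i : nat) : C :=
  match i with
  | 0 => X 1
  | j.+1 => if (j < n)%N then bip (X j.+2) (Y j.+1) else Y j.+1
  end.

Definition cone_d0 (b : bool) : hom (X 1) (if b then bip (X 2) (Y 1) else Y 1) :=
  match b with
  | true => inl_ _ _ \oc (- cd X 1) + inr_ _ _ \oc f 1
  | false => f 1
  end.

Definition cone_dS (j : nat) (b b' : bool) :
    hom (if b then bip (X j.+2) (Y j.+1) else Y j.+1)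
        (if b' then bip (X j.+3) (Y j.+2) else Y j.+2) :=
  match b, b' with
  | true, true => inl_ _ _ \oc (- cd X j.+2) \oc prl _ _
                  + inr_ _ _ \oc (f j.+2 \oc prl _ _ + cd Y j.+1 \oc prr _ _)
  | true, false => f j.+2 \oc prl _ _ + cd Y j.+1 \oc prr _ _
  | false, _ => 0
  end.

Definition cone_d (i : nat) : hom (cone_ob i) (cone_ob i.+1) :=
  match i with
  | 0 => cone_d0 (0 < n)%N
  | j.+1 => cone_dS j (j < n)%N (j.+1 < n)%N
  end.

Lemma cone_last : cone_ob n.+1 = D'.
Proof. by rewrite /= ltnn; apply: cob_last. Qed.

(* The mapping cone formed in the opposite category:                         *)
(* X^0 -> Y^0 (+) X^1 -> ... -> Y^{n-1} (+) X^n -> Y^n                       *)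
Definition cocone_ob (i : nat) : C :=
  match i with
  | 0 => X 0
  | j.+1 => if (j < n)%N then bip (Y j) (X j.+1) else Y j
  end.

Definition cocone_d0 (b : bool) : hom (X 0) (if b then bip (Y 0) (X 1) else Y 0) :=
  match b with
  | true => inl_ _ _ \oc f 0%N + inr_ _ _ \oc cd X 0
  | false => f 0%N
  end.

Definition cocone_dS (j : nat) (b b' : bool) :
    hom (if b then bip (Y j) (X j.+1) else Y j)
        (if b' then bip (Y j.+1) (X j.+2) else Y j.+1) :=
  match b, b' with
  | true, true => inl_ _ _ \oc (- cd Y j \oc prl _ _ + f j.+1 \oc prr _ _)
                  + inr_ _ _ \oc cd X j.+1 \oc prr _ _
  | true, false => - cd Y j \oc prl _ _ + f j.+1 \oc prr _ _
  | false, _ => 0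
  end.

Definition cocone_d (i : nat) : hom (cocone_ob i) (cocone_ob i.+1) :=
  match i with
  | 0 => cocone_d0 (0 < n)%N
  | j.+1 => cocone_dS j (j < n)%N (j.+1 < n)%N
  end.

Lemma cocone_last : cocone_ob n.+1 = Y n.
Proof. by rewrite /= ltnn. Qed.

Lemma cone_dd i : (i < n)%N -> cone_d i.+1 \oc cone_d i = 0.
Proof.
have simpm := @mcomp_simp k C.
case: i => [|i] lt_in; rewrite /= lt_in ?(ltnW lt_in).
  have fd := cm_cd f lt_in.
  case lt1n: (1 < n)%N; rewrite /cone_dS /cone_d0 !(simpm, =^~ mcompA) ?fd ?simpm //.
  by rewrite (cd_cd X lt1n) !simpm.
have fd W (g : hom W _) : cd Y i.+2 \oc (f i.+2 \oc g) = f i.+3 \oc (cd X i.+2 \oc g).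
  by rewrite !mcompA cm_cd.
have dY W (g : hom W _) : cd Y i.+2 \oc (cd Y i.+1 \oc g) = 0.
  by rewrite mcompA cd_cd ?simpm.
case ltin: (i.+2 < n)%N; rewrite /cone_dS !(simpm, =^~ mcompA) ?(fd, dY, simpm) //.
by rewrite [cd X _ \oc (cd X _ \oc _)]mcompA (cd_cd X ltin) !simpm.
Qed.

Lemma cocone_dd i : (i < n)%N -> cocone_d i.+1 \oc cocone_d i = 0.
Proof.
have simpm := @mcomp_simp k C.
case: i => [|i] lt_in; rewrite /= lt_in ?(ltnW lt_in).
  have fd := cm_cd f (ltnW lt_in).
  case lt1n: (1 < n)%N; rewrite /cocone_dS /cocone_d0 !(simpm, =^~ mcompA) ?fd ?simpm //.
  by rewrite (cd_cd X lt_in) !simpm.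
have fd W (g : hom W _) : cd Y i.+1 \oc (f i.+1 \oc g) = f i.+2 \oc (cd X i.+1 \oc g).
  by rewrite !mcompA cm_cd // ltnW.
have dY W (g : hom W _) : cd Y i.+1 \oc (cd Y i \oc g) = 0.
  by rewrite mcompA cd_cd ?simpm // ltnW.
have dX W (g : hom W _) : cd X i.+2 \oc (cd X i.+1 \oc g) = 0.
  by rewrite mcompA cd_cd ?simpm.
by case ltin: (i.+2 < n)%N; rewrite /cocone_dS !(simpm, =^~ mcompA) ?(fd, dY, dX, simpm).
Qed.

Definition cone : cplx (X 1) D' := Cplx cone_dd erefl cone_last.
Definition cocone : cplx A (Y n) := Cplx cocone_dd (cob_first X) cocone_last.

End MappingCone.

Section TrivialComplexes.
Hypothesis n_gt0 : (0 < n)%N.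
Variable A : C.

(* A -> A -> 0 -> ... -> 0 *)
Definition triv_first_ob (i : nat) : C := if i is _.+2 then zob else A.

Definition triv_first_d (i : nat) : hom (triv_first_ob i) (triv_first_ob i.+1) :=
  if i is 0 then idm A else 0.

Lemma triv_first_dd i : (i < n)%N -> triv_first_d i.+1 \oc triv_first_d i = 0.
Proof. by move=> _; apply: mcomp0m. Qed.

Lemma triv_first_last : triv_first_ob n.+1 = zob.
Proof. by case: n n_gt0. Qed.

Definition triv_first : cplx A zob := Cplx triv_first_dd erefl triv_first_last.

(* 0 -> ... -> 0 -> A -> A *)
Definition triv_last_ob (i : nat) : C := if (i < n)%N then zob else A.

Definition triv_last_d_aux (b b' : bool) :
    hom (if b then zob else A) (if b' then zob else A) :=
  match b, b' with
  | false, false => idm A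
  | _, _ => 0
  end.

Definition triv_last_d (i : nat) : hom (triv_last_ob i) (triv_last_ob i.+1) :=
  triv_last_d_aux (i < n)%N (i.+1 < n)%N.

Lemma triv_last_dd i : (i < n)%N -> triv_last_d i.+1 \oc triv_last_d i = 0.
Proof.
move=> lt_in; have d0 (b b' : bool) : b -> triv_last_d_aux b b' = 0 by case: b; case: b'.
by rewrite [triv_last_d i]d0 ?mcompm0.
Qed.

Lemma triv_last_first : triv_last_ob 0 = zob.
Proof. by rewrite /triv_last_ob n_gt0. Qed.

Lemma triv_last_last : triv_last_ob n.+1 = A.
Proof. by rewrite /triv_last_ob ltnNge leqnSn. Qed.

Definition triv_last : cplx zob A := Cplx triv_last_dd triv_last_first triv_last_last.

End TrivialComplexes.

End Complexes.

Section Realizations.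
Variables (k : comPzRingType) (C : addcat k) (n : nat) (E : bifunctor C).
(* real delta X means that X belongs to the class s(delta). *)
Variable real : forall D A : C, E D A -> cplx n A D -> Prop.

Record exact_realization (n_gt0 : (0 < n)%N) : Prop := ExactRealization {
  real_ex : forall D A (delta : E D A), exists X, real delta X;
  real_class : forall D A (delta : E D A) X Y,
    real delta X -> (real delta Y <-> homotopy_equivalent X Y);
  real_R0 : forall D A D' A' (delta : E D A) (rho : E D' A') X Y,
    real delta X -> real rho Y ->
    forall (a : hom A A') (c : hom D D'), push a delta = pull c rho ->
    exists f : chain_map X Y, lifts f a c;
  real_R1 : forall D A (delta : E D A) X, real delta X -> is_exangle X delta;
  real_R2 : forall A, real (0 : E zob A) (triv_first n_gt0 A) /\
                      real (0 : E A zob) (triv_last n_gt0 A) }.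

Definition inflation (A B : C) (f : hom A B) : Prop :=
  exists D (delta : E D A) (X : cplx n A D) (e : X 1 = B),
    real delta X /\ f = eqm e \oc dfirst X.

Definition deflation (B D : C) (f : hom B D) : Prop :=
  exists A (delta : E D A) (X : cplx n A D) (e : X n = B),
    real delta X /\ f = dlast X \oc eqm (esym e).

Definition EA1 : Prop :=
  (forall A B B' (f : hom A B) (g : hom B B'),
     inflation f -> inflation g -> inflation (g \oc f)) /\
  (forall A B B' (f : hom A B) (g : hom B B'),
     deflation f -> deflation g -> deflation (g \oc f)).

Definition EA2 : Prop :=
  forall A B D (rho : E D A) (c : hom B D) (X : cplx n A B) (Y : cplx n A D),
    real (pull c rho) X -> real rho Y ->
  exists f : chain_map X Y,
    lifts f (idm A) c /\ real (push (dfirst X) rho) (cone f).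

Definition EA2op : Prop :=
  forall A B D (delta : E D A) (a : hom A B) (X : cplx n A D) (Y : cplx n B D),
    real delta X -> real (push a delta) Y ->
  exists f : chain_map X Y,
    lifts f a (idm D) /\ real (pull (dlast Y) delta) (cocone f).

End Realizations.

Record nexangulated (k : comPzRingType) (C : addcat k) (n : nat) (n_gt0 : (0 < n)%N) :=
  NExangulated {
    nex_ext :> bifunctor C;
    nex_real : forall D A : C, nex_ext D A -> cplx n A D -> Prop;
    nex_realP : exact_realization nex_real n_gt0;
    nex_EA1 : EA1 nex_real;
    nex_EA2 : EA2 nex_real;
    nex_EA2op : EA2op nex_real }.

Section NExangulatedTheory.
Variables (k : comPzRingType) (C : addcat k) (n : nat) (n_gt0 : (0 < n)%N).
Variable S : nexangulated C n_gt0.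

Definition distinguished (A D : C) (X : cplx n A D) (delta : S D A) : Prop :=
  nex_real delta X.

Definition projective (P : C) : Prop :=
  forall A D (X : cplx n A D) (delta : S D A), distinguished X delta ->
  forall f : hom P D, exists g, f = dlast X \oc g.

Definition injective_ob (I : C) : Prop :=
  forall A D (X : cplx n A D) (delta : S D A), distinguished X delta ->
  forall f : hom A I, exists g, f = g \oc dfirst X.

Definition enough_projectives : Prop :=
  forall D, exists A (X : cplx n A D) (delta : S D A),
    distinguished X delta /\ forall i, (0 < i <= n)%N -> projective (X i).

Definition enough_injectives : Prop :=
  forall A, exists D (X : cplx n A D) (delta : S D A),
    distinguished X delta /\ forall i, (0 < i <= n)%N -> injective_ob (X i).

Definition factors_through (P : C -> Prop) (A B : C) (f : hom A B) : Prop :=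
  exists (Q : C) (h : hom Q B) (g : hom A Q), P Q /\ f = h \oc g.

Section FactorIdeal.
Variable P : C -> Prop.
Hypothesis P0 : P zob.
Hypothesis PD : forall Q R, P Q -> P R -> P (bip Q R).

Definition factor_submodule (A B : C) : submodule (hom A B).
Proof.
refine (@Submodule _ _ (@factors_through P A B) _ _ _).
- by exists zob, 0, 0; split=> //; rewrite mcompm0.
- move=> _ _ [Q [h [g [PQ ->]]]] [R [h' [g' [PR ->]]]].
  exists (bip Q R), (h \oc prl Q R + h' \oc prr Q R), (inl_ Q R \oc g + inr_ Q R \oc g').
  split; first exact: PD.
  by rewrite !mcompDl !mcompDr -!mcompA prl_inlK prl_inrK prr_inlK prr_inrK
    !mcompm0 addr0 add0r.
- move=> a _ [Q [h [g [PQ ->]]]]; exists Q, (a *: h), g.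
  by split=> //; rewrite mcompZl.
Defined.

Definition factor_ideal : cat_ideal C.
Proof.
refine (@CatIdeal k C factor_submodule _ _).
- move=> X Y Z g _ [Q [h [h' [PQ ->]]]]; exists Q, (g \oc h), h'.
  by split=> //; rewrite mcompA.
- move=> X Y Z _ f [Q [h [h' [PQ ->]]]]; exists Q, h, (h' \oc f).
  by split=> //; rewrite mcompA.
Defined.

End FactorIdeal.

Lemma projective_zob : projective zob.
Proof. by move=> A D X delta _ f; exists 0; rewrite mcompm0; apply: zob_from. Qed.

Lemma projective_bip Q R : projective Q -> projective R -> projective (bip Q R).
Proof.
move=> PQ PR A D X delta dX f.
have [g fg] := PQ _ _ _ _ dX (f \oc inl_ Q R).
have [h fh] := PR _ _ _ _ dX (f \oc inr_ Q R).
exists (g \oc prl Q R + h \oc prr Q R).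
by rewrite mcompDr !mcompA -fg -fh -!mcompA -mcompDr bip_id mcompm1.
Qed.

Lemma injective_zob : injective_ob zob.
Proof. by move=> A D X delta _ f; exists 0; rewrite mcomp0m; apply: zob_to. Qed.

Lemma injective_bip Q R : injective_ob Q -> injective_ob R -> injective_ob (bip Q R).
Proof.
move=> IQ IR A D X delta dX f.
have [g fg] := IQ _ _ _ _ dX (prl Q R \oc f).
have [h fh] := IR _ _ _ _ dX (prr Q R \oc f).
exists (inl_ Q R \oc g + inr_ Q R \oc h).
by rewrite mcompDl -!mcompA -fg -fh !mcompA -mcompDl bip_id mcomp1m.
Qed.

Definition proj_ideal : cat_ideal C := factor_ideal projective_zob projective_bip.
Definition inj_ideal : cat_ideal C := factor_ideal injective_zob injective_bip.

Definition stable : lincat k := quot_cat proj_ideal.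
Definition costable : lincat k := quot_cat inj_ideal.

Section Defects.
Variables (A D : C) (X : cplx n A D).

Definition contra_defect : abfun (op C) := @coker_fun k (op C) D (X n) (dlast X).
Definition co_defect : abfun C := coker_fun (dfirst X).

Variable delta : S D A.
Hypothesis dX : distinguished X delta.

Lemma contra_defect0 (B B' : C) (f : hom B B') :
  proj_ideal B B' f -> forall x, @amap _ _ contra_defect B' B f x = 0.
Proof.
move=> [Q [h [g [PQ ->]]]] x.
rewrite -(qreprK x) [LHS](@coker_mapE k (op C) D (X n) (dlast X) B' B (h \oc g)).
apply/qclass_eq0; set u : @hom k C B' D := qrepr x.
have [y hy] := PQ _ _ _ _ dX (u \oc h).
by exists (y \oc g); rewrite /= !mcompA hy.
Qed.

Lemma co_defect0 (B B' : C) (f : hom B B') :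
  inj_ideal B B' f -> forall x, @amap _ _ co_defect B B' f x = 0.
Proof.
move=> [Q [h [g [IQ ->]]]] x.
rewrite -(qreprK x) [LHS]coker_mapE.
apply/qclass_eq0; have [y hy] := IQ _ _ _ _ dX (g \oc qrepr x).
by exists (h \oc y); rewrite -!mcompA hy.
Qed.

Definition stable_contra_defect : abfun (op stable) := descend_op contra_defect0.
Definition costable_co_defect : abfun costable := descend co_defect0.

End Defects.

End NExangulatedTheory.

(* Main.v *)
From HB Require Import structures.
From mathcomp Require Import all_boot all_algebra.
From mathcomp Require Import boolp.
Require Import Defs.

Set Implicit Arguments.
Unset Strict Implicit.
Unset Printing Implicit Defensive.

Import GRing.Theory.
Local Open Scope ring_scope.

(** The theorem is Auslander-Reiten duality, and it comes down to finding perfect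
    pairings. A functional w : E(Y,X) -> J pairs f : Y -> W and e in E(W,X) to
    w(f^*e), and g : B -> X and e in E(Y,B) to w(g_*e). It is [perfect] when the first
    pairing identifies C(Y,W), modulo the f with f^* = 0, with D E(W,X) for all W, and
    the second identifies C(B,X), modulo the g with g_* = 0, with D E(Y,B) for all B.
    As there are enough projectives, f^* = 0 means that f factors through a projective
    ([proj_idealP]); dually for g and injectives. So a perfect pairing says that D
    E(-,X) is represented by Y on the stable category and D E(Y,-) by X on the
    costable one: Y is the inverse translate of X, and X the translate of Y.

    Functoriality and the quasi-inverse property then follow formally. Given perfect w
    : E(Y,X) -> J and w' : E(Y',X') -> J, the equation w(F^*e) = w'(G_*e) for all e in
    E(Y',X) is a bijection between morphisms F : Y -> Y' modulo projectives and G : X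
    -> X' modulo injectives, compatible with sums and composites ([translate],
    [translate_inverse], [translates_quasi_inverse]). The contravariant defect of
    delta in E(D,A) is the subfunctor of the f^*delta in E(-,A), the covariant one
    that of the g_*delta in E(D,-), and the formulas for their duals are obtained by
    evaluating perfect pairings on the elements g_*f^*delta ([contra_defect_dual],
    [co_defect_dual]).

    Existence of a perfect pairing for a given X ([pairing_left]) has two steps. By
    the dualizing hypothesis D E(-,X) has a presentation C(Z,-) -> C(Y,-) -> D E(-,X)
    -> 0. If it splits modulo the morphisms that E annihilates, then an idempotent
    endomorphism of Y modulo these morphisms cuts out the representing object, since
    idempotents lift and split. It does split, because E(-,X) is injective among the
    defects: a map to it from a defect is given by pushing out the defining element,
    and so extends to larger defects ([ext_pull_functional_representable]). The second
    step is that representing one of the functors D E(-,X), D E(Y,-) by w implies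
    representing the other ([represents_pull_push], [represents_push_pull]), by Matlis
    reflexivity of the modules E(W,X).

    Only a weak form of exactness of E enters: every delta in E(D,A) has morphisms
    into D and out of A that control its annihilators on both sides, and there are
    universal elements ([exact_bifunctor]). For an n-exangulated category it follows
    from the mapping cone and cocone conditions ([nexangulated_exact]). It is
    self-dual, so the existence for a given Y is the existence for a given X in the
    opposite category, up to one difficulty: E is only biadditive, and k acts on
    E(W,X) both through W and through X, possibly in different ways. The dual of
    E(-,X) uses the first action, the dual of E(X,-) the second. The two kinds of
    functionals on the orbit of an element delta are matched by [functional_twist]:
    both actions factor through a commutative ring Z generated by them on delta, and
    the modules Hom_k(Z, J) formed for the two maps k -> Z are isomorphic over Z
    ([coind_iso]), each of them being an injective envelope of Z / rad Z. *)

(** * Linear maps, submodules and the descending chain condition *)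

Section Linear.
Variable k : comPzRingType.

(** Morphisms are mostly constructed from formulas; stating existence keeps the bundled
    structure of the map out of the rewriting that follows. *)
Lemma linear_lhom (V W : lmodType k) (f : V -> W) :
  linear f -> exists g : lhom V W, forall x, g x = f x.
Proof.
move=> lf.
pose g : {linear V -> W} := HB.pack f (GRing.isLinear.Build k V W *:%R f lf).
by exists g.
Qed.

Section LhomModule.
Variables V W : lmodType k.
Implicit Types f g : lhom V W.

Definition lhom_scale (a : k) f : lhom V W := (a \*: f : {linear V -> W}).
Lemma lhom_scaleA a b f : lhom_scale a (lhom_scale b f) = lhom_scale (a * b) f.
Proof. by apply: lhomP => x; rewrite /= /lfun_of /= scalerA. Qed.
Lemma lhom_scale1 : left_id 1 lhom_scale.
Proof. by move=> f; apply: lhomP => x; apply: scale1r. Qed.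
Lemma lhom_scaleDr : right_distributive lhom_scale +%R.
Proof. by move=> a f g; apply: lhomP => x; apply: scalerDr. Qed.
Lemma lhom_scaleDl f : {morph lhom_scale^~ f : a b / a + b}.
Proof. by move=> a b; apply: lhomP => x; apply: scalerDl. Qed.
HB.instance Definition _ :=
  GRing.Zmodule_isLmodule.Build k (lhom V W) lhom_scaleA lhom_scale1 lhom_scaleDr lhom_scaleDl.

Lemma lhomE_D f g x : lfun_of (f + g) x = f x + g x. Proof. by []. Qed.
Lemma lhomE_Z a f x : lfun_of (a *: f) x = a *: f x. Proof. by []. Qed.
Lemma lhomE_N f x : lfun_of (- f) x = - f x. Proof. by []. Qed.
Lemma lhomE_0 x : lfun_of (0 : lhom V W) x = 0. Proof. by []. Qed.
Lemma lhD f x y : f (x + y) = f x + f y. Proof. exact: raddfD. Qed.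
Lemma lhN f x : f (- x) = - f x. Proof. exact: raddfN. Qed.
Lemma lhB f x y : f (x - y) = f x - f y. Proof. exact: raddfB. Qed.
Lemma lh0 f : f 0 = 0. Proof. exact: raddf0. Qed.
Lemma lhZ f a x : f (a *: x) = a *: f x. Proof. exact: linearZZ. Qed.
End LhomModule.
Definition lhE := (lhomE_D, lhomE_Z, lhomE_N, lhomE_0, lhD, lhN, lhB, lh0, lhZ).

Lemma submodule_ex (M : lmodType k) (P : M -> Prop) :
  P 0 -> (forall x y, P x -> P y -> P (x + y)) -> (forall a x, P x -> P (a *: x)) ->
  exists S : submodule M, forall x, S x <-> P x.
Proof. by move=> P0 PD PZ; exists (Submodule P0 PD PZ). Qed.

Lemma whole_submodule (M : lmodType k) : exists S : submodule M, forall x, S x <-> True.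
Proof. exact: submodule_ex. Qed.

Lemma kernel_submodule (M N : lmodType k) (f : lhom M N) : exists S : submodule M,
  forall x, S x <-> f x = 0.
Proof.
apply: submodule_ex => /=.
- exact: lh0.
- by move=> x y fx fy; rewrite lhD fx fy addr0.
- by move=> a x fx; rewrite lhZ fx scaler0.
Qed.

Lemma image_submodule (M N : lmodType k) (f : lhom M N) (S : submodule M) : exists T : submodule N,
  forall y, T y <-> exists x, S x /\ y = f x.
Proof.
apply: submodule_ex => /=.
- by exists 0; rewrite lh0; split=> //; apply: smem0.
- by move=> _ _ [x [Sx ->]] [y [Sy ->]]; exists (x + y); rewrite lhD; split=> //; apply: smemD.
- by move=> a _ [x [Sx ->]]; exists (a *: x); rewrite lhZ; split=> //; apply: smemZ.
Qed.

Lemma preimage_submodule (M N : lmodType k) (f : lhom M N) (T : submodule N) :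
  exists S : submodule M, forall x, S x <-> T (f x).
Proof.
apply: submodule_ex => /=.
- by rewrite lh0; apply: smem0.
- by move=> x y fx fy; rewrite lhD; apply: smemD.
- by move=> a x fx; rewrite lhZ; apply: smemZ.
Qed.

Lemma meet_submodule (M : lmodType k) (S T : submodule M) : exists U : submodule M,
  forall x, U x <-> S x /\ T x.
Proof.
apply: submodule_ex => /=.
- by split; apply: smem0.
- by move=> x y [? ?] [? ?]; split; apply: smemD.
- by move=> a x [? ?]; split; apply: smemZ.
Qed.

Definition subspan (M : lmodType k) (P : M -> Prop) : submodule M.
Proof.
refine (@Submodule k M (fun y => forall S : submodule M, (forall x, P x -> S x) -> S y) _ _ _).
- by move=> S _; apply: smem0.
- by move=> x y hx hy S hS; apply: smemD; [apply: hx | apply: hy].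
- by move=> a x hx S hS; apply: smemZ; apply: hx.
Defined.

Lemma mul_lin (M : lmodType k) (x : M) : exists f : lhom k^o M, forall c : k, f c = c *: x.
Proof. by apply: linear_lhom => a b c; rewrite scalerDl -scalerA. Qed.

Lemma quot_lift (M N : lmodType k) (S : submodule M) (f : lhom M N) :
  (forall x, S x -> f x = 0) -> exists g : lhom (lquot S) N, forall x, g (qclass S x) = f x.
Proof.
move=> fS; have fE x : f (qrepr (qclass S x)) = f x.
  by apply/eqP; rewrite -subr_eq0 -lhB fS //; apply: qrepr_class.
have [|g gE] := @linear_lhom (lquot S) N (fun x => f (qrepr x)).
  by move=> a x y; rewrite -(qreprK x) -(qreprK y) -qclassZ -qclassD !fE lhD lhZ.
by exists g => x; rewrite gE fE.
Qed.

Definition artinian_mod (M : lmodType k) : Prop :=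
  forall N : nat -> submodule M, (forall i x, N i.+1 x -> N i x) ->
  exists n, forall i, (n <= i)%N -> forall x, N n x -> N i x.

(** The minimum condition is what the chain condition is used for below. If F had no
    minimal member, dependent choice would produce a strictly decreasing chain. *)
Lemma artinian_min (M : lmodType k) (F : submodule M -> Prop) S0 :
  artinian_mod M -> F S0 ->
  exists S, F S /\ forall K, F K -> (forall x, K x -> S x) -> forall x, S x -> K x.
Proof.
move=> aM FS0; apply: contrapT => nomin.
have step (S : {S | F S}) : {K : {K | F K} | (forall x, sval K x -> sval S x) /\
    exists x, sval S x /\ ~ sval K x}.
  apply: cid; case: S => S FS; apply: contrapT => noK; apply: nomin; exists S; split=> //.
  move=> K FK KS x Sx; apply: contrapT => nKx; apply: noK.
  by exists (exist _ K FK); split=> //; exists x.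
pose ch := fix ch i := if i is j.+1 then sval (step (ch j)) else exist F S0 FS0.
have [|n hn] := aM (fun i => sval (ch i)).
  by move=> i x; apply: (proj1 (svalP (step (ch i)))).
have [_ [x [Sx nKx]]] := svalP (step (ch n)).
by apply: nKx; apply: (hn n.+1).
Qed.

Lemma artinian_surj (M N : lmodType k) (f : lhom M N) :
  (forall y, exists x, y = f x) -> artinian_mod M -> artinian_mod N.
Proof.
move=> fs aM S dS.
have [T hT] := choice (fun i => preimage_submodule f (S i)).
have [|n hn] := aM T; first by move=> i x; rewrite !hT; apply: dS.
by exists n => i ni x; have [y ->] := fs x; rewrite -!hT; apply: hn.
Qed.

Lemma artinian_inj (M N : lmodType k) (f : lhom M N) :
  (forall x, f x = 0 -> x = 0) -> artinian_mod N -> artinian_mod M.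
Proof.
move=> fi aN S dS.
have [T hT] := choice (fun i => image_submodule f (S i)).
have [|n hn] := aN T.
  by move=> i x; rewrite !hT => -[y [Sy ->]]; exists y; split=> //; apply: dS.
exists n => i ni x Sx; have /hT [y [Sy fxy]] : T i (f x) by apply/(hn i ni)/hT; exists x.
suff -> : x = y by [].
by apply/eqP; rewrite -subr_eq0; apply/eqP/fi; rewrite lhB fxy subrr.
Qed.

(** Modules of finite type over an artinian ring are artinian. Induction on p shows that
    a chain stabilizes on the span of the first p generators: the coefficients of the
    next generator form a descending chain of ideals, and once these are stable an
    element can be corrected by a deeper one to have its last coefficient zero. *)
Lemma artinian_fg (M : lmodType k) m (g : 'I_m -> M) :
  artinian_mod k^o -> (forall x, exists c : 'I_m -> k, x = \sum_(i < m) c i *: g i) ->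
  artinian_mod M.
Proof.
move=> ak gM S dS.
have mono i j x : (i <= j)%N -> S j x -> S i x.
  elim: j => [|j IH]; first by rewrite leqn0 => /eqP->.
  by rewrite leq_eqVlt => /orP [/eqP->//|ij /dS]; apply: IH.
suff H p : exists n, forall i, (n <= i)%N -> forall c : 'I_m -> k,
    (forall j : 'I_m, (p <= j)%N -> c j = 0) ->
    S n (\sum_(j < m) c j *: g j) -> S i (\sum_(j < m) c j *: g j).
  have [n hn] := H m; exists n => i ni x; have [c ->] := gM x; apply: hn => // j.
  by rewrite leqNgt ltn_ord.
elim: p => [|p [n hn]].
  exists 0%N => i _ c c0 _; rewrite big1 => [|j _]; first exact: smem0.
  by rewrite c0 ?scale0r.
have [mp|pm] := leqP m p.
  exists n => i ni c c0; apply: hn => // j pj.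
  by have := leq_trans mp pj; rewrite leqNgt ltn_ord.
(* I i is the ideal of coefficients of generator number p in elements of S i that
   involve no later generator *)
pose o := Ordinal pm.
have [I hI] : exists I : nat -> submodule k^o, forall i a, I i a <->
    exists c : 'I_m -> k, [/\ forall j : 'I_m, (p < j)%N -> c j = 0, c o = a
                           & S i (\sum_(j < m) c j *: g j)].
  suff hi i : exists I : submodule k^o, forall a, I a <->
      exists c : 'I_m -> k, [/\ forall j : 'I_m, (p < j)%N -> c j = 0, c o = a
                             & S i (\sum_(j < m) c j *: g j)].
    by have [I hI] := choice hi; exists I.
  apply: submodule_ex => /=.
  - exists (fun=> 0); split=> //; rewrite big1 => [|j _]; [exact: smem0 | exact: scale0r].
  - move=> _ _ [c [c0 <- Sc]] [d [d0 <- Sd]]; exists (fun j => c j + d j); split=> //.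
      by move=> j pj; rewrite c0 ?d0 ?addr0.
    rewrite (eq_bigr (fun j => c j *: g j + d j *: g j)) => [|j _]; last exact: scalerDl.
    by rewrite big_split; apply: smemD.
  - move=> a _ [c [c0 <- Sc]]; exists (fun j => a * c j); split=> //.
      by move=> j pj; rewrite c0 ?mulr0.
    rewrite (eq_bigr (fun j => a *: (c j *: g j))) => [|j _]; last by rewrite scalerA.
    by rewrite -scaler_sumr; apply: smemZ.
have [|n' hn'] := ak I.
  by move=> i a /hI [c [? ? ?]]; apply/hI; exists c; split=> //; apply: dS.
exists (maxn n n') => i; rewrite geq_max => /andP [ni n'i] c c0 Sc.
have /hI [d [d0 do_ Sd]] : I i (c o).
  by apply/(hn' i n'i)/hI; exists c; split=> //; apply: mono Sc; apply: leq_maxr.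
have -> : \sum_(j < m) c j *: g j =
    \sum_(j < m) (c j - d j) *: g j + \sum_(j < m) d j *: g j.
  by rewrite -big_split /=; apply: eq_bigr => j _; rewrite -scalerDl subrK.
apply: smemD => //; apply: hn => //.
  move=> j; rewrite leq_eqVlt => /orP [/eqP pj|pj]; last by rewrite c0 ?d0 ?subrr.
  by have -> : j = o; [apply: val_inj | rewrite do_ subrr].
rewrite (eq_bigr (fun j => c j *: g j - d j *: g j)) => [|j _]; last exact: scalerBl.
rewrite sumrB; apply: smemB; first by apply: mono Sc; apply: leq_maxl.
exact: mono Sd.
Qed.

End Linear.

(** * Maximal ideals of an artinian ring *)

Section MaximalIdeals.
Variable k : comPzRingType.

Lemma sub_ideal (S : submodule k^o) : is_ideal S.
Proof.
split=> [|x y Sx Sy|a x Sx]; [exact: smem0 | exact: (smemD Sx Sy) | exact: (@smemZ k k^o S a x Sx)].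
Qed.

Lemma artinianW : artinian k -> artinian_mod k^o.
Proof.
move=> ak N dN; apply: (ak (fun i x => N i x)) => [i|//].
exact: sub_ideal.
Qed.

Lemma ideal_sub (I : k -> Prop) : is_ideal I -> exists S : submodule k^o, forall x, S x <-> I x.
Proof. by case=> I0 ID IM; apply: submodule_ex. Qed.

Lemma maximal_inv (m : k -> Prop) x : maximal_ideal m -> ~ m x -> exists y, m (y * x - 1).
Proof.
case=> -[m0 mD mM] m1 mmax nmx.
pose K := fun c => exists a b, m b /\ c = a * x + b.
apply: contrapT => ninv; apply: nmx; apply: (mmax K).
- split.
  + by exists 0, 0; rewrite mul0r addr0.
  + move=> _ _ [a [b [mb ->]]] [a' [b' [mb' ->]]]; exists (a + a'), (b + b').
    by split; [apply: mD | rewrite mulrDl addrACA].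
  + move=> c _ [a [b [mb ->]]]; exists (c * a), (c * b).
    by split; [apply: mM | rewrite mulrDr mulrA].
- by move=> b mb; exists 0, b; rewrite mul0r add0r.
- move=> [a [b [mb e]]]; apply: ninv; exists a.
  by rewrite e opprD addrA subrr add0r -mulN1r; apply: mM.
- by exists 1, 0; rewrite mul1r addr0.
Qed.

Lemma maximal_prime (m : k -> Prop) x y : maximal_ideal m -> m (x * y) -> ~ m x -> m y.
Proof.
move=> mm mxy nmx; have [z mz] := maximal_inv mm nmx.
have [[_ mD mM] _ _] := mm.
have -> : y = z * (x * y) + - y * (z * x - 1).
  by rewrite mulrBr mulr1 opprK mulNr mulrA [y * _]mulrC addrA subrr add0r.
by apply: mD; apply: mM.
Qed.

Hypothesis ak : artinian_mod k^o.

(** Take an ideal I minimal among those that do not kill x, and z in I with z x nonzero.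
    Every multiple of z that does not kill x again generates I, so c z x is either zero
    or c is invertible modulo the annihilator of z x. The minimum condition thus
    replaces Zorn's lemma. *)
Lemma ann_max (M : lmodType k) (x : M) : x <> 0 ->
  exists z : k, z *: x <> 0 /\ maximal_ideal (fun c => c *: (z *: x) = 0).
Proof.
move=> x0.
have [S1 hS1] := whole_submodule (k^o).
have [I [[z [Iz zx]] Imin]] := @artinian_min k k^o
  (fun I => exists z : k, I z /\ z *: x <> 0) S1 ak
  (ex_intro _ 1 (conj (proj2 (hS1 1) Logic.I) (fun e => x0 (etrans (esym (scale1r x)) e)))).
exists z; split=> //; split.
- split=> [|a b ha hb|a b hb]; first exact: scale0r.
    by rewrite scalerDl ha hb addr0.
  by rewrite -scalerA hb scaler0.
- by rewrite scale1r.
move=> K [K0 KD KM] annK K1 c Kc; apply: contrapT => czx; apply: K1.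
have [T hT] := mul_lin (c * z : k^o); have [U hU] := image_submodule T S1.
have Ucz : U (c * z) by apply/hU; exists 1; rewrite hS1 hT scale1r.
have UI y : U y -> I y.
  by case/hU => a [_ ->]; rewrite hT; apply: smemZ; apply: (@smemZ k k^o I c z).
have /hU [d [_]] : U z by apply: (Imin U) => //; exists (c * z); rewrite -scalerA.
rewrite hT => zE.
rewrite -[1](subrK (d * c)); apply: KD; last exact: KM.
by apply: annK; rewrite scalerBl scale1r scalerA -mulrA -[d * _]zE subrr.
Qed.

(** A multiple of the class of 1 in k / I has a maximal annihilator, and I annihilates k
    / I. *)
Lemma maximal_above (I : submodule k^o) : ~ I 1 ->
  exists m, maximal_ideal m /\ forall x : k, I x -> m x.
Proof.
move=> I1; have x0 : qclass I 1 <> 0 by rewrite qclass_eq0.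
have [z [_ mz]] := ann_max x0; eexists; split; first exact: mz.
move=> x Ix; suff : x *: (z *: qclass I 1) = 0 by [].
have -> : z *: qclass I 1 = qclass I z by rewrite -qclassZ; congr qclass; apply: mulr1.
rewrite -qclassZ; apply/qclass_eq0; have -> : x *: (z : k^o) = z *: (x : k^o) by apply: mulrC.
exact: smemZ.
Qed.

(** The semisimple quotient of an artinian ring is a finite product of fields, and z
    plays the part of the unit of one factor. An ideal B minimal among those not
    contained in m works: for m' <> m the intersection of B and m' is not contained in
    m, which is prime, so B lies in m' by minimality. *)
Lemma maximal_separate (m : k -> Prop) : maximal_ideal m ->
  exists z, ~ m z /\ forall m', maximal_ideal m' -> (exists x, m x /\ ~ m' x) -> m' z.
Proof.
move=> mm; have [_ m1 _] := mm.
have [S1 hS1] := whole_submodule (k^o).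
have [B [[z [Bz mz]] Bmin]] := @artinian_min k k^o
  (fun I => exists z : k, I z /\ ~ m z) S1 ak (ex_intro _ 1 (conj (proj2 (hS1 1) Logic.I) m1)).
exists z; split=> // m' mm' [x [mx m'x]].
have [im' m'1 m'max] := mm'; have [_ _ m'M] := im'.
have [y [m'y my]] : exists y, m' y /\ ~ m y.
  apply: contrapT => ny; apply: m'x; have [mi _ mmax] := mm; apply: (m'max m) => // y m'y.
  by apply: contrapT => my; apply: ny; exists y.
have [T hT] := ideal_sub im'.
have [U hU] := meet_submodule B T.
suff /hU [_ /hT] : U z by [].
apply: (Bmin U) => // [|u /hU [] //]; exists (y * z); split.
  by apply/hU; split; [apply: (smemZ y Bz) | apply/hT; rewrite mulrC; apply: m'M].
by move=> myz; apply: mz; apply: maximal_prime my.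
Qed.

End MaximalIdeals.

(** * Matlis duality *)

Section Matlis.
Variables (k : comPzRingType) (J : lmodType k).
Hypothesis ak : artinian_mod k^o.
Hypothesis envJ : injective_envelope_of_residue_ring J.

(** Injectivity of J in the form in which it gets used: p need not be injective, and q
    only has to factor through its image. *)
Lemma functional_ext (M N : lmodType k) (p : lhom N M) (q : lhom N J) :
  (forall x, p x = 0 -> q x = 0) -> exists g : lhom M J, forall x, g (p x) = q x.
Proof.
move=> pq; have [R [r [i [_ _ [_ injJ _]]]]] := envJ.
have [S hS] := kernel_submodule p.
have [p' p'E] := quot_lift (fun x Sx => proj1 (hS x) Sx).
have [q' q'E] := quot_lift (fun x Sx => pq x (proj1 (hS x) Sx)).
have [|g gE] := injJ _ _ (p' : {linear _ -> _}) (q' : {linear _ -> _}).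
  move=> x y; rewrite -(qreprK x) -(qreprK y) => e.
  apply/qclass_eq/hS; rewrite lhB -!p'E; apply/eqP; rewrite subr_eq0; exact/eqP.
by exists g => x; rewrite -p'E -q'E; apply: gE.
Qed.

(** The element that lies outside m and in all other maximal ideals has a class in k /
    rad k that m annihilates, and k / rad k embeds into J. *)
Lemma socle_nonzero m : maximal_ideal m ->
  exists j : J, j <> 0 /\ forall c, m c -> c *: j = 0.
Proof.
move=> mm; have [R [p [i [ps pr [ii _ _]]]]] := envJ.
have [z [mz sep]] := maximal_separate ak mm.
exists (i (p z)); split.
  move=> e; apply: mz; have /pr : p z = 0 by apply: ii; rewrite e raddf0.
  by apply.
move=> c mc; rewrite -linearZZ -linearZZ.
suff /pr -> : jacobson_radical (c *: (z : k^o)) by rewrite raddf0.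
move=> m' mm'; have [[_ _ m'M] _ _] := mm'.
have [[x [mx m'x]]|no] := pselect (exists x, m x /\ ~ m' x).
  by apply: m'M; apply: sep => //; exists x.
rewrite -[_ *: _]/(c * z) mulrC; apply: m'M; apply: contrapT => m'c; apply: no.
by exists c.
Qed.

(** J is an essential extension of k / rad k, so its m-torsion lies in k / rad k. There
    it is one-dimensional over k / m: an element of k whose class is killed by m lies in
    every maximal ideal other than m, and is determined modulo rad k by its residue
    modulo m. *)
Lemma socle_cyclic m (j j' : J) : maximal_ideal m -> j <> 0 ->
  (forall c, m c -> c *: j = 0) -> (forall c, m c -> c *: j' = 0) ->
  exists c, j' = c *: j.
Proof.
move=> mm; have [R [p [i [ps pr [ii _ ess]]]]] := envJ.
(* essentiality puts a multiple a j0 into k / rad k, and a is invertible modulo m *)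
have lift j0 : j0 <> 0 -> (forall c, m c -> c *: j0 = 0) -> exists r, j0 = i (p r).
  move=> j0n mj0; have [f fE] := mul_lin j0; have [S1 hS1] := whole_submodule (k^o).
  have [S hS] := image_submodule f S1.
  have [y [[a ya] y0]] : exists y, (exists a, i y = a *: j0) /\ y <> 0.
    apply: contrapT => no; apply: j0n; apply: (ess S).
      move=> y /hS [a [_ ya]]; apply: contrapT => y0; apply: no; exists y.
      by split=> //; exists a; rewrite ya fE.
    by apply/hS; exists 1; rewrite hS1 fE scale1r.
  have ma : ~ m a by move=> ma; apply: y0; apply: ii; rewrite ya mj0 ?raddf0.
  have [b mb] := maximal_inv mm ma; have [r yr] := ps y.
  exists (b *: r); rewrite !linearZZ -yr ya scalerA.
  by apply/eqP; rewrite eq_sym -subr_eq0 -[X in _ - X]scale1r -scalerBl mj0.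
have [[_ _ mM] _ _] := mm.
move=> jn mj mj'; have [->|/eqP j'n] := eqVneq j' 0; first by exists 0; rewrite scale0r.
have [r jr] := lift _ jn mj; have [r' jr'] := lift _ j'n mj'.
(* a representative r0 of an m-torsion class lies in every maximal ideal other than m *)
have inr r0 j0 : j0 = i (p r0) -> (forall c, m c -> c *: j0 = 0) ->
    forall m', maximal_ideal m' -> (exists x, m x /\ ~ m' x) -> m' r0.
  move=> j0r mj0 m' mm' [x [mx m'x]]; apply: (maximal_prime mm' _ m'x).
  apply: (proj1 (pr (x * r0)) _ _ mm'); apply: ii.
  by rewrite -[x * r0]/(x *: (r0 : k^o)) !linearZZ -j0r mj0 ?raddf0.
have mr : ~ m r.
  move=> mr; apply: jn; rewrite jr; have /pr -> : jacobson_radical r; last by rewrite raddf0.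
  move=> m' mm'; have [h|no] := pselect (exists x, m x /\ ~ m' x).
    exact: (inr r j jr mj m' mm' h).
  by apply: contrapT => m'r; apply: no; exists r.
have [b mb] := maximal_inv mm mr; exists (r' * b).
have jrad : jacobson_radical (r' * b * r - r').
  have -> : r' * b * r - r' = r' * (b * r - 1) by rewrite mulrBr mulr1 mulrA.
  move=> m' mm'; have [[_ _ m'M] _ _] := mm'.
  have [h|no] := pselect (exists x, m x /\ ~ m' x).
    by rewrite mulrC; apply: m'M; exact: (inr r' j' jr' mj' m' mm' h).
  by apply: m'M; apply: contrapT => nm'; apply: no; exists (b * r - 1).
apply/eqP; rewrite eq_sym -subr_eq0 jr jr' -!linearZZ -!raddfB.
by apply/eqP; apply: etrans (congr1 i (proj2 (pr _) jrad)) _; apply: raddf0.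
Qed.

Lemma cogenerator (M : lmodType k) (x : M) : x <> 0 -> exists f : lhom M J, f x <> 0.
Proof.
move=> x0; have [z [zx mz]] := ann_max ak x0.
have [j [j0 mj]] := socle_nonzero mz.
have [p pE] := mul_lin (z *: x); have [q qE] := mul_lin j.
have [|g gE] := @functional_ext _ _ p q; first by move=> c; rewrite pE qE => /mj.
exists g => gx; apply: j0; rewrite -[j]scale1r -qE -gE pE scale1r.
by rewrite lhZ gx scaler0.
Qed.

Lemma cogenerator_mod (M : lmodType k) (S : submodule M) (x : M) : ~ S x ->
  exists f : lhom M J, f x <> 0 /\ forall y, S y -> f y = 0.
Proof.
move=> Sx; have [|f fx] := @cogenerator _ (qclass S x); first by rewrite qclass_eq0.
have [g gE] : exists g : lhom M J, forall y, g y = f (qclass S y).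
  by apply: linear_lhom => a y z; rewrite qclassD qclassZ lhD lhZ.
by exists g; rewrite gE; split=> // y /qclass_eq0 Sy; rewrite gE Sy lh0.
Qed.

(** Nakayama's lemma for a module of arbitrary size: N has a nonzero functional killed
    by some maximal ideal m. Let I be an ideal minimal among those with I N nonzero,
    generated by c with c x nonzero, and let m contain the annihilator of c x. If x
    belonged to m N, then c b z would be nonzero for some b in m and z in N; minimality
    gives c = d c b, so 1 - d b kills c x, and 1 is in m. *)
Lemma simple_quotient (M : lmodType k) (N : submodule M) (x0 : M) : N x0 -> x0 <> 0 ->
  exists m (f : lhom M J), [/\ maximal_ideal m, exists x, N x /\ f x <> 0
                             & forall c x, m c -> N x -> f (c *: x) = 0].
Proof.
move=> Nx0 x0n; have [S1 hS1] := whole_submodule (k^o).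
have [I [[c [x [Ic Nx cx]]] Imin]] := @artinian_min k k^o
  (fun I => exists (c : k) (x : M), [/\ I c, N x & c *: x <> 0]) S1 ak
  (ex_intro _ 1 (ex_intro _ x0 (And3 (proj2 (hS1 1) Logic.I) Nx0
     (fun e => x0n (etrans (esym (scale1r x0)) e))))).
have [A hA] : exists A : submodule k^o, forall a : k, A a <-> a *: (c *: x) = 0.
  apply: submodule_ex => [|a b ha hb|a b hb]; first exact: scale0r.
    by rewrite scalerDl ha hb addr0.
  by rewrite -[a *: b]/(a * b) -scalerA hb scaler0.
have [|m [mm Am]] := @maximal_above _ ak A; first by move/hA; rewrite scale1r.
pose mN := subspan (fun y => exists (b : k) z, [/\ m b, N z & y = b *: z]).
have [T|nT] := pselect (mN x); last first.
  have [f [fx f0]] := cogenerator_mod nT.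
  exists m, f; split=> //; first by exists x.
  by move=> b z mb Nz; apply: f0 => S; apply; exists b, z.
have [K hK] : exists K : submodule M, forall y, K y <-> c *: y = 0.
  apply: submodule_ex => [|y z ha hb|a y hb]; first exact: scaler0.
    by rewrite scalerDr ha hb addr0.
  by rewrite scalerA mulrC -scalerA hb scaler0.
have [b [z [mb Nz cbz]]] : exists (b : k) z, [/\ m b, N z & c *: (b *: z) <> 0].
  apply: contrapT => no; apply: cx; apply/hK/T => _ [b [z [mb Nz ->]]].
  by apply/hK; apply: contrapT => cbz; apply: no; exists b, z.
have [f fE] := mul_lin (c * b : k^o); have [U hU] := image_submodule f S1.
have /hU [d [_]] : U c.
  apply: (Imin U) => //; first exists (c * b), z; rewrite -?scalerA.
    by split=> //; apply/hU; exists 1; rewrite hS1 fE scale1r.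
  move=> y /hU [a [_ ->]]; rewrite fE; apply: smemZ; rewrite mulrC.
  exact: (@smemZ k k^o I b c).
rewrite fE => cE; have [[_ mD mM] m1 _] := mm; case: m1.
rewrite -[1](subrK (d * b)); apply: mD; last exact: mM.
apply: Am; apply/hA; rewrite scalerBl scale1r [in X in _ - X]scalerA.
by rewrite -mulrA [b * c]mulrC -[d * _]cE subrr.
Qed.

(** Suppose not, and let N be a minimal submodule such that some functional zeta on D M
    vanishes on the annihilator of N without being the evaluation at an element of N.
    Choose f0 with a nonzero value f0(x1) on N and killed by m on N. As the m-torsion of
    J is one-dimensional, subtracting a suitable multiple of the evaluation at x1 makes
    zeta vanish on f0, hence on the annihilator of the smaller submodule of N on which
    f0 is zero, where minimality applies. *)
Lemma matlis_reflexive (M : lmodType k) (xi : lhom (lhom M J) J) : artinian_mod M ->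
  exists x, forall f : lhom M J, xi f = f x.
Proof.
move=> aM.
pose R (N : submodule M) := forall xi : lhom (lhom M J) J,
  (forall f : lhom M J, (forall x, N x -> f x = 0) -> xi f = 0) ->
  exists x, N x /\ forall f : lhom M J, xi f = f x.
have [S1 hS1] := whole_submodule M.
suff : R S1.
  case/(_ xi) => [f f0|x [_ hx]]; last by exists x.
  have -> : f = 0 by apply: lhomP => x; rewrite f0 //; apply/hS1.
  exact: lh0.
apply: contrapT => nR.
have [N [nRN Nmin]] := @artinian_min k M (fun N => ~ R N) S1 aM nR.
have [[x0 [Nx0 x0n]]|N0] := pselect (exists x0, N x0 /\ x0 <> 0); last first.
  apply: nRN => zeta z0; exists 0; split=> [|f]; first exact: smem0.
  rewrite z0 ?lh0 // => x Nx; apply: contrapT => fx; apply: N0; exists x; split=> // xE.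
  by apply: fx; rewrite xE lh0.
have [m [f0 [mm [x1 [Nx1 fx1]] mN]]] := simple_quotient Nx0 x0n.
have [K hK] := kernel_submodule f0; have [N' hN'] := meet_submodule N K.
have : R N'.
  apply: contrapT => nRN'; apply: fx1; apply/hK.
  have N'N x : N' x -> N x by case/hN'.
  by have /hN' [] := Nmin _ nRN' N'N x1 Nx1.
move=> RN'; apply: nRN => zeta z0.
have mf c : m c -> c *: f0 x1 = 0 by move=> mc; rewrite -lhZ mN.
have [|a za] := socle_cyclic mm fx1 mf (_ : forall c, m c -> c *: zeta f0 = 0).
  by move=> c mc; rewrite -lhZ z0 // => x Nx;  rewrite lhE -lhZ mN.
have [zeta' z'E] : exists z' : lhom (lhom M J) J,
    forall f : lhom M J, z' f = zeta f - a *: lfun_of f x1.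
  apply: linear_lhom => b f g; rewrite lhD lhZ !lhE !(scalerDr, opprD) scalerN.
  by rewrite !scalerA mulrC addrACA.
have [f f0N|x [Nx xE]] := RN' zeta'; last first.
  exists (x + a *: x1); split; last first.
    by move=> f; rewrite lhD lhZ -xE z'E subrK.
  by apply: smemD; [case/hN': Nx | apply: smemZ].
(* f vanishes on N', so it is a multiple of f0 on N *)
have [|b fb] := socle_cyclic mm fx1 mf (_ : forall c, m c -> c *: f x1 = 0).
  move=> c mc; rewrite -lhZ; apply: f0N; apply/hN'; split; first exact: smemZ.
  by apply/hK; apply: mN.
have e : zeta (f - b *: f0) = 0.
  apply: z0 => x Nx; rewrite !lhE.
  have [|c xc] := socle_cyclic mm fx1 mf (_ : forall c, m c -> c *: f0 x = 0).
    by move=> c mc; rewrite -lhZ mN.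
  have /f0N : N' (x - c *: x1).
    apply/hN'; split; first by apply: smemB => //; apply: smemZ.
    by apply/hK; rewrite lhB lhZ xc subrr.
  rewrite lhB lhZ xc fb => /eqP; rewrite subr_eq0 scalerA mulrC -scalerA => /eqP ->.
  by rewrite subrr.
move: e; rewrite lhB lhZ => /eqP; rewrite subr_eq0 => /eqP e.
by rewrite z'E e fb za !scalerA mulrC subrr.
Qed.

End Matlis.

(** * Functionals on a submodule *)

Section SubmoduleType.
Variables (k : comPzRingType) (M : lmodType k) (S : submodule M).
Lemma smem_pred_scale : GRing.scaler_closed (smem_pred S).
Proof. by move=> a x /asboolP Sx; apply/asboolP/smemZ. Qed.
HB.instance Definition _ := GRing.isScaleClosed.Build k M (smem_pred S) smem_pred_scale.
Record submod := SubMod { submod_val : M; submod_in : submod_val \in smem_pred S }.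
HB.instance Definition _ := [isSub for submod_val].
HB.instance Definition _ := [Choice of submod by <:].
HB.instance Definition _ := [SubChoice_isSubLmodule of submod by <:].
End SubmoduleType.

Lemma submodule_functional (k : comPzRingType) (J M : lmodType k) (S : submodule M) (f : M -> J) :
  injective_envelope_of_residue_ring J ->
  (forall x y, S x -> S y -> f (x + y) = f x + f y) -> (forall a x, S x -> f (a *: x) = a *: f x) ->
  exists g : lhom M J, forall x, S x -> g x = f x.
Proof.
move=> envJ fD fZ.
have Sv (x : submod S) : S (submod_val x) by apply/asboolP/submod_in.
have [p pE] : exists p : lhom (submod S) M, forall x, p x = submod_val x by exact: linear_lhom.
have [|q qE] := @linear_lhom _ (submod S) J (fun x => f (submod_val x)).
  by move=> a x y; rewrite -fZ // -fD //; apply: smemZ.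
have [|g gE] := @functional_ext _ J envJ _ _ p q.
  move=> x; rewrite pE qE => ->; have := fZ 0 0 (smem0 S); by rewrite !scale0r.
exists g => x Sx; pose y := @SubMod _ _ S x (introT (asboolP _) Sx).
by have := gE y; rewrite pE qE.
Qed.

(** * The dual of a ring over another ring *)

Definition restr (k Z : comPzRingType) (io : {rmorphism k -> Z}) (M : lmodType Z) : Type := M.

Section Restriction.
Variables (k Z : comPzRingType) (io : {rmorphism k -> Z}) (M : lmodType Z).
HB.instance Definition _ := GRing.Zmodule.on (restr io M).
Definition restr_scale (a : k) (x : restr io M) : restr io M := io a *: (x : M).
Lemma restr_scaleA a b x : restr_scale a (restr_scale b x) = restr_scale (a * b) x.
Proof. by rewrite /restr_scale scalerA rmorphM. Qed.
Lemma restr_scale1 : left_id 1 restr_scale.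
Proof. by move=> x; rewrite /restr_scale rmorph1 scale1r. Qed.
Lemma restr_scaleDr : right_distributive restr_scale +%R.
Proof. by move=> a x y; apply: scalerDr. Qed.
Lemma restr_scaleDl x : {morph restr_scale^~ x : a b / a + b}.
Proof. by move=> a b; rewrite /restr_scale /= rmorphD; apply: scalerDl. Qed.
HB.instance Definition _ :=
  GRing.Zmodule_isLmodule.Build k (restr io M)
    restr_scaleA restr_scale1 restr_scaleDr restr_scaleDl.
Lemma restrZ a (x : M) : a *: (x : restr io M) = io a *: x :> M. Proof. by []. Qed.
End Restriction.

(** The injective Z-module Hom_k(Z, J), with Z acting on the argument. *)
Definition coind (k Z : comPzRingType) (J : lmodType k) (io : {rmorphism k -> Z}) : Type :=
  lhom (restr io Z^o) J.

Section Coinduced.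
Variables (k Z : comPzRingType) (J : lmodType k) (io : {rmorphism k -> Z}).
Local Notation W := (coind J io).
HB.instance Definition _ := GRing.Zmodule.on W.
Definition coind_eval (f : W) : Z -> J := fun z => lfun_of f z.
Lemma coind_evalP (f g : W) : (forall z, coind_eval f z = coind_eval g z) -> f = g.
Proof. by move=> fg; apply: (@lhomP k (restr io Z^o) J f g) => z; apply: fg. Qed.
Lemma coind_ex (f : Z -> J) : (forall x y, f (x + y) = f x + f y) ->
  (forall a x, f (io a * x) = a *: f x) -> exists g : W, forall z, coind_eval g z = f z.
Proof.
move=> fD fZ; have [|g gE] := @linear_lhom _ (restr io Z^o) J f; last by exists g.
by move=> a x y; rewrite fD -fZ.
Qed.
Lemma coind_evalD f (x y : Z) : coind_eval f (x + y) = coind_eval f x + coind_eval f y.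
Proof. exact: lhD. Qed.
Lemma coind_evalZ f a (x : Z) : coind_eval f (io a * x) = a *: coind_eval f x.
Proof. exact: (@lhZ k (restr io Z^o) J f a x). Qed.
Lemma coind_eval_add f g z : coind_eval (f + g) z = coind_eval f z + coind_eval g z.
Proof. by []. Qed.
Lemma coind_eval0 z : coind_eval 0 z = 0. Proof. by []. Qed.

Lemma coind_scale_ex z (f : W) : exists g : W, forall w, coind_eval g w = coind_eval f (z * w).
Proof.
apply: coind_ex => [x y|a x]; first by rewrite mulrDr coind_evalD.
by rewrite mulrCA coind_evalZ.
Qed.
Definition coind_scale z f : W := projT1 (cid (coind_scale_ex z f)).
Lemma coind_scaleE z f w : coind_eval (coind_scale z f) w = coind_eval f (z * w).
Proof. exact: (projT2 (cid (coind_scale_ex z f))). Qed.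
Lemma coind_scaleA a b x : coind_scale a (coind_scale b x) = coind_scale (a * b) x.
Proof. by apply: coind_evalP => z; rewrite !coind_scaleE mulrCA mulrA. Qed.
Lemma coind_scale1 : left_id 1 coind_scale.
Proof. by move=> x; apply: coind_evalP => z; rewrite coind_scaleE mul1r. Qed.
Lemma coind_scaleDr : right_distributive coind_scale +%R.
Proof. by move=> a x y; apply: coind_evalP => z; rewrite coind_eval_add !coind_scaleE. Qed.
Lemma coind_scaleDl x : {morph coind_scale^~ x : a b / a + b}.
Proof.
move=> a b; apply: coind_evalP => z.
by rewrite coind_eval_add !coind_scaleE mulrDl coind_evalD.
Qed.
HB.instance Definition _ :=
  GRing.Zmodule_isLmodule.Build Z W coind_scaleA coind_scale1 coind_scaleDr coind_scaleDl.
Lemma coind_eval_scale z (f : W) w : coind_eval (z *: f) w = coind_eval f (z * w).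
Proof. exact: coind_scaleE. Qed.
End Coinduced.

Section ChangeOfRings.
Variables (k : comPzRingType) (J : lmodType k).
Hypothesis ak : artinian_mod k^o.
Hypothesis envJ : injective_envelope_of_residue_ring J.
Variable Z : comPzRingType.

Lemma artinian_restr (io : {rmorphism k -> Z}) :
  artinian_mod (restr io Z^o) -> artinian_mod Z^o.
Proof.
move=> aZ N dN.
have H i : exists S : submodule (restr io Z^o), forall x : Z, S x <-> N i x.
  apply: submodule_ex => [|x y Nx Ny|a x Nx]; [exact: smem0 | exact: smemD | ].
  exact: (@smemZ Z Z^o (N i) (io a) x).
have [S hS] := choice H.
have [|n hn] := aZ S; first by move=> i x /hS Sx; apply/hS/dN.
by exists n => i ni x /hS Sx; apply/hS/(hn i ni).
Qed.

Section One.
Variable io : {rmorphism k -> Z}.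
Hypothesis aZ : artinian_mod (restr io Z^o).
Local Notation W := (coind J io).

(** A k-functional on Z that kills m and not 1 exists because J cogenerates. *)
Lemma coind_socle_nonzero (m : Z -> Prop) : maximal_ideal m ->
  exists w : W, w <> 0 /\ forall c, m c -> c *: w = 0.
Proof.
case=> -[m0 mD mM] m1 _.
have [S hS] : exists S : submodule (restr io Z^o), forall x : Z, S x <-> m x.
  apply: submodule_ex => // a x mx; exact: (mM (io a) x mx).
have [|f [f1 f0]] := @cogenerator_mod k J ak envJ (restr io Z^o) S 1; first by move/hS.
exists (f : W); split=> [f00|c mc]; first by apply: f1; rewrite f00.
apply: coind_evalP => z; rewrite coind_eval_scale coind_eval0; apply: f0; apply/hS.
by rewrite mulrC; apply: mM.
Qed.

(** Otherwise reflexivity gives z in Z on which all multiples of w vanish while w' does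
    not. Then z is not in m, as m kills w'; so z is invertible modulo m, and w vanishes
    everywhere. *)
Lemma coind_socle_cyclic (m : Z -> Prop) (w w' : W) : maximal_ideal m -> w <> 0 ->
  (forall c, m c -> c *: w = 0) -> (forall c, m c -> c *: w' = 0) ->
  exists z, w' = z *: w.
Proof.
move=> mm wn mw mw'.
pose D : lmodType k := lhom (restr io Z^o) J.
have [S hS] : exists S : submodule D, forall f : D, S f <-> exists z, (f : W) = z *: w.
  apply: submodule_ex => [|_ _ [z ->] [z' ->]|a _ [z ->]].
  - by exists 0; rewrite scale0r.
  - by exists (z + z'); rewrite scalerDl.
  - exists (io a * z); apply: coind_evalP => x.
    by rewrite coind_eval_scale -mulrA coind_evalZ -coind_eval_scale.
apply: contrapT => no.
have [|xi [xi1 xi0]] := @cogenerator_mod k J ak envJ D S w'; first by move/hS.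
have [z zE] := matlis_reflexive ak envJ xi aZ.
have mz : ~ m z.
  move=> mz; apply: xi1; rewrite zE; have := mw' _ mz.
  move/(congr1 (fun f : W => coind_eval f 1)); rewrite coind_eval_scale mulr1 coind_eval0; exact.
have [y my] := maximal_inv mm mz; apply: wn; apply: coind_evalP => x; rewrite coind_eval0.
have e u : coind_eval (u *: w) z = 0.
  by apply: etrans (esym (zE (u *: w : W))) (xi0 _ _); apply/hS; exists u.
have -> : x = x * y * z + - x * (y * z - 1).
  by rewrite mulrBr mulr1 mulNr opprK mulrA addrA subrr add0r.
by rewrite coind_evalD -coind_eval_scale e add0r mulrC -coind_eval_scale mw.
Qed.

(** Evaluating g(f) at 1 is a k-functional on the dual of Z, so it is the evaluation at
    some z by reflexivity; linearity over Z then gives g(f) = z f. *)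
Lemma coind_endo (g : lhom W W) : exists z, forall w, g w = z *: w.
Proof.
pose D : lmodType k := lhom (restr io Z^o) J.
have [xi xiE] : exists xi : lhom D J, forall f : D, xi f = coind_eval (g (f : W)) 1.
  apply: linear_lhom => a f f'.
  have -> : a *: f + f' = io a *: (f : W) + f' :> W.
    by apply: coind_evalP => x; rewrite [RHS]coind_eval_add coind_eval_scale coind_evalZ.
  by rewrite lhD lhZ coind_eval_add coind_eval_scale coind_evalZ.
have [z zE] := matlis_reflexive ak envJ xi aZ; exists z => w; apply: coind_evalP => v.
have := zE (v *: w : W); rewrite xiE -[RHS]/(coind_eval (v *: w) z) lhZ.
rewrite !coind_eval_scale mulr1 => ->.
by rewrite mulrC.
Qed.
End One.

(** Hom_k(Z, J) is injective over Z: a Z-linear map into it is the same as a k-linear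
    map into J. *)
Lemma coind_ext (io io' : {rmorphism k -> Z}) (x : coind J io) (y : coind J io') :
  (forall z, z *: x = 0 -> z *: y = 0) ->
  exists g : lhom (coind J io) (coind J io'), g x = y.
Proof.
move=> xy.
have [p pE] : exists p : lhom (restr io' Z^o) (restr io' (coind J io)), forall z : Z, p z = z *: x.
  by apply: linear_lhom => a b c; rewrite scalerDl restrZ -scalerA.
have [|g gE] := @functional_ext k J envJ _ _ p (y : lhom _ _).
  move=> z; rewrite pE => /xy /(congr1 (fun f => coind_eval f 1)).
  by rewrite coind_eval_scale mulr1 coind_eval0.
(* the Z-linear map attached to the k-functional g *)
have H w : exists v : coind J io', forall z, coind_eval v z = g (z *: w : restr io' (coind J io)).
  apply: coind_ex => [z z'|a z]; first by rewrite scalerDl lhD.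
  by rewrite -scalerA; apply: (@lhZ k (restr io' (coind J io)) J g a (z *: w)).
have [h hE] := choice H.
have [|f fE] := @linear_lhom _ (coind J io) (coind J io') h.
  move=> a u v; apply: coind_evalP => z.
  by rewrite coind_eval_add coind_eval_scale !hE scalerDr lhD scalerA mulrC.
exists f; rewrite fE; apply: coind_evalP => z; rewrite hE -pE gE //.
Qed.

(** A Z-linear map is injective if it is so on the m-torsion of each maximal ideal m;
    call m good for h in this case. Choose h such that the intersection of its good
    ideals is minimal. If m were not good, then h kills a vector w0 generating the
    m-torsion. Let g send w0 to a nonzero m-torsion vector, and let z lie outside m and
    in all other maximal ideals. Adding z g to h makes m good and keeps the good ideals
    good, which contradicts minimality since z is in all of these but not in m. *)
Lemma coind_mono (io io' : {rmorphism k -> Z}) :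
  artinian_mod (restr io Z^o) -> artinian_mod (restr io' Z^o) ->
  exists h : lhom (coind J io) (coind J io'), forall w, h w = 0 -> w = 0.
Proof.
move=> aZ aZ'; have aZo := artinian_restr aZ.
pose good (h : lhom (coind J io) (coind J io')) (m : Z -> Prop) :=
  forall w, (forall c, m c -> c *: w = 0) -> h w = 0 -> w = 0.
pose F (I : submodule Z^o) := exists h, forall z : Z,
  I z <-> forall m, maximal_ideal m -> good h m -> m z.
have Fex h : exists I : submodule Z^o, forall z : Z,
    I z <-> forall m, maximal_ideal m -> good h m -> m z.
  apply: submodule_ex => [m [[m0 _ _] _ _] _ //|x y Ix Iy m mm gm|a x Ix m mm gm].
    by have [[_ mD _] _ _] := mm; apply: mD; [apply: Ix | apply: Iy].
  by have [[_ _ mM] _ _] := mm; apply: mM; apply: Ix.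
have [I0 hI0] := Fex 0.
have [I [[h hI] Imin]] := @artinian_min Z Z^o F I0 aZo (ex_intro _ 0 hI0).
suff allgood m : maximal_ideal m -> good h m.
  exists h => w hw; apply: contrapT => wn.
  have [z [zw mz]] := ann_max aZo wn; apply: zw.
  by apply: (allgood _ mz) => //; rewrite lhZ hw scaler0.
move=> mm; apply: contrapT => /existsNP [w0] /not_implyP [mw0] /not_implyP [hw0 w0n].
have [w0' [w0'n mw0']] := coind_socle_nonzero io' mm.
have annm (V : lmodType Z) (v : V) c : v <> 0 -> (forall c, m c -> c *: v = 0) -> c *: v = 0 -> m c.
  move=> vn mv cv; apply: contrapT => mc; have [b mb] := maximal_inv mm mc; apply: vn.
  have := mv _ mb; rewrite scalerBl scale1r -scalerA cv scaler0 sub0r => /eqP.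
  by rewrite oppr_eq0 => /eqP.
have [|g gE] := @coind_ext io io' w0 w0'; first by move=> z /(annm _ _ _ w0n mw0) /mw0'.
have [z [mz sep]] := maximal_separate aZo mm.
have same m' : maximal_ideal m' -> ~ (exists x, m x /\ ~ m' x) -> forall x, m x <-> m' x.
  move=> mm' no x; have mm'x y : m y -> m' y.
    by move=> my; apply: contrapT => m'y; apply: no; exists y.
  have [_ _ mmax] := mm; have [m'i m'1 _] := mm'.
  by split; [apply: mm'x | apply: mmax].
have notgood m' : maximal_ideal m' -> good h m' -> exists x, m x /\ ~ m' x.
  move=> mm' gm'; apply: contrapT => no; apply: w0n; apply: gm' => // c m'c.
  by apply: mw0; apply/(same m').
pose h' := h + z *: g.
have gm : good h' m.
  move=> w mw; have [c ->] := coind_socle_cyclic aZ mm w0n mw0 mw.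
  rewrite /h' lhomE_D lhomE_Z !lhZ hw0 scaler0 add0r gE scalerA => /(annm _ _ _ w0'n mw0') mzc.
  by apply: mw0; apply: maximal_prime mzc mz.
have gm' m' : maximal_ideal m' -> good h m' -> good h' m'.
  move=> mm' gm' w m'w; rewrite /h' lhomE_D lhomE_Z -lhZ m'w ?lh0 ?addr0; first exact: gm'.
  exact: sep (notgood _ mm' gm').
have [I' hI'] := Fex h'.
have I'z : I' z.
  apply: (Imin I' _ _ z).
  - by exists h'.
  - by move=> x /hI' I'x; apply/hI => m' mm' /(gm' _ mm'); apply: I'x.
  - by apply/hI => m' mm' /(notgood _ mm') h1; apply: sep.
by apply: mz; apply: (proj1 (hI' z) I'z).
Qed.

(** There are injections both ways by [coind_mono]. Their composites are multiplications
    by elements of Z, and an element of Z that acts injectively is a unit because every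
    maximal ideal kills a nonzero vector. *)
Lemma coind_iso (io io' : {rmorphism k -> Z}) :
  artinian_mod (restr io Z^o) -> artinian_mod (restr io' Z^o) ->
  exists (h : lhom (coind J io) (coind J io')) (h' : lhom (coind J io') (coind J io)),
    cancel h h' /\ cancel h' h.
Proof.
move=> aZ aZ'; have aZo := artinian_restr aZ.
have unit_of (i : {rmorphism k -> Z}) (z : Z) : artinian_mod (restr i Z^o) ->
    (forall w : coind J i, z *: w = 0 -> w = 0) -> exists y, y * z = 1.
  move=> ai zi; apply: contrapT => no.
  have [f fE] := mul_lin (z : Z^o); have [S1 hS1] := whole_submodule (Z^o).
  have [S hS] := image_submodule f S1.
  have [|m [mm Sm]] := @maximal_above _ aZo S.
    by move/hS => [y [_ yE]]; apply: no; exists y; rewrite yE fE.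
  have [w [wn mw]] := coind_socle_nonzero i mm; apply: wn; apply: zi; apply: mw; apply: Sm.
  by apply/hS; exists 1; rewrite hS1 fE scale1r.
have [h hi] := coind_mono aZ aZ'; have [h' h'i] := coind_mono aZ' aZ.
have comp (U V X : lmodType Z) (f : lhom V X) (g : lhom U V) :
    exists r : lhom U X, forall x, r x = f (g x).
  by apply: linear_lhom => a x y; rewrite !lhD !lhZ.
have [r rE] := comp _ _ _ h' h; have [z zE] := coind_endo aZ r.
have [|y yE] := unit_of io z aZ; first by move=> w; rewrite -zE rE => /h'i /hi.
exists h, (y *: h'); split=> w; first by rewrite lhomE_Z -rE zE scalerA yE scale1r.
apply/eqP; rewrite lhomE_Z -subr_eq0; apply/eqP/h'i.
by rewrite lhB -rE zE scalerA mulrC yE scale1r subrr.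
Qed.

End ChangeOfRings.

(** * Idempotents: lifting and splitting *)

Section IdempotentLifting.
Variables (k : comPzRingType) (C : lincat k) (Y : C).

(** The multiples of t^i by endomorphisms commuting with t form a descending chain, so p
    = t^(n+1) satisfies p = p^2 s for some s commuting with t. Then p s is idempotent,
    and it is congruent to t modulo K because all positive powers of t are. *)
Lemma idempotent_lift (K : submodule (hom Y Y)) (t : hom Y Y) :
  artinian_mod (hom Y Y) ->
  (forall g f, K f -> K (g \oc f)) -> (forall g f, K g -> K (g \oc f)) ->
  K (t \oc t - t) -> exists e, e \oc e = e /\ K (e - t).
Proof.
move=> aY Kl Kr Kt.
pose pw i := iter i (mcomp t) (idm Y).
have pwS i : pw i.+1 = pw i \oc t.
  by elim: i => [|i IH]; rewrite /pw /= ?mcompm1 ?mcomp1m // -mcompA -IH.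
have pwC s i : s \oc t = t \oc s -> s \oc pw i = pw i \oc s.
  move=> st; elim: i => [|i IH]; first by rewrite mcompm1 mcomp1m.
  by rewrite /pw /= -/(pw i) mcompA st -mcompA IH mcompA.
have HN i : exists N : submodule (hom Y Y), forall x,
    N x <-> exists s, s \oc t = t \oc s /\ x = pw i \oc s.
  apply: submodule_ex => [|_ _ [s [sC ->]] [s' [s'C ->]]|a _ [s [sC ->]]].
  - by exists 0; rewrite !mcompm0 mcomp0m.
  - by exists (s + s'); rewrite !mcompDl !mcompDr sC s'C.
  - by exists (a *: s); rewrite !mcompZl !mcompZr sC.
have [N hN] := choice HN.
have [|n hn] := aY N.
  move=> i x /hN [s [sC ->]]; apply/hN; exists (t \oc s).
  by rewrite pwS -!mcompA sC.
have Np : N n (pw n.+1) by apply/hN; exists t; rewrite pwS.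
have nn : (n <= n.+1 + n.+1)%N by rewrite addSn ltnW // ltnS leq_addr.
have /hN [s [sC pE]] := hn _ nn _ Np.
have pwD i j : pw (i + j)%N = pw i \oc pw j.
  by elim: i => [|i IH]; rewrite ?mcomp1m //= -mcompA -IH.
rewrite pwD in pE; set p := pw n.+1 in pE *.
have sp : s \oc p = p \oc s by apply: pwC.
have pps : p \oc (p \oc s) = p by rewrite mcompA -pE.
exists (p \oc s); split; first by rewrite -[in LHS]mcompA [s \oc _]mcompA sp mcompA pps.
have tr x y z : K (x - y) -> K (y - z) -> K (x - z).
  by move=> xy yz; rewrite -[x](subrK y) -addrA; apply: smemD.
have sy x y : K (x - y) -> K (y - x) by move=> xy; rewrite -opprB -scaleN1r; apply: smemZ.
have pt : K (p - t).
  rewrite /p; elim: (n) => [|i IH]; first by rewrite /pw /= mcompm1 subrr; apply: smem0.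
  by apply: tr Kt; rewrite -mcompBr; apply: Kl.
apply: (tr _ (t \oc s)); first by rewrite -mcompBl; apply: Kr.
apply: (tr _ (t \oc (t \oc s))); first by apply: sy; rewrite mcompA -mcompBl; apply: Kr.
apply: (tr _ (t \oc (p \oc s))); first by apply: sy; rewrite -mcompBr -mcompBl; apply/Kl/Kr.
apply: (tr _ (p \oc (p \oc s))); first by apply: sy; rewrite -mcompBl; apply: Kr.
by rewrite pps.
Qed.

End IdempotentLifting.

Definition splits (k : comPzRingType) (C : lincat k) (Y : C) (e : hom Y Y) : Prop :=
  exists (W : C) (i : hom W Y) (p : hom Y W), p \oc i = idm W /\ i \oc p = e.

Definition idempotents_split (k : comPzRingType) (C : lincat k) : Prop :=
  forall (Y : C) (e : hom Y Y), e \oc e = e -> splits e.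

Section IdempotentSplitting.
Variables (k : comPzRingType) (C : addcat k).

(** Idempotents that factor as a b and b a are isomorphic as formal summands. *)
Lemma splits_transfer (Y : C) (e f a b : hom Y Y) : e \oc e = e ->
  a \oc b = f -> b \oc a = e -> splits f -> splits e.
Proof.
move=> ee ab ba [W [i [p [pi ip]]]]; exists W, (b \oc i), (p \oc a); split.
  have fi : f \oc i = i by rewrite -ip -mcompA pi mcompm1.
  by rewrite -mcompA [a \oc _]mcompA ab fi pi.
by rewrite -mcompA [i \oc _]mcompA ip -ab mcompA mcompA ba -mcompA ba ee.
Qed.

(** Peel off the summands one at a time: q s is the projection onto the summands of
    index at least s, and an idempotent e with q s e q s = e is treated by descending
    induction on s. For the first summand j, the endomorphisms p_j e i_j and p_j (q s -
    e) i_j sum to the identity of an object with local endomorphism ring, so one of them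
    is invertible. In the first case e is the sum of a copy of summand j and a smaller
    idempotent; in the second e is isomorphic to an idempotent carried by the remaining
    summands. *)
Lemma krull_schmidt_split : krull_schmidt C -> idempotents_split C.
Proof.
move=> KS Y; have [m [V [i [p [loc pi pi0 ip1]]]]] := KS Y.
pose q s : hom Y Y := \sum_(j < m | (s <= j)%N) i j \oc p j.
have suml (X : C) (I : finType) (P : pred I) (F : I -> hom Y Y) (f : hom X Y) :
    (\sum_(j | P j) F j) \oc f = \sum_(j | P j) F j \oc f.
  by elim/big_rec2: _ => [|j x y _ <-]; rewrite ?mcomp0m ?mcompDl.
have sumr (X : C) (I : finType) (P : pred I) (F : I -> hom Y Y) (f : hom Y X) :
    f \oc (\sum_(j | P j) F j) = \sum_(j | P j) f \oc F j.
  by elim/big_rec2: _ => [|j x y _ <-]; rewrite ?mcompm0 ?mcompDr.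
have pq s (j : 'I_m) : (s <= j)%N -> p j \oc q s = p j.
  move=> sj; rewrite /q sumr (bigD1 j) //= mcompA pi mcomp1m big1 ?addr0 // => l.
  by case/andP=> _ lj; rewrite mcompA pi0 ?mcomp0m // eq_sym.
have qi s (j : 'I_m) : (s <= j)%N -> q s \oc i j = i j.
  move=> sj; rewrite /q suml (bigD1 j) //= -mcompA pi mcompm1 big1 ?addr0 // => l.
  by case/andP=> _ lj; rewrite -mcompA pi0 ?mcompm0.
have qq s : q s \oc q s = q s.
  rewrite {2}/q sumr [RHS]/q; apply: eq_bigr => j sj.
  by rewrite mcompA qi.
suff H s : (s <= m)%N -> forall e, e \oc e = e -> q s \oc e = e -> e \oc q s = e -> splits e.
  have q1 : q 0%N = idm Y by rewrite -ip1.
  by move=> e ee; apply: (H 0%N) => //; rewrite q1 ?mcomp1m ?mcompm1.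
move=> sm; rewrite -(subKn sm); move: (m - s)%N (leq_subr s m) => {s sm} d.
elim: d => [|d IH] dm e ee qe eq_.
  have e0 : e = 0.
    rewrite -qe /q big1 ?mcomp0m // => j; rewrite subn0 leqNgt ltn_ord //.
  exists zob, 0, 0; split; last by rewrite mcomp0m e0.
  by rewrite mcomp0m [RHS]zob_to.
have {IH} IH := IH (ltnW dm).
have jm : (m - d.+1 < m)%N by rewrite -subn_gt0 subKn.
pose j := Ordinal jm; set s := (m - d.+1)%N in qe eq_ *.
have sE : (m - d)%N = s.+1 by rewrite /s subnSK.
rewrite {}sE in IH.
have sj : (s <= j)%N by [].
have qS : q s.+1 = q s - i j \oc p j.
  rewrite /q [in RHS](bigD1 j) //= addrAC subrr add0r; apply: eq_bigl => l.
  by rewrite ltn_neqAle andbC -val_eqE /= eq_sym.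
have p1 : p j \oc q s = p j by apply: pq.
have i1 : q s \oc i j = i j by apply: qi.
set q0 := q s in qe eq_ qS p1 i1; set q1 := q s.+1 in IH qS.
have q00 : q0 \oc q0 = q0 by apply: qq.
have q11 : q1 \oc q1 = q1 by apply: qq.
have pij : p j \oc i j = idm _ by apply: pi.
have [lid lsum] := loc j.
have iso_or : isomorphism (p j \oc e \oc i j) \/ isomorphism (p j \oc (q0 - e) \oc i j).
  apply: contrapT => /not_orP [n1 n2]; apply: (lsum _ _ n1 n2).
  rewrite -mcompDl -mcompDr addrC subrK p1 pij.
  by exists (idm _); rewrite mcomp1m.
(* f below is the complement of summand j in e; in the second case r maps onto the
   summands after j, along a copy i' of summand j inside q s - e *)
case: iso_or => -[b [ba ab]].
- pose i' := e \oc i j \oc b; pose p' := p j \oc e.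
  have p'i' : p' \oc i' = idm _.
    by rewrite /p' /i' !mcompA -[p j \oc e \oc e]mcompA ee.
  have ei' : e \oc i' = i' by rewrite /i' !mcompA ee.
  have p'e : p' \oc e = p' by rewrite /p' -mcompA ee.
  pose f := e - i' \oc p'.
  have fe : f \oc e = f by rewrite /f mcompBl ee -mcompA p'e.
  have ef : e \oc f = f by rewrite /f mcompBr ee mcompA ei'.
  have fi' : f \oc i' = 0 by rewrite /f mcompBl ei' -mcompA p'i' mcompm1 subrr.
  have p'f : p' \oc f = 0 by rewrite /f mcompBr p'e mcompA p'i' mcomp1m subrr.
  have ff : f \oc f = f by rewrite {2}/f mcompBr fe mcompA fi' mcomp0m subr0.
  have q0f : q0 \oc f = f by rewrite -ef mcompA qe.
  have pf : p j \oc f = 0 by rewrite -ef mcompA -/p' p'f.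
  have q1f : q1 \oc f = f.
    by rewrite qS mcompBl q0f -mcompA pf mcompm0 subr0.
  have [|||W' [I [P [PI IP]]]] := IH (f \oc q1).
  + by rewrite -mcompA [q1 \oc _]mcompA q1f mcompA ff.
  + by rewrite mcompA q1f.
  + by rewrite -mcompA q11.
  have : splits f.
    apply: (@splits_transfer _ f (f \oc q1) f (f \oc q1)) => //.
    + by rewrite mcompA ff.
    + by rewrite -mcompA q1f ff.
    + by exists W', I, P.
  case=> {W' I P PI IP} W' [I [P [PI IP]]].
  have fI : f \oc I = I by rewrite -IP -mcompA PI mcompm1.
  have Pf : P \oc f = P by rewrite -IP mcompA PI mcomp1m.
  exists (bip (V j) W'), (i' \oc prl _ _ + I \oc prr _ _), (inl_ _ _ \oc p' + inr_ _ _ \oc P).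
  have fE : f = e - i' \oc p' by [].
  clearbody f; clearbody p' i'.
  have pI : p' \oc I = 0 by rewrite -fI mcompA p'f mcomp0m.
  have Pi : P \oc i' = 0 by rewrite -Pf -mcompA fi' mcompm0.
  split.
  + rewrite mcompDl !mcompDr -!mcompA [p' \oc (_ \oc _)]mcompA p'i' mcomp1m.
    rewrite [p' \oc (_ \oc _)]mcompA pI mcomp0m mcompm0 addr0.
    rewrite [P \oc (_ \oc _)]mcompA Pi mcomp0m mcompm0 add0r.
    by rewrite [P \oc (_ \oc _)]mcompA PI mcomp1m bip_id.
  + rewrite mcompDl !mcompDr -!mcompA prl_inlK prl_inrK prr_inlK prr_inrK !mcompm0 addr0 add0r.
    by rewrite IP fE addrC subrK.
- pose i' := (q0 - e) \oc i j \oc b.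
  have p'i' : p j \oc i' = idm _ by rewrite /i' !mcompA.
  have ei' : e \oc i' = 0 by rewrite /i' !mcompA mcompBr eq_ ee subrr !mcomp0m.
  have q0i' : q0 \oc i' = i' by rewrite /i' !mcompA mcompBr q00 qe.
  clearbody i'; pose r := q0 - i' \oc p j.
  have er : e \oc r = e by rewrite /r mcompBr eq_ mcompA ei' mcomp0m subr0.
  have q1r : q1 \oc r = r.
    rewrite qS mcompBl /r !mcompBr q00 mcompA q0i' -!mcompA p1.
    by rewrite [p j \oc (i' \oc _)]mcompA p'i' mcomp1m subrr subr0.
  have [|||W' [I [P [PI IP]]]] := IH (r \oc e \oc q1).
  + rewrite -!mcompA [q1 \oc (r \oc _)]mcompA q1r [e \oc (r \oc _)]mcompA er.
    by rewrite [e \oc (e \oc _)]mcompA ee.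
  + by rewrite !mcompA q1r.
  + by rewrite -!mcompA q11.
  apply: (@splits_transfer _ e (r \oc e \oc q1) (r \oc e) (e \oc q1)) => //.
  + by rewrite -!mcompA [e \oc (e \oc _)]mcompA ee.
  + by rewrite -!mcompA [q1 \oc (r \oc _)]mcompA q1r mcompA er ee.
  + by exists W', I, P.
Qed.

End IdempotentSplitting.

(** * Exact bifunctors and universal elements *)

Section BifunctorBasics.
Variables (k : comPzRingType) (C : lincat k) (E : bifunctor C).

Lemma pull0 (W D A : C) (g : hom W D) : pull g (0 : E D A) = 0.
Proof. by apply: (addrI (pull g 0)); rewrite -pull_add !addr0. Qed.
Lemma push0 (D A B : C) (g : hom A B) : push g (0 : E D A) = 0.
Proof. by apply: (addrI (push g 0)); rewrite -push_add !addr0. Qed.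
Lemma pull_zero (W D A : C) (x : E D A) : pull (0 : hom W D) x = 0.
Proof. by apply: (addrI (pull 0 x)); rewrite -pullD !addr0. Qed.
Lemma push_zero (D A B : C) (x : E D A) : push (0 : hom A B) x = 0.
Proof. by apply: (addrI (push 0 x)); rewrite -pushD !addr0. Qed.
Lemma pullN (W D A : C) (g : hom W D) (x : E D A) : pull (- g) x = - pull g x.
Proof. by apply: (addrI (pull g x)); rewrite -pullD !subrr pull_zero. Qed.
Lemma pushN (D A B : C) (g : hom A B) (x : E D A) : push (- g) x = - push g x.
Proof. by apply: (addrI (push g x)); rewrite -pushD !subrr push_zero. Qed.
Lemma pullB (W D A : C) (f g : hom W D) (x : E D A) : pull (f - g) x = pull f x - pull g x.
Proof. by rewrite pullD pullN. Qed.
Lemma pushB (D A B : C) (f g : hom A B) (x : E D A) : push (f - g) x = push f x - push g x.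
Proof. by rewrite pushD pushN. Qed.
Lemma pull_opp (W D A : C) (g : hom W D) (x : E D A) : pull g (- x) = - pull g x.
Proof. by apply: (addrI (pull g x)); rewrite -pull_add !subrr pull0. Qed.
Lemma pull_sub (W D A : C) (g : hom W D) (x y : E D A) : pull g (x - y) = pull g x - pull g y.
Proof. by rewrite pull_add pull_opp. Qed.
(** Each statement about one variable of E is used for the other one by applying it to
    this bifunctor. *)
Definition op_ext : bifunctor (op C) :=
  @Bifunctor k (op C) (fun D A => E A D)
    (fun D A B a => @pull k C E B A D a) (fun C' D A c => @push k C E A D C' c)
    (fun D A B a => @pull_add _ _ E B A D a)
    (fun D A B a a' x => @pullD _ _ E B A D a a' x)
    (fun D A x => @pull1 _ _ E A D x)
    (fun D A B B' b a x => @pullM _ _ E B B' A D a b x)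
    (fun C' D A c => @push_add _ _ E A D C' c)
    (fun C' D A c c' x => @pushD _ _ E A D C' c c' x)
    (fun D A x => @push1 _ _ E A D x)
    (fun C' C'' D A c c' x => @pushM _ _ E A D C' C'' c' c x)
    (fun C' D A B a c x => esym (@push_pull _ _ E B A D C' c a x)).

(** Exactness of C(-,B) -> C(-,D) -> E(-,A) and of C(A,-) -> E(D,-) -> E(B,-). Only the
    second goes beyond the definition of an exangle with class delta and last morphism
    d. *)
Definition is_deflation (D A : C) (delta : E D A) (B : C) (d : hom B D) : Prop :=
  (forall W (g : hom W D), pull g delta = 0 <-> exists h, g = d \oc h) /\
  (forall B (eps : E D B), pull d eps = 0 -> exists a, eps = push a delta).

Definition is_inflation (D A : C) (delta : E D A) (B : C) (d : hom A B) : Prop :=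
  (forall W (g : hom A W), push g delta = 0 <-> exists h, g = h \oc d) /\
  (forall B (eps : E B A), push d eps = 0 -> exists c, eps = pull c delta).

(** The last two clauses stand for enough projectives and injectives: if an exangle
    ending in W has projective middle terms, then all elements of E(W,-) are pushouts of
    its class. *)
Definition exact_bifunctor : Prop :=
  [/\ forall D A (delta : E D A), exists B (d : hom B D), is_deflation delta d,
      forall D A (delta : E D A), exists B (d : hom A B), is_inflation delta d,
      forall W, exists A (pi : E W A), forall B (eps : E W B), exists g, eps = push g pi
    & forall X, exists K (iota : E K X), forall W (eps : E W X), exists c, eps = pull c iota].

(** With enough projectives these are the morphisms that factor through a projective. *)
Definition pull_null (Y W : C) (f : hom Y W) : Prop := forall A (eps : E W A), pull f eps = 0.
Definition push_null (A B : C) (g : hom A B) : Prop := forall D (eps : E D A), push g eps = 0.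

Lemma pull_null_submodule (Y W : C) : exists S : submodule (hom Y W), forall f, S f <-> pull_null f.
Proof.
apply: submodule_ex => [A eps|f g nf ng A eps|a f nf A eps].
- by rewrite pull_zero.
- by rewrite pullD nf ng addr0.
- by rewrite -[f]mcomp1m -mcompZl pullM nf.
Qed.

Lemma pull_null_l (X Y Z : C) (g : hom Y Z) (f : hom X Y) : pull_null f -> pull_null (g \oc f).
Proof. by move=> nf A eps; rewrite pullM nf. Qed.
Lemma pull_null_r (X Y Z : C) (g : hom Y Z) (f : hom X Y) : pull_null g -> pull_null (g \oc f).
Proof. by move=> ng A eps; rewrite pullM ng pull0. Qed.

Section Functionals.
Variable J : lmodType k.

Definition pull_linear (W X : C) (w : E W X -> J) : Prop :=
  (forall x y, w (x + y) = w x + w y) /\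
  (forall a x, w (pull (a *: idm W) x) = a *: w x).

(** By Yoneda, w is an element of D E(-,X) at Y; the clauses say that it represents this
    functor modulo the morphisms annihilated by E. *)
Definition represents_pull (Y X : C) (w : E Y X -> J) : Prop :=
  [/\ pull_linear w,
      forall W (f : hom Y W), (forall e : E W X, w (pull f e) = 0) -> pull_null f
    & forall W (psi : E W X -> J), pull_linear psi ->
      exists f : hom Y W, forall e, psi e = w (pull f e)].

End Functionals.
End BifunctorBasics.

Lemma exact_bifunctor_op (k : comPzRingType) (C : lincat k) (E : bifunctor C) :
  exact_bifunctor E -> exact_bifunctor (op_ext E).
Proof. by case=> d i p j; split=> *; [apply: i | apply: d | apply: j | apply: p]. Qed.

(** The functor F = Coker (C(-,X1) -> C(-,X0)) has a finitely presented dual, spelled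
    out in elements: y in D F(Y) generates D F under C(Y,-), and its relations are
    generated by u. *)
Definition dual_presented (k : comPzRingType) (J : lmodType k) (C : lincat k) : Prop :=
  forall (X1 X0 : C) (v : hom X1 X0), exists (Y Z : C) (u : hom Y Z) (y : lhom (hom Y X0) J),
  [/\ forall h : hom Y X1, y (v \oc h) = 0,
      forall W (psi : lhom (hom W X0) J), (forall h : hom W X1, psi (v \oc h) = 0) ->
        exists f : hom Y W, forall c, psi c = y (c \oc f)
    & forall W (f : hom Y W), (forall c : hom W X0, y (c \oc f) = 0) <->
        exists h : hom Z W, f = h \oc u].

Lemma dual_presented_op (k : comPzRingType) (J : lmodType k) (C : lincat k) :
  dual_presented J (op C) -> forall (X0 X1 : C) (v : hom X0 X1),
  exists (Y : C) (y : lhom (hom X0 Y) J),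
  (forall h : hom X1 Y, y (h \oc v) = 0) /\
  (forall W (psi : lhom (hom X0 W) J), (forall h : hom X1 W, psi (h \oc v) = 0) ->
     exists f : hom W Y, forall c, psi c = y (f \oc c)).
Proof. by move=> d X0 X1 v; have [Y [Z [u [y [y0 yg _]]]]] := d X1 X0 v; exists Y, y. Qed.

Definition has_biproducts (k : comPzRingType) (C : lincat k) : Prop :=
  forall A B : C, exists (S : C) (il : hom A S) (ir : hom B S) (pl : hom S A) (pr : hom S B),
  [/\ pl \oc il = idm A, pr \oc ir = idm B, pl \oc ir = 0, pr \oc il = 0
    & il \oc pl + ir \oc pr = idm S].

(** * Representability of the dual of E(-,X) *)

Section Representability.
Variables (k : comPzRingType) (J : lmodType k) (C : lincat k) (E : bifunctor C).
Hypothesis ak : artinian_mod k^o.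
Hypothesis envJ : injective_envelope_of_residue_ring J.
Hypothesis aC : forall A B : C, artinian_mod (hom A B).
Hypothesis bipC : has_biproducts C.
Hypothesis splitC : idempotents_split C.
Hypothesis dualC : dual_presented J C.
Hypothesis dualCop : dual_presented J (op C).
Hypothesis exE : exact_bifunctor E.

(** The dual of C(-,Q) is presented by an object YQ with generator y and relation u : YQ
    -> ZQ, and L = y(- g) for some g : YQ -> Y. A morphism c : W -> Q satisfies L(c f) =
    0 for all f exactly when the functional f -> y(c f) on C(YQ,W) vanishes on the
    multiples of v = (u, g). Such functionals are presented, by duality in the opposite
    category, by an object N with a generator gam : C(YQ,N) -> J, which reflexivity
    turns into a morphism kap : N -> Q. *)
Lemma functional_kernel (Y Q : C) (L : lhom (hom Y Q) J) :
  exists (N : C) (kap : hom N Q), forall W (c : hom W Q),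
    (forall f : hom Y W, L (c \oc f) = 0) <-> exists w, c = kap \oc w.
Proof.
have [YQ [ZQ [u [y [_ ygen yrel]]]]] := dualC (0 : hom Q Q).
have {}ygen W (psi : lhom (hom W Q) J) : exists f : hom YQ W, forall c, psi c = y (c \oc f).
  by apply: ygen => h; rewrite mcomp0m lh0.
have [g gE] := ygen _ L.
have [S [il [ir [pl [pr [plil prir plir pril _]]]]]] := bipC ZQ Y.
pose v := il \oc u + ir \oc g.
have [N [gam [gam0 gamgen]]] := dual_presented_op dualCop v.
have yu W (h : hom ZQ W) (c : hom W Q) : y (c \oc (h \oc u)) = 0.
  by move: c; apply/yrel; exists h.
have sep W (c : hom W Q) : (forall f, y (c \oc f) = 0) -> c = 0.
  move=> yc; apply: contrapT => /(cogenerator ak envJ) [psi]; apply.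
  by have [f ->] := ygen _ psi.
(* gam only depends on the functional y (- f) that f defines on hom N Q *)
have gamy (f : hom YQ N) : (forall c, y (c \oc f) = 0) -> gam f = 0.
  move/yrel => [h ->]; rewrite -(gam0 (h \oc pl)); congr (lfun_of gam _).
  by rewrite /v mcompDr -!mcompA [pl \oc (il \oc _)]mcompA plil mcomp1m
    [pl \oc (ir \oc _)]mcompA plir mcomp0m mcompm0 addr0.
have [fch fchE] := choice (ygen N).
have gam_eq f f' : (forall c, y (c \oc f) = y (c \oc f')) -> gam f = gam f'.
  move=> e; apply/eqP; rewrite -subr_eq0 -lhB; apply/eqP/gamy => c.
  by rewrite mcompBr lhB e subrr.
have [xi xiE] : exists xi : lhom (lhom (hom N Q) J) J, forall phi, xi phi = gam (fch phi).
  apply: linear_lhom => a phi psi; rewrite -lhZ -lhD; apply: gam_eq => c.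
  by rewrite -fchE lhomE_D lhomE_Z !fchE mcompDr mcompZr lhD lhZ.
have [kap kapE] := matlis_reflexive ak envJ xi (@aC N Q).
have {}kapE f : gam f = y (kap \oc f).
  have [phi phiE] : exists phi : lhom (hom N Q) J, forall c, phi c = y (c \oc f).
    by apply: linear_lhom => a c c'; rewrite mcompDl mcompZl lhD lhZ.
  by rewrite -phiE -kapE xiE; apply: gam_eq => c; rewrite -phiE fchE.
exists N, kap => W c; split=> [Lc|[w ->] f].
  have [psi psiE] : exists psi : lhom (hom YQ W) J, forall f, psi f = y (c \oc f).
    by apply: linear_lhom => a f f'; rewrite mcompDr mcompZr lhD lhZ.
  have [|w wE] := gamgen _ psi.
    move=> h; rewrite psiE /v !mcompDr lhD [h \oc (il \oc _)]mcompA yu add0r.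
    by rewrite [h \oc _]mcompA mcompA -gE Lc.
  exists w; apply/eqP; rewrite -subr_eq0; apply/eqP/sep => f.
  by rewrite mcompBl lhB -psiE wE kapE mcompA subrr.
rewrite gE -mcompA -mcompA -kapE mcompA -(gam0 (w \oc f \oc pr)); congr (lfun_of gam _).
rewrite /v mcompDr -!mcompA [pr \oc (il \oc _)]mcompA pril mcomp0m !mcompm0 add0r.
by rewrite [pr \oc (ir \oc _)]mcompA prir mcomp1m.
Qed.

(** If the cokernel of C(-,kap) vanishes on the morphisms annihilated by E, then it is a
    defect. Let pi be universal for E(Q,-), let d be the inflation of kap^*pi and put
    rho = d_*pi. If c^*rho = 0, then c^*pi is a pullback of kap^*pi, so c agrees up to a
    multiple of kap with a morphism that annihilates pi, hence all of E(Q,-). *)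
Lemma defect_of_weak_cover (N Q : C) (kap : hom N Q) :
  (forall W (c : hom W Q), pull_null E c -> exists w, c = kap \oc w) ->
  exists A (rho : E Q A), forall W (c : hom W Q), pull c rho = 0 <-> exists w, c = kap \oc w.
Proof.
move=> kapn; have [_ infl proj _] := exE.
have [A [pi piU]] := proj Q.
have [V [d [dinf1 dinf2]]] := infl _ _ (pull kap pi).
exists V, (push d pi) => W c; split=> [|[w ->]].
  rewrite -push_pull => cpi.
  have [defl _ _ _] := exE; have [|w wE] := dinf2 _ (pull c pi); first by [].
  have [|z zE] := kapn _ (c - kap \oc w).
    by move=> B eps; have [g ->] := piU _ eps; rewrite -push_pull pullB pullM -wE subrr push0.
  by exists (z + w); rewrite mcompDr -zE subrK.
rewrite -push_pull pullM push_pull.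
have -> : push d (pull kap pi) = 0 by apply/dinf1; exists (idm _); rewrite mcomp1m.
exact: pull0.
Qed.

(** Let E(-,X) be the cokernel of C(-,v), with v the deflation of a universal element
    sig in E(K,X), and let y and u present its dual on Y and Z. The aim is an
    endomorphism t of Y with y t = y such that u t is annihilated by E. Then t is
    idempotent modulo annihilated morphisms, as t - 1 factors through u, and splitting a
    lift of t cuts out of Y the representing object. To find t, enlarge K to S = K + Q',
    where Q' carries a functional phi detecting which morphisms Y -> Z are annihilated,
    and set L = (y, phi). The morphisms c into S with L(c f) = 0 for all f are the
    annihilator of some rho in E(S,A) by [functional_kernel] and [defect_of_weak_cover].
    The restriction of rho to K is annihilated only by morphisms that annihilate sig, so
    sig is a pushout of it, and the same pushout of rho is q^*sig for some q : S -> K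
    whose restriction to K fixes sig. The functional y(q -) vanishes on the g with L(g
    f) = 0 for all f, so by reflexivity it is L(- t) for some t : Y -> Y. On K this says
    y t = y; on Q' it says that phi kills h u t for all h, that is, u t is annihilated
    by E. *)
Theorem ext_pull_functional_representable (X : C) :
  exists (Y : C) (w : E Y X -> J), represents_pull w.
Proof.
have [defl _ _ inj] := exE; have [K [sig sigU]] := inj X.
have [X1 [v [vk vx]]] := defl _ _ sig.
have [Y [Z [u [y [yv ygen yrel]]]]] := dualC v.
have ysig (c c' : hom Y K) : pull c sig = pull c' sig -> y c = y c'.
  move=> cc'; have [|h hE] := proj1 (vk _ (c - c')); first by rewrite pullB cc' subrr.
  by apply/eqP; rewrite -subr_eq0 -lhB hE yv.
have ynull (c : hom Y K) : pull_null E c -> y c = 0.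
  by move=> nc; rewrite -(lh0 y); apply: ysig; rewrite nc pull_zero.
have sep W (c : hom W K) : (forall f : hom Y W, y (c \oc f) = 0) -> pull c sig = 0.
  move=> yc; apply/vk; apply: contrapT => nh.
  have [S hS] : exists S : submodule (hom W K), forall c, S c <-> exists h, c = v \oc h.
    apply: submodule_ex => [|_ _ [h ->] [h' ->]|a _ [h ->]]; first by exists 0; rewrite mcompm0.
      by exists (h + h'); rewrite mcompDr.
    by exists (a *: h); rewrite mcompZr.
  have [|psi [psic psi0]] := @cogenerator_mod _ J ak envJ _ S c; first by move/hS.
  have [h|f fE] := ygen _ psi; first by apply: psi0; apply/hS; exists h.
  by apply: psic; rewrite fE yc.
(* a test object Q' whose functional phi detects the null maps Y -> Z *)
have [Q' [phi [phin phiN]]] : exists (Q' : C) (phi : lhom (hom Y Q') J),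
    (forall f, pull_null E f -> phi f = 0) /\
    forall f : hom Y Z, (forall h : hom Z Q', phi (h \oc f) = 0) -> pull_null E f.
  have Nex (Q : C) (phi : lhom (hom Y Q) J) : exists N : submodule (hom Y Z), forall f,
      N f <-> forall h : hom Z Q, phi (h \oc f) = 0.
    apply: submodule_ex => [h|f g hf hg h|a f hf h]; first by rewrite mcompm0 lh0.
      by rewrite mcompDr lhD hf hg addr0.
    by rewrite mcompZr lhZ hf scaler0.
  pose F (N : submodule (hom Y Z)) := exists (Q : C) (phi : lhom (hom Y Q) J),
    (forall f, pull_null E f -> phi f = 0) /\
    forall f, N f <-> forall h : hom Z Q, phi (h \oc f) = 0.
  have [N0 hN0] := Nex Z 0.
  have [|N [[Q [phi [phin phiE]]] Nmin]] := @artinian_min _ _ F N0 (@aC Y Z).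
    by exists Z, 0.
  exists Q, phi; split=> // f /phiE Nf; apply: contrapT => nf.
  have [S hS] := pull_null_submodule E Y Z.
  have [|psi [psif psi0]] := @cogenerator_mod _ J ak envJ _ S f; first by move/hS.
  have [Q2 [il [ir [pl [pr [plil prir plir pril _]]]]]] := bipC Q Z.
  have [phi2 phi2E] : exists phi2 : lhom (hom Y Q2) J, forall g,
      phi2 g = phi (pl \oc g) + psi (pr \oc g).
    apply: linear_lhom => a g g'; rewrite !mcompDr !mcompZr !lhD !lhZ scalerDr.
    by rewrite addrACA.
  have [N2 hN2] := Nex _ phi2.
  have /hN2 /(_ ir) : N2 f.
    apply: (Nmin N2) => //.
      exists Q2, phi2; split=> // g ng; rewrite phi2E phin ?psi0 ?addr0 //.
        by apply/hS; apply: pull_null_l.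
      exact: pull_null_l.
    move=> g /hN2 ng; apply/phiE => h; have := ng (il \oc h).
    by rewrite phi2E !mcompA plil pril mcomp1m !mcomp0m lh0 addr0.
  by rewrite phi2E !mcompA plir prir mcomp1m mcomp0m lh0 add0r.
have [S [il [ir [pl [pr [plil prir plir pril _]]]]]] := bipC K Q'.
have [L LE] : exists L : lhom (hom Y S) J, forall g, L g = y (pl \oc g) + phi (pr \oc g).
  apply: linear_lhom => a g g'; rewrite !mcompDr !mcompZr !lhD !lhZ scalerDr.
  by rewrite addrACA.
have [N [kap kapE]] := functional_kernel L.
have [A [rho rhoE]] : exists A (rho : E S A), forall W (c : hom W S),
    pull c rho = 0 <-> exists w, c = kap \oc w.
  apply: defect_of_weak_cover => W c nc; apply/kapE => f; rewrite LE ynull ?phin ?addr0 //.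
    by apply: pull_null_l; apply: pull_null_r.
  by apply: pull_null_l; apply: pull_null_r.
(* what annihilates the restriction of rho to K annihilates sig *)
pose th := pull il rho.
have thE W (c : hom W K) : pull c th = 0 -> pull c sig = 0.
  rewrite /th -pullM => /rhoE /kapE Lc; apply: sep => f; rewrite -(Lc f) LE.
  by rewrite -!mcompA [pl \oc (il \oc _)]mcompA plil mcomp1m
    [pr \oc (il \oc _)]mcompA pril mcomp0m lh0 addr0.
have [B [d [dk dx]]] := defl _ _ th.
have [|a' a'E] := dx _ sig; first by apply: thE; apply/dk; exists (idm _); rewrite mcompm1.
(* q retracts the inclusion of K, up to morphisms that annihilate sig *)
have [q qE] := sigU _ (push a' rho).
have qil : pull (q \oc il) sig = sig by rewrite pullM -qE -push_pull -a'E.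
have [t tE] : exists t : hom Y Y, forall g : hom Y S, y (q \oc g) = L (g \oc t).
  have pex (g : hom Y S) : exists h : lhom (hom Y Y) J, forall f, h f = L (g \oc f).
    by apply: linear_lhom => a f f'; rewrite mcompDr mcompZr lhD lhZ.
  have [p0 p0E] := choice pex.
  have [p pE] : exists p : lhom (hom Y S) (lhom (hom Y Y) J), forall g, p g = p0 g.
    apply: linear_lhom => a g g'; apply: lhomP => f.
    by rewrite -!/(lfun_of _ _) lhomE_D lhomE_Z !p0E mcompDl mcompZl lhD lhZ.
  have [q1 q1E] : exists q1 : lhom (hom Y S) J, forall g, q1 g = y (q \oc g).
    by apply: linear_lhom => a g g'; rewrite mcompDr mcompZr lhD lhZ.
  have [|xi xiE] := @functional_ext _ J envJ _ _ p q1.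
    move=> g pg0; have /kapE [w ->] : forall f, L (g \oc f) = 0.
      by move=> f; rewrite -p0E -pE pg0.
    rewrite q1E -(lh0 y); apply: ysig; rewrite pull_zero mcompA pullM pullM -qE -push_pull.
    have -> : pull kap rho = 0 by apply/rhoE; exists (idm _); rewrite mcompm1.
    by rewrite push0 pull0.
  have [t tE] := matlis_reflexive ak envJ xi (@aC Y Y).
  by exists t => g; rewrite -q1E -xiE tE pE p0E.
have yt (c : hom Y K) : y (c \oc t) = y c.
  have := tE (il \oc c); rewrite LE -!mcompA [pl \oc (il \oc _)]mcompA plil mcomp1m.
  rewrite [pr \oc (il \oc _)]mcompA pril mcomp0m lh0 addr0 => <-.
  by apply: ysig; rewrite mcompA pullM qil.
have yu (c : hom Z K) : y (c \oc u) = 0.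
  by move: c; apply/yrel; exists (idm _); rewrite mcomp1m.
have ut : pull_null E (u \oc t).
  apply: phiN => h; have := tE (ir \oc (h \oc u)).
  rewrite !mcompA yu LE -!mcompA [pl \oc (ir \oc _)]mcompA plir mcomp0m lh0 add0r.
  by rewrite [pr \oc (ir \oc _)]mcompA prir mcomp1m => <-.
have [KY hKY] := pull_null_submodule E Y Y.
have [|||e [ee /hKY et]] := @idempotent_lift _ C Y KY t (@aC Y Y).
- by move=> g f /hKY nf; apply/hKY; apply: pull_null_l.
- by move=> g f /hKY nf; apply/hKY; apply: pull_null_r.
- have [|h hE] := proj1 (yrel _ (t - idm Y)).
    by move=> c; rewrite mcompBr mcompm1 lhB yt subrr.
  apply/hKY; have -> : t \oc t - t = h \oc (u \oc t).
    by rewrite mcompA -hE mcompBl mcomp1m.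
  exact: pull_null_l.
have ye (c : hom Y K) : y (c \oc e) = y c.
  rewrite -[e](subrK t) mcompDr lhD yt ynull ?add0r //; exact: pull_null_l.
have ue : pull_null E (u \oc e).
  by move=> D eps; rewrite -[e](subrK t) mcompDr pullD ut (pull_null_l _ et) addr0.
have [Y0 [i [p [pi ip]]]] := splitC ee.
have [cc ccE] := choice (sigU Y0).
(* any c with e = c^*sig may be used to compute the functional at e *)
have wE (c : hom Y0 K) : y (cc (pull c sig) \oc p) = y (c \oc p).
  by apply: ysig; rewrite !pullM -ccE.
exists Y0, (fun eps => y (cc eps \oc p)); split.
- split=> [e1 e2|a e1].
    rewrite {1}(ccE e1) {1}(ccE e2) -pullD wE mcompDl lhD //.
  rewrite {1}(ccE e1) -pullM mcompZr mcompm1 wE mcompZl lhZ //.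
- move=> W f fe.
  have [|h hE] := proj1 (yrel _ (f \oc p)).
    by move=> c; rewrite mcompA -wE pullM fe.
  have -> : f = h \oc (u \oc i) by rewrite mcompA -hE -mcompA pi mcompm1.
  apply: pull_null_l; have -> : u \oc i = u \oc e \oc i.
    by rewrite -ip -!mcompA pi mcompm1.
  exact: pull_null_r.
- move=> W psi [psiD psiZ].
  have [psi' psi'E] : exists psi' : lhom (hom W K) J, forall c, psi' c = psi (pull c sig).
    apply: linear_lhom => a c c'; rewrite pullD psiD -psiZ -pullM mcompZr mcompm1 //.
  have psi0 : psi 0 = 0 by apply: (addrI (psi 0)); rewrite -psiD !addr0.
  have [|f fE] := ygen _ psi'.
    by move=> h; rewrite psi'E (proj2 (vk _ _)) //; exists h.
  exists (f \oc i) => eps; have [c ->] := sigU _ eps.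
  by rewrite -psi'E fE -pullM wE mcompA -mcompA ip ye.
Qed.

End Representability.

(** * From one represented functor to the other *)

Section Pairings.
Variables (k : comPzRingType) (J : lmodType k) (C : lincat k) (E : bifunctor C).
Hypothesis ak : artinian_mod k^o.
Hypothesis envJ : injective_envelope_of_residue_ring J.
Hypothesis aC : forall A B : C, artinian_mod (hom A B).
Hypothesis exE : exact_bifunctor E.

Local Notation M1 W X := (kmod (ext_contra E X) W).

Lemma pull_linear_lhom (W X : C) (w : E W X -> J) : pull_linear w ->
  exists f : lhom (M1 W X) J, forall x : E W X, f x = w x.
Proof.
case=> wD wZ; apply: (@linear_lhom _ (M1 W X) J w) => a x y.
by rewrite wD; congr (_ + _); apply: wZ.
Qed.

Lemma lhom_pull_linear (W X : C) (f : lhom (M1 W X) J) : pull_linear (fun x : E W X => lfun_of f x).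
Proof. by split=> [x y|a x]; [apply: lhD | apply: (lhZ f a x)]. Qed.

(** E(W,X) is a quotient of C(W,K), by a universal element of E(K,X). *)
Lemma ext_artinian (W X : C) : artinian_mod (M1 W X).
Proof.
have [_ _ _ inj] := exE; have [K [sig sigU]] := inj X.
have [f fE] : exists f : lhom (hom W K) (M1 W X), forall c, f c = pull c sig.
  apply: (@linear_lhom _ (hom W K) (M1 W X)) => a c c'; rewrite pullD; congr (_ + _).
  by rewrite -[RHS]/(pull (a *: idm W) (pull c sig)) -pullM mcompZr mcompm1.
by apply: (artinian_surj (f := f)) => // e; have [c cE] := sigU _ e; exists c; rewrite fE.
Qed.

Lemma ext_cogenerator (W X : C) (e : E W X) : e <> 0 ->
  exists psi : E W X -> J, pull_linear psi /\ psi e <> 0.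
Proof.
move=> e0; have [f fe] := @cogenerator _ J ak envJ (M1 W X) e e0.
by exists (fun x => lfun_of f x); split=> //; apply: lhom_pull_linear.
Qed.

Lemma pull_linear_push (Y B X : C) (w : E Y X -> J) (g : hom B X) :
  pull_linear w -> pull_linear (fun e => w (push g e)).
Proof. by case=> wD wZ; split=> [x y|a x]; rewrite ?push_add ?wD // push_pull wZ. Qed.

Lemma pull_linear_pull (Y W X : C) (w : E Y X -> J) (f : hom Y W) :
  pull_linear w -> pull_linear (fun e => w (pull f e)).
Proof.
case=> wD wZ; split=> [x y|a x]; rewrite ?pull_add ?wD // -wZ -!pullM.
by rewrite mcompZl mcompZr mcomp1m mcompm1.
Qed.

Lemma pull_linear0 (W X : C) (w : E W X -> J) : pull_linear w -> w 0 = 0.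
Proof. by case=> wD _; apply: (addrI (w 0)); rewrite -wD !addr0. Qed.

Lemma pull_linearB (W X : C) (w : E W X -> J) x y : pull_linear w -> w (x - y) = w x - w y.
Proof.
move=> lw; have wN z : w (- z) = - w z.
  by apply: (addrI (w z)); rewrite -(proj1 lw) !subrr pull_linear0.
by rewrite (proj1 lw) wN.
Qed.

Definition represents_push (Y X : C) (w : E Y X -> J) : Prop :=
  [/\ pull_linear w,
      forall B (g : hom B X), (forall e : E Y B, w (push g e) = 0) -> push_null E g
    & forall B (psi : E Y B -> J), pull_linear psi ->
      exists g : hom B X, forall e, psi e = w (push g e)].

(** Let psi be a functional on E(Y,B), and io universal in E(K,B). As functionals on
    E(K,X) are represented by morphisms f : Y -> K, the rule f -> psi(f^*io) defines a
    functional on the dual of E(K,X), which by reflexivity is an element eps of E(K,X).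
    The deflation of io kills eps, so eps = g_*io, and g represents psi. *)
Lemma represents_pull_push (Y X : C) (w : E Y X -> J) :
  represents_pull w -> represents_push w.
Proof.
case=> lw winj wsurj; split=> // [B g wg D eps|B psi lpsi].
  apply: contrapT => /ext_cogenerator [psi [lpsi]]; apply.
  by have [f ->] := wsurj _ _ lpsi; rewrite -push_pull wg.
have [defl infl _ inj] := exE; have [K [io ioU]] := inj B.
have [I [d [dk dx]]] := defl _ _ io.
have wex (phi : lhom (M1 K X) J) : exists f : hom Y K, forall e : E K X, phi e = w (pull f e).
  exact: wsurj (lhom_pull_linear phi).
have [fch fchE] := choice wex.
have psi_eq (f f' : hom Y K) : (forall e, w (pull f e) = w (pull f' e)) ->
    psi (pull f io) = psi (pull f' io).
  move=> ff'; have nf : pull_null E (f - f').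
    by apply: winj => e; rewrite pullB pull_linearB // ff' subrr.
  apply/eqP; rewrite -subr_eq0 -pull_linearB // -pullB nf pull_linear0 //.
have [xi xiE] : exists xi : lhom (lhom (M1 K X) J) J, forall phi, xi phi = psi (pull (fch phi) io).
  apply: linear_lhom => a phi phi'.
  rewrite -(proj2 lpsi) -(proj1 lpsi) -pullM -pullD; apply: psi_eq => e.
  rewrite -fchE lhomE_D lhomE_Z !fchE pullD (proj1 lw) mcompZr mcompm1.
  by rewrite -[X in pull (a *: X)]mcompm1 -mcompZr pullM (proj2 lw).
have [eps epsE] := matlis_reflexive ak envJ xi (@ext_artinian K X).
have {}epsE (f : hom Y K) : psi (pull f io) = w (pull f eps).
  have [phi phiE] := pull_linear_lhom (pull_linear_pull f lw).
  by rewrite -phiE -epsE xiE; apply: psi_eq => e; rewrite -phiE fchE.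
have deps : pull d eps = 0.
  apply: contrapT => /ext_cogenerator [chi [lchi]]; apply; have [f ->] := wsurj _ _ lchi.
  rewrite -pullM -epsE; have -> : pull (d \oc f) io = 0 by apply/dk; exists f.
  exact: pull_linear0.
have [g gE] := dx _ _ deps.
by exists g => e; have [f ->] := ioU _ e; rewrite epsE gE push_pull.
Qed.

(** As in [represents_pull_push], with a universal element pi of E(W,A). What has to be
    shown in addition is that w separates the elements of E(W,X): if w(f^*eps) = 0 for
    all f, then w factors through the map d_* given by the inflation d of eps, so w(e) =
    w(g_*d_*e) for some g, and 1 - g d is annihilated by E. Applied to eps this gives
    eps = 0. *)
Lemma represents_push_pull (Y X : C) (w : E Y X -> J) :
  represents_push w -> represents_pull w.
Proof.
case=> lw winj wsurj; have [defl infl proj inj] := exE.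
have nondeg W (eps : E W X) : (forall f : hom Y W, w (pull f eps) = 0) -> eps = 0.
  move=> weps; have [V [d [dk dx]]] := infl _ _ eps.
  have [p pE] : exists p : lhom (M1 Y X) (M1 Y V), forall e : E Y X, p e = push d e.
    apply: (@linear_lhom _ (M1 Y X) (M1 Y V) (fun e : E Y X => push d e)) => a x y.
    by rewrite push_add; congr (_ + _); apply: push_pull.
  have [w' w'E] := pull_linear_lhom lw.
  have [|psi psiE] := @functional_ext _ J envJ _ _ p w'.
    by move=> e; rewrite pE w'E => /dx [f ->].
  have [g gE] := wsurj _ _ (lhom_pull_linear psi).
  have n1 : push_null E (idm X - g \oc d).
    apply: winj => e; rewrite pushB push1 pull_linearB // pushM -gE.
    by rewrite -w'E -psiE pE subrr.
  have := n1 _ eps; rewrite pushB push1 pushM.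
  have -> : push d eps = 0 by apply/dk; exists (idm V); rewrite mcomp1m.
  by rewrite push0 subr0.
split=> // [W f wf A eps|W psi lpsi].
  apply: contrapT => /ext_cogenerator [psi [lpsi]]; apply.
  by have [g ->] := wsurj _ _ lpsi; rewrite push_pull wf.
have [A [pi piU]] := proj W; have [P [d [dk dx]]] := infl _ _ pi.
have wex (phi : lhom (M1 Y A) J) : exists g : hom A X, forall e : E Y A, phi e = w (push g e).
  exact: wsurj (lhom_pull_linear phi).
have [gch gchE] := choice wex.
have psi_eq (g g' : hom A X) : (forall e, w (push g e) = w (push g' e)) ->
    psi (push g pi) = psi (push g' pi).
  move=> gg'; have ng : push_null E (g - g').
    by apply: winj => e; rewrite pushB pull_linearB // gg' subrr.
  by congr psi; apply/eqP; rewrite -subr_eq0 -pushB ng.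
have [xi xiE] : exists xi : lhom (lhom (M1 Y A) J) J, forall phi, xi phi = psi (push (gch phi) pi).
  apply: linear_lhom => a phi phi'.
  rewrite -(proj2 lpsi) -(proj1 lpsi); congr psi; apply/eqP; rewrite -subr_eq0; apply/eqP.
  apply: nondeg => f; rewrite pull_sub pull_add pull_linearB // (proj1 lw) -!push_pull.
  rewrite -pullM mcompZl mcomp1m -[X in pull (a *: X)]mcompm1 -mcompZr pullM.
  rewrite [push _ (pull (_ *: _) _)]push_pull (proj2 lw).
  by rewrite -!gchE lhomE_D lhomE_Z subrr.
have [e eE] := matlis_reflexive ak envJ xi (@ext_artinian Y A).
have {}eE (g : hom A X) : psi (push g pi) = w (push g e).
  have [phi phiE] := pull_linear_lhom (pull_linear_push g lw).
  by rewrite -phiE -eE xiE; apply: psi_eq => x; rewrite -phiE gchE.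
have de : push d e = 0.
  apply: contrapT => /ext_cogenerator [chi [lchi]]; apply; have [h ->] := wsurj _ _ lchi.
  rewrite -pushM -eE; have -> : push (h \oc d) pi = 0 by apply/dk; exists h.
  exact: pull_linear0.
have [f fE] := dx _ _ de.
by exists f => eps; have [g ->] := piU _ eps; rewrite eE fE push_pull.
Qed.

End Pairings.

(** * The ring generated by the two actions of k on an element *)

(** The condition lets the action of k through D be imitated on delta by endomorphisms
    of A. Elements with a deflation have this property, see [deflation_cyclic]. *)
Record cyclic_ext (k : comPzRingType) (C : lincat k) (E : bifunctor C) := CyclicExt {
  cy_D : C; cy_A : C; cy_elt : E cy_D cy_A;
  cy_pull : forall b, exists e, pull (b *: idm cy_D) cy_elt = push e cy_elt }.

Section ScalarRing.
Variables (k : comPzRingType) (C : lincat k) (E : bifunctor C) (c : cyclic_ext E).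
Local Notation D := (cy_D c).
Local Notation A := (cy_A c).
Local Notation delta := (cy_elt c).

(** The orbit of delta under both actions of k. It carries a ring structure with unit
    delta, in which x y is e_*y for any e with x = e_*delta; being generated by
    commuting scalars, the ring is commutative. *)
Inductive scal : E D A -> Prop :=
| scal1 : scal delta
| scalD x y : scal x -> scal y -> scal (x + y)
| scal_push a x : scal x -> scal (push (a *: idm A) x)
| scal_pull b x : scal x -> scal (pull (b *: idm D) x).

Lemma push_scaleC (B : C) (a : k) (e : hom A B) (x : E D A) :
  push e (push (a *: idm A) x) = push (a *: idm B) (push e x).
Proof. by rewrite -!pushM mcompZl mcompZr mcomp1m mcompm1. Qed.

Lemma pull_scaleC (a b : k) (B : C) (x : E D B) :
  pull (a *: idm D) (pull (b *: idm D) x) = pull (b *: idm D) (pull (a *: idm D) x).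
Proof. by rewrite -!pullM !mcompZl !mcompZr !scalerA mulrC. Qed.

Lemma scal_rep x : scal x -> exists e, x = push e delta.
Proof.
elim=> [|_ _ _ [e ->] _ [e' ->]|a _ _ [e ->]|b _ _ [e ->]].
- by exists (idm A); rewrite push1.
- by exists (e + e'); rewrite pushD.
- by exists (a *: idm A \oc e); rewrite pushM.
- by have [e' e'E] := cy_pull c b; exists (e \oc e'); rewrite -push_pull e'E pushM.
Qed.

Definition rep (x : E D A) : hom A A :=
  if pselect (exists e, x = push e delta) is left h then projT1 (cid h) else 0.
Lemma repE x : scal x -> push (rep x) delta = x.
Proof.
move=> sx; rewrite /rep; case: pselect => [h|]; last by case; apply: scal_rep.
by rewrite -(projT2 (cid h)).
Qed.

(** Since push commutes with both actions, e_* on the whole orbit is determined by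
    e_*delta. This makes the product independent of the representative. *)
Lemma push_scal (B : C) (e e' : hom A B) y :
  push e delta = push e' delta -> scal y -> push e y = push e' y.
Proof.
move=> ee'; elim=> [|x z _ IHx _ IHz|a x _ IH|b x _ IH] //.
- by rewrite !push_add IHx IHz.
- by rewrite !push_scaleC IH.
- by rewrite !push_pull IH.
Qed.

Definition scal_mul x y : E D A := push (rep x) y.

Lemma scal_mul_scal x y : scal x -> scal y -> scal (scal_mul x y).
Proof.
move=> sx; rewrite /scal_mul; elim=> [|z t _ IHz _ IHt|a z _ IH|b z _ IH].
- by rewrite repE.
- by rewrite push_add; apply: scalD.
- by rewrite push_scaleC; apply: scal_push.
- by rewrite push_pull; apply: scal_pull.
Qed.

Lemma scal_mul_addl x y z : scal x -> scal y -> scal z ->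
  scal_mul (x + y) z = scal_mul x z + scal_mul y z.
Proof.
move=> sx sy sz; rewrite {2 3}/scal_mul -pushD; apply: push_scal => //.
by rewrite pushD !repE //; apply: scalD.
Qed.

Lemma scal_mul_pushl a x y : scal x -> scal y ->
  scal_mul (push (a *: idm A) x) y = push (a *: idm A) (scal_mul x y).
Proof.
move=> sx sy; rewrite /scal_mul -[RHS]pushM; apply: push_scal => //.
by rewrite pushM !repE //; apply: scal_push.
Qed.

Lemma scal_mul_pulll b x y : scal x -> scal y ->
  scal_mul (pull (b *: idm D) x) y = pull (b *: idm D) (scal_mul x y).
Proof.
move=> sx; rewrite /scal_mul; elim=> [|z t _ IHz _ IHt|a z _ IH|b' z _ IH].
- by rewrite !repE //; apply: scal_pull.
- by rewrite !push_add pull_add IHz IHt.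
- by rewrite !push_scaleC IH push_pull.
- by rewrite !push_pull IH pull_scaleC.
Qed.

Lemma scal_mul1 y : scal y -> scal_mul delta y = y.
Proof.
move=> sy; rewrite -[RHS]push1; apply: push_scal => //.
by rewrite push1 repE //; apply: scal1.
Qed.

Lemma scal_mulC x y : scal x -> scal y -> scal_mul x y = scal_mul y x.
Proof.
move=> sx sy; elim: sx => {x} [|z t sz IHz st IHt|a z sz IH|b z sz IH].
- by rewrite scal_mul1 // /scal_mul repE.
- by rewrite scal_mul_addl // IHz IHt /scal_mul push_add.
- by rewrite scal_mul_pushl // IH /scal_mul push_scaleC.
- by rewrite scal_mul_pulll // IH /scal_mul push_pull.
Qed.

Lemma scal_mulA x y z : scal x -> scal y -> scal z ->
  scal_mul x (scal_mul y z) = scal_mul (scal_mul x y) z.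
Proof.
move=> sx sy sz; rewrite /scal_mul -pushM; apply: push_scal => //.
by rewrite pushM !repE // ; apply: scal_mul_scal.
Qed.

Definition scal_pred : {pred E D A} := fun x => `[< scal x >].
Lemma scal_zmod_closed : zmod_closed scal_pred.
Proof.
split=> [|x y].
  apply/asboolP; have := scal_push 0 scal1.
  by rewrite scale0r push_zero.
move=> /asboolP sx /asboolP sy; apply/asboolP; apply: scalD => //.
have := scal_push (-1) sy; rewrite scaleN1r pushN push1; exact.
Qed.
HB.instance Definition _ := GRing.isZmodClosed.Build (E D A) scal_pred scal_zmod_closed.

Record scalar_ring := ScalarRing { scalar_val : E D A; scalar_in : scalar_val \in scal_pred }.
HB.instance Definition _ := [isSub for scalar_val].
HB.instance Definition _ := [Choice of scalar_ring by <:].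
HB.instance Definition _ := [SubChoice_isSubZmodule of scalar_ring by <:].

Lemma scalar_valP (x : scalar_ring) : scal (scalar_val x).
Proof. exact/asboolP/scalar_in. Qed.
Lemma scalar_ringP (x y : scalar_ring) : scalar_val x = scalar_val y -> x = y.
Proof. exact: val_inj. Qed.
Definition scalar_of x (sx : scal x) : scalar_ring := @ScalarRing x (introT (asboolP _) sx).

Definition scalar_one := scalar_of scal1.
Definition scalar_mul (x y : scalar_ring) :=
  scalar_of (scal_mul_scal (scalar_valP x) (scalar_valP y)).
Lemma scalar_mulA : associative scalar_mul.
Proof. by move=> x y z; apply: scalar_ringP; apply: scal_mulA; apply: scalar_valP. Qed.
Lemma scalar_mulC : commutative scalar_mul.
Proof. by move=> x y; apply: scalar_ringP; apply: scal_mulC; apply: scalar_valP. Qed.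
Lemma scalar_mul1 : left_id scalar_one scalar_mul.
Proof. by move=> x; apply: scalar_ringP; apply: scal_mul1; apply: scalar_valP. Qed.
Lemma scalar_mulD : left_distributive scalar_mul +%R.
Proof. by move=> x y z; apply: scalar_ringP; apply: scal_mul_addl; apply: scalar_valP. Qed.
HB.instance Definition _ :=
  GRing.Zmodule_isComPzRing.Build scalar_ring scalar_mulA scalar_mulC scalar_mul1 scalar_mulD.

(** The two structure maps k -> Z, for the action through D and through A respectively. *)
Definition scal_by_pull (b : k) : scalar_ring := scalar_of (scal_pull b scal1).
Definition scal_by_push (a : k) : scalar_ring := scalar_of (scal_push a scal1).

Lemma scal_by_pullE b (z : scalar_ring) :
  scalar_val (scal_by_pull b * z) = pull (b *: idm D) (scalar_val z).
Proof.
rewrite -[LHS]/(scal_mul _ _) /= scal_mul_pulll; [|exact: scal1|exact: scalar_valP].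
by rewrite scal_mul1 //; apply: scalar_valP.
Qed.
Lemma scal_by_pushE a (z : scalar_ring) :
  scalar_val (scal_by_push a * z) = push (a *: idm A) (scalar_val z).
Proof.
rewrite -[LHS]/(scal_mul _ _) /= scal_mul_pushl; [|exact: scal1|exact: scalar_valP].
by rewrite scal_mul1 //; apply: scalar_valP.
Qed.

Lemma scal_by_pull_zmod : zmod_morphism scal_by_pull.
Proof. by move=> a b; apply: scalar_ringP; rewrite /= scalerBl pullB. Qed.
Lemma scal_by_pull_monoid : monoid_morphism scal_by_pull.
Proof.
split; first by apply: scalar_ringP; rewrite /= scale1r pull1.
by move=> a b; apply: scalar_ringP; rewrite scal_by_pullE /= -pullM mcompZl mcomp1m scalerA mulrC.
Qed.
HB.instance Definition _ :=
  GRing.isZmodMorphism.Build k scalar_ring scal_by_pull scal_by_pull_zmod.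
HB.instance Definition _ :=
  GRing.isMonoidMorphism.Build k scalar_ring scal_by_pull scal_by_pull_monoid.

Lemma scal_by_push_zmod : zmod_morphism scal_by_push.
Proof. by move=> a b; apply: scalar_ringP; rewrite /= scalerBl pushB. Qed.
Lemma scal_by_push_monoid : monoid_morphism scal_by_push.
Proof.
split; first by apply: scalar_ringP; rewrite /= scale1r push1.
by move=> a b; apply: scalar_ringP; rewrite scal_by_pushE /= -pushM mcompZl mcomp1m scalerA.
Qed.
HB.instance Definition _ :=
  GRing.isZmodMorphism.Build k scalar_ring scal_by_push scal_by_push_zmod.
HB.instance Definition _ :=
  GRing.isMonoidMorphism.Build k scalar_ring scal_by_push scal_by_push_monoid.

End ScalarRing.

(** * Exchanging the two actions in functionals *)

Section Twist.
Variables (k : comPzRingType) (C : lincat k) (E : bifunctor C) (c : cyclic_ext E).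
Variable J : lmodType k.
Hypothesis ak : artinian_mod k^o.
Hypothesis envJ : injective_envelope_of_residue_ring J.
Local Notation D := (cy_D c).
Local Notation A := (cy_A c).
Local Notation delta := (cy_elt c).
Local Notation Z := (scalar_ring c).
Hypothesis aco : artinian_mod (kmod (ext_contra E A) D).
Hypothesis acontra : artinian_mod (kmod (ext_contra (op_ext E) D) A).

Lemma scal_by_pull_artinian : artinian_mod (restr (@scal_by_pull _ _ _ c) Z^o).
Proof.
have l : @GRing.linear_for k (restr (@scal_by_pull _ _ _ c) Z^o)
    (kmod (ext_contra E A) D) *:%R (@scalar_val _ _ _ c).
  move=> a x y; apply: (etrans (y := scalar_val (scal_by_pull c a * x) + scalar_val y)) => //.
  by rewrite scal_by_pullE.
have [f fE] := linear_lhom l.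
by apply: (artinian_inj (f := f)) => // z; rewrite fE => z0; apply: scalar_ringP.
Qed.

Lemma scal_by_push_artinian : artinian_mod (restr (@scal_by_push _ _ _ c) Z^o).
Proof.
have l : @GRing.linear_for k (restr (@scal_by_push _ _ _ c) Z^o)
    (kmod (ext_contra (op_ext E) D) A) *:%R (@scalar_val _ _ _ c).
  move=> a x y; apply: (etrans (y := scalar_val (scal_by_push c a * x) + scalar_val y)) => //.
  by rewrite scal_by_pushE.
have [f fE] := linear_lhom l.
by apply: (artinian_inj (f := f)) => // z; rewrite fE => z0; apply: scalar_ringP.
Qed.

(** Functionals on the set of the g_*delta in E(D,B), written as functions of g and
    linear over k, where b in k moves g_*delta to g_*(io b). *)
Definition fun_along (io : {rmorphism k -> Z}) (B : C) (phi : hom A B -> J) : Prop :=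
  [/\ forall g g', phi (g + g') = phi g + phi g',
      forall g, push g delta = 0 -> phi g = 0
    & forall b g g', push g' delta = push g (scalar_val (io b)) -> phi g' = b *: phi g].

Lemma fun_along_eq io B (phi : hom A B -> J) g g' : fun_along io phi ->
  push g delta = push g' delta -> phi g = phi g'.
Proof.
case=> phiD phi0 _ gg'; rewrite -[g](subrK g') phiD phi0 ?add0r //.
by rewrite pushB gg' subrr.
Qed.

Lemma fun_along0 io B : fun_along io (fun _ : hom A B => 0).
Proof. by split=> // [g g'|b g g' _]; rewrite ?addr0 ?scaler0. Qed.

Lemma fun_along_add io B (phi psi : hom A B -> J) :
  fun_along io phi -> fun_along io psi -> fun_along io (fun g => phi g + psi g).
Proof.
case=> phiD phi0 phiZ [psiD psi0 psiZ]; split=> [g g'|g g0|b g g' gg'].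
- by rewrite phiD psiD addrACA.
- by rewrite phi0 ?psi0 ?addr0.
- by rewrite (phiZ b g g' gg') (psiZ b g g' gg') scalerDr.
Qed.

Lemma fun_along_precomp io B B' (f : hom B B') (phi : hom A B' -> J) :
  fun_along io phi -> fun_along io (fun g : hom A B => phi (f \oc g)).
Proof.
case=> phiD phi0 phiZ; split=> [g g'|g g0|b g g' gg'].
- by rewrite mcompDr phiD.
- by rewrite phi0 // pushM g0 push0.
- by apply: phiZ; rewrite !pushM gg'.
Qed.

Section Transport.
Variables (io io' : {rmorphism k -> Z}) (h : lhom (coind J io) (coind J io')).

(** The element z -> phi(g_*z) of Hom_k(Z, J). In this way phi becomes a Z-linear map
    into Hom_k(Z, J), and a functional for another k-structure is obtained by applying
    an isomorphism h of Z-modules and evaluating at 1. *)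
Definition orbit_fun B (phi : hom A B -> J) (g : hom A B) : coind J io :=
  if pselect (exists v : coind J io, forall z, coind_eval v z = phi (g \oc rep (scalar_val z)))
  is left e then projT1 (cid e) else 0.

Lemma orbit_funE B (phi : hom A B -> J) g z : fun_along io phi ->
  coind_eval (orbit_fun phi g) z = phi (g \oc rep (scalar_val z)).
Proof.
move=> lphi; have [phiD phi0 phiZ] := lphi.
rewrite /orbit_fun; case: pselect => [e|]; first by rewrite (projT2 (cid e)).
case; apply: coind_ex => [x y|b x].
  rewrite -phiD; apply: fun_along_eq lphi _.
  by rewrite pushD !pushM !repE ?push_add //; apply: scalar_valP.
apply: phiZ; rewrite !pushM repE; last exact: scalar_valP.
rewrite -[scalar_val (_ * _)]/(scal_mul (scalar_val (io b)) (scalar_val x)) scal_mulC //;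
  exact: scalar_valP.
Qed.

Lemma orbit_funD B (phi : hom A B -> J) g g' : fun_along io phi ->
  orbit_fun phi (g + g') = orbit_fun phi g + orbit_fun phi g'.
Proof.
move=> lphi; apply: coind_evalP => z; rewrite coind_eval_add !orbit_funE // mcompDl.
by case: lphi.
Qed.

Lemma orbit_fun_scale B (phi : hom A B -> J) g g' (z : Z) : fun_along io phi ->
  push g' delta = push g (scalar_val z) -> orbit_fun phi g' = z *: orbit_fun phi g.
Proof.
move=> lphi gg'; apply: coind_evalP => x; rewrite coind_eval_scale !orbit_funE //.
apply: fun_along_eq lphi _; rewrite !pushM !repE; try exact: scalar_valP.
rewrite -[scalar_val (_ * _)]/(scal_mul (scalar_val z) (scalar_val x)) /scal_mul -pushM.
apply: push_scal; last exact: scalar_valP.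
by rewrite pushM repE //; apply: scalar_valP.
Qed.

Definition transport B (phi : hom A B -> J) (g : hom A B) : J := coind_eval (h (orbit_fun phi g)) 1.

Lemma transport_along B (phi : hom A B -> J) : fun_along io phi -> fun_along io' (transport phi).
Proof.
move=> lphi; split=> [g g'|g g0|b g g' gg']; rewrite /transport.
- by rewrite orbit_funD // lhD.
- by rewrite (@orbit_fun_scale _ _ 0 _ 0) ?scale0r ?lh0 // push_zero.
- by rewrite (orbit_fun_scale lphi gg') lhZ coind_eval_scale coind_evalZ.
Qed.

Lemma transport_add B (phi psi : hom A B -> J) g : fun_along io phi -> fun_along io psi ->
  transport (fun g => phi g + psi g) g = transport phi g + transport psi g.
Proof.
move=> lphi lpsi; have lphipsi := fun_along_add lphi lpsi.
rewrite /transport -coind_eval_add -lhD; congr (coind_eval (lfun_of h _) 1).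
by apply: coind_evalP => z; rewrite coind_eval_add !orbit_funE.
Qed.

Lemma transport_nat B B' (f : hom B B') (phi : hom A B' -> J) g : fun_along io phi ->
  transport (fun g : hom A B => phi (f \oc g)) g = transport phi (f \oc g).
Proof.
move=> lphi; have lphif := fun_along_precomp f lphi.
rewrite /transport; congr (coind_eval (lfun_of h _) 1).
by apply: coind_evalP => z; rewrite !orbit_funE // mcompA.
Qed.

End Transport.

Lemma orbit_transport io io' (h : lhom (coind J io) (coind J io')) B (phi : hom A B -> J) g :
  fun_along io phi -> orbit_fun io' (transport h phi) g = h (orbit_fun io phi g).
Proof.
move=> lphi; apply: coind_evalP => z.
rewrite orbit_funE; last exact: transport_along.
rewrite /transport (@orbit_fun_scale _ _ phi g _ z) //.
  by rewrite lhZ coind_eval_scale mulr1.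
by rewrite pushM repE //; apply: scalar_valP.
Qed.

Lemma transportK io io' (h : lhom (coind J io) (coind J io')) (h' : lhom (coind J io') (coind J io))
  B (phi : hom A B -> J) g : cancel h h' -> fun_along io phi ->
  transport h' (transport h phi) g = phi g.
Proof.
move=> hK lphi; rewrite {1}/transport orbit_transport // hK orbit_funE //.
apply: fun_along_eq lphi _; rewrite pushM repE //; exact: scalar_valP.
Qed.

Definition push_functional B (phi : hom A B -> J) : Prop :=
  [/\ forall g g', phi (g + g') = phi g + phi g',
      forall g, push g delta = 0 -> phi g = 0
    & forall a g, phi (a *: g) = a *: phi g].

(** Linearity for the action through D needs a second morphism g', because b times
    g_*delta is g'_*delta for some g' that is no canonical multiple of g. *)
Definition pull_functional B (phi : hom A B -> J) : Prop :=
  [/\ forall g g', phi (g + g') = phi g + phi g',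
      forall g, push g delta = 0 -> phi g = 0
    & forall b g g', push g' delta = pull (b *: idm D) (push g delta) -> phi g' = b *: phi g].

Lemma push_functionalE B (phi : hom A B -> J) :
  push_functional phi <-> fun_along (@scal_by_push _ _ _ c) phi.
Proof.
split=> [[phiD phi0 phiZ]|l].
  split=> // b g g' e; rewrite -phiZ; apply/eqP.
  have phiN x : phi (- x) = - phi x.
    by apply: (addrI (phi x)); rewrite -phiD !subrr phi0 ?push_zero.
  rewrite -subr_eq0 -phiN -phiD phi0 // pushB e /=.
  have -> : b *: g = (b *: idm B) \oc g by rewrite mcompZl mcomp1m.
  by rewrite push_scaleC pushM subrr.
have [phiD phi0 phiZ] := l; split=> // a g; apply: phiZ => /=.
have -> : a *: g = (a *: idm B) \oc g by rewrite mcompZl mcomp1m.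
by rewrite push_scaleC pushM.
Qed.

Lemma pull_functionalE B (phi : hom A B -> J) :
  pull_functional phi <-> fun_along (@scal_by_pull _ _ _ c) phi.
Proof.
split=> -[phiD phi0 phiZ]; split=> // b g g' e; apply: phiZ; rewrite e /=.
  by rewrite push_pull.
by rewrite push_pull.
Qed.

Definition functional_twisting (T T' : forall B, (hom A B -> J) -> hom A B -> J) : Prop :=
  [/\ forall B phi, push_functional phi -> pull_functional (T B phi) /\ T' B (T B phi) = phi,
      forall B phi, pull_functional phi -> push_functional (T' B phi) /\ T B (T' B phi) = phi,
      forall B phi psi, push_functional phi -> push_functional psi ->
        T B (fun g => phi g + psi g) = (fun g => T B phi g + T B psi g),
      forall B phi psi, pull_functional phi -> pull_functional psi ->
        T' B (fun g => phi g + psi g) = (fun g => T' B phi g + T' B psi g)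
    & (forall B B' (f : hom B B') phi, push_functional phi ->
        T B (fun g => phi (f \oc g)) = (fun g => T B' phi (f \oc g))) /\
      (forall B B' (f : hom B B') phi, pull_functional phi ->
        T' B (fun g => phi (f \oc g)) = (fun g => T' B' phi (f \oc g)))].

(** Apply [coind_iso] to the ring generated by the two actions on delta, which is
    artinian for both as a submodule of E(D,A). *)
Theorem functional_twist : exists T T', functional_twisting T T'.
Proof.
have [h [h' [hK h'K]]] := coind_iso ak envJ scal_by_push_artinian scal_by_pull_artinian.
exists (@transport _ _ h), (@transport _ _ h'); split.
- move=> B phi /push_functionalE l; split; first exact/pull_functionalE/transport_along.
  by apply/funext => g; apply: transportK.
- move=> B phi /pull_functionalE l; split; first exact/push_functionalE/transport_along.
  by apply/funext => g; apply: transportK.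
- move=> B phi psi /push_functionalE l /push_functionalE l'; apply/funext => g.
  exact: transport_add.
- move=> B phi psi /pull_functionalE l /pull_functionalE l'; apply/funext => g.
  exact: transport_add.
- split=> B B' f phi; first by move/push_functionalE=> l; apply/funext => g; apply: transport_nat.
  by move/pull_functionalE=> l; apply/funext => g; apply: transport_nat.
Qed.

Lemma functional_twisting0 T T' B : functional_twisting T T' ->
  T B (fun=> 0) = (fun=> 0) /\ T' B (fun=> 0) = (fun=> 0).
Proof.
have e : (fun _ : hom A B => 0 + 0 : J) = (fun=> 0) by apply/funext => x; rewrite addr0.
case=> _ _ TD T'D _; split; apply/funext => g.
- have /push_functionalE l := @fun_along0 (@scal_by_push _ _ _ c) B.
  have /(congr1 (fun f => f g)) /= := TD _ _ _ l l; rewrite e => z.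
  by apply: (addrI (T B (fun=> 0) g)); rewrite -z addr0.
- have /pull_functionalE l := @fun_along0 (@scal_by_pull _ _ _ c) B.
  have /(congr1 (fun f => f g)) /= := T'D _ _ _ l l; rewrite e => z.
  by apply: (addrI (T' B (fun=> 0) g)); rewrite -z addr0.
Qed.

End Twist.

(** * Consequences of the dualizing hypothesis *)

Section DualPresentation.
Variables (k : comPzRingType) (J : lmodType k).

(** The image of the identity of Y under C(Y,-) -> DF is the generator y. The evaluation
    ev identifies DF W with the functionals on C(W,X0) that vanish on multiples of v; it
    is a parameter because DF is the dual of a functor either on the category or on its
    opposite. *)
Lemma presentation_elements (C : lincat k) (X1 X0 : C) (v : hom X1 X0) (DF : abfun C)
    (ev : forall W, DF W -> hom W X0 -> J) :
  (forall W phi, linear (@ev W phi)) ->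
  (forall W phi (h : hom W X1), ev W phi (v \oc h) = 0) ->
  (forall W phi, (forall c, ev W phi c = 0) -> phi = 0) ->
  (forall W c, ev W 0 c = 0) ->
  (forall W phi phi' c, ev W (phi - phi') c = ev W phi c - ev W phi' c) ->
  (forall W (psi : lhom (hom W X0) J), (forall h : hom W X1, psi (v \oc h) = 0) ->
     exists phi, forall c, ev W phi c = psi c) ->
  (forall W W' (f : hom W W') phi c, ev W' (amap f phi) c = ev W phi (c \oc f)) ->
  finitely_presented DF ->
  exists (Y Z : C) (u : hom Y Z) (y : lhom (hom Y X0) J),
  [/\ forall h : hom Y X1, y (v \oc h) = 0,
      forall W (psi : lhom (hom W X0) J), (forall h : hom W X1, psi (v \oc h) = 0) ->
        exists f : hom Y W, forall c, psi c = y (c \oc f)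
    & forall W (f : hom Y W), (forall c : hom W X0, y (c \oc f) = 0) <->
        exists h : hom Z W, f = h \oc u].
Proof.
move=> evlin evv ev0 ev0' evB evs evm [Y [Z [u [eta [etaD etab etaN]]]]].
have eta0 W : eta W 0 = 0 by apply: (addrI (eta W 0)); rewrite -etaD !addr0.
have etai W := bij_inj (etab W).
have [y0 y0E] : exists y0, eta Y y0 = qclass _ (idm Y).
  by have [g _ gK] := etab Y; exists (g (qclass _ (idm Y))); rewrite gK.
have etaf W (f : hom Y W) : eta W (amap f y0) = qclass _ f.
  rewrite etaN y0E; apply: etrans (coker_mapE _ _ _) _; by rewrite mcompm1.
have [y yE] := linear_lhom (evlin Y y0).
exists Y, Z, u, y; split=> [h|W psi psi0|W f].
- by rewrite yE evv.
- have [phi phiE] := evs _ _ psi0; exists (qrepr (eta W phi)) => c.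
  have -> : phi = amap (qrepr (eta W phi)) y0 by apply: etai; rewrite etaf qreprK.
  rewrite yE -evm etaf qreprK -phiE; congr (ev W _ c).
  by apply: etai; rewrite etaf qreprK.
- have -> : (exists h : hom Z W, f = h \oc u) <-> amap f y0 = 0.
    split=> [hf|e]; last by apply/(qclass_eq0 (precomp_image u W) f); rewrite -etaf e eta0.
    by apply: etai; rewrite etaf eta0; apply/qclass_eq0.
  split=> [yf|e c]; last by rewrite yE -evm e ev0'.
  by apply: ev0 => c; rewrite evm -yE.
Qed.

Lemma coker_fp (C : lincat k) (X Y : C) (f : hom X Y) : finitely_presented (coker_fun f).
Proof. by exists X, Y, f, (fun _ x => x); split=> // A; exists id. Qed.

Lemma dualizing_presented (C : lincat k) : dualizing_variety J C -> dual_presented J C.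
Proof.
case=> _ _ dual _ X1 X0 v.
pose F := @coker_fun k (op C) X0 X1 v.
apply: (@presentation_elements C X1 X0 v (unop (kdual J F))
  (fun W (phi : lhom (kmod F W) J) (c : hom W X0) =>
     phi (qclass (@precomp_image k (op C) X0 X1 v W) c))).
- move=> W phi a x y; rewrite qclassD; apply: etrans (lhD (phi : lhom (kmod F W) J) _ _) _.
  congr (_ + _); rewrite -[RHS](lhZ (phi : lhom (kmod F W) J)); congr (lfun_of _ _).
  apply: etrans (esym (@coker_mapE k (op C) X0 X1 v W W (a *: idm W) x)) => /=.
  by rewrite mcompZr mcompm1.
- move=> W phi h; have -> : qclass (@precomp_image k (op C) X0 X1 v W) (v \oc h) = 0.
    by apply/qclass_eq0; exists h.
  exact: lh0.
- by move=> W phi h; apply: lhomP => x; rewrite -[x](qreprK (x : lquot _)); apply: h.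
- by [].
- by [].
- move=> W psi psi0.
  have [|g gE] := @quot_lift _ _ _ (@precomp_image k (op C) X0 X1 v W) psi.
    by move=> _ [h ->]; apply: psi0.
  have [|phi phiE] := @linear_lhom _ (kmod F W) J g; last by exists phi => c; rewrite phiE gE.
  move=> a x y; rewrite lhD -lhZ; congr (lfun_of g _ + _).
  rewrite -[x](qreprK (x : lquot _)) -qclassZ.
  apply: etrans (@coker_mapE k (op C) X0 X1 v W W (a *: idm W) _) _ => /=.
  by rewrite mcompZr mcompm1.
- move=> W W' f phi c; rewrite -[LHS]/(lfun_of phi (coker_map _ _)); congr (lfun_of phi _).
  exact: (@coker_mapE k (op C) X0 X1 v W' W f c).
- by apply: dual; apply: coker_fp.
Qed.

Lemma dualizing_presented_op (C : lincat k) : dualizing_variety J C -> dual_presented J (op C).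
Proof.
case=> _ _ _ dual X1 X0 v.
pose F := @coker_fun k C X0 X1 v.
apply: (@presentation_elements (op C) X1 X0 v (kdual J F)
  (fun W (phi : lhom (kmod F W) J) (c : @hom k C X0 W) =>
     phi (qclass (@precomp_image k C X0 X1 v W) c))).
- move=> W phi a x y; rewrite qclassD; apply: etrans (lhD (phi : lhom (kmod F W) J) _ _) _.
  congr (_ + _); rewrite -[RHS](lhZ (phi : lhom (kmod F W) J)); congr (lfun_of _ _).
  apply: etrans (esym (@coker_mapE k C X0 X1 v W W (a *: idm W) x)) => /=.
  by rewrite mcompZl mcomp1m.
- move=> W phi h; rewrite /=.
  have -> : qclass (@precomp_image k C X0 X1 v W) (@mcomp k C _ _ _ h v) = 0.
    by apply/qclass_eq0; exists h.
  exact: lh0.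
- by move=> W phi h; apply: lhomP => x; rewrite -[x](qreprK (x : lquot _)); apply: h.
- by [].
- by [].
- move=> W psi psi0.
  have [|g gE] := @quot_lift _ _ _ (@precomp_image k C X0 X1 v W) psi.
    by move=> _ [h ->]; apply: psi0.
  have [|phi phiE] := @linear_lhom _ (kmod F W) J g; last by exists phi => c; rewrite phiE gE.
  move=> a x y; rewrite lhD -lhZ; congr (lfun_of g _ + _).
  rewrite -[x](qreprK (x : lquot _)) -qclassZ.
  apply: etrans (@coker_mapE k C X0 X1 v W W (a *: idm W) _) _ => /=.
  by rewrite mcompZl mcomp1m.
- move=> W W' f phi c; rewrite -[LHS]/(lfun_of phi (coker_map _ _)); congr (lfun_of phi _).
  exact: (@coker_mapE k C X0 X1 v W' W f c).
- by apply: dual; apply: coker_fp.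
Qed.

Lemma hom_finite_artinian (C : lincat k) (A B : C) : artinian k -> hom_finite C ->
  artinian_mod (hom A B).
Proof.
move=> /artinianW ak fin; have [m [g gE]] := fin A B.
exact: (@artinian_fg _ _ m g).
Qed.

Lemma addcat_biproducts (C : addcat k) : has_biproducts C.
Proof.
move=> A B; exists (bip A B), (inl_ _ _), (inr_ _ _), (prl _ _), (prr _ _).
by split; [apply: prl_inl | apply: prr_inr | apply: prl_inr | apply: prr_inl | apply: bip_id].
Qed.

Lemma has_biproducts_op (C : lincat k) : has_biproducts C -> has_biproducts (op C).
Proof.
move=> bC A B; have [S [il [ir [pl [pr [h1 h2 h3 h4 h5]]]]]] := bC A B.
by exists S, pl, pr, il, ir.
Qed.

Lemma idempotents_split_op (C : lincat k) : idempotents_split C -> idempotents_split (op C).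
Proof. by move=> sC Y e ee; have [W [i [p [pi ip]]]] := sC Y e ee; exists W, p, i. Qed.

End DualPresentation.

(** * Exactness of n-exangulated categories *)

Section Exangles.
Variables (k : comPzRingType) (C : addcat k) (n : nat) (n_gt0 : (0 < n)%N).
Variable S : nexangulated C n_gt0.

Lemma eqmK (A B : C) (e : A = B) : eqm (esym e) \oc eqm e = idm A.
Proof. by case: _ / e; rewrite mcomp1m. Qed.
Lemma dfirst_cocone (A D A' D' : C) (X : cplx n A D) (Y : cplx n A' D') (f : chain_map X Y) :
  exists (a : hom A' (cocone f 1)) (b : hom (X 1) (cocone f 1)),
    dfirst (cocone f) = a \oc cm_first f + b \oc dfirst X.
Proof.
have [a [b abE]] : exists (a : hom (Y 0) (cocone f 1)) (b : hom (X 1) (cocone f 1)),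
    cocone_d f 0 = a \oc f 0%N + b \oc cd X 0.
  rewrite /cocone /= /cocone_d0; case: (0 < n)%N n_gt0 => // _.
  by exists (inl_ _ _), (inr_ _ _).
exists (a \oc eqm (esym (cob_first Y))), b.
rewrite /dfirst /cm_first -[cd (cocone f) 0]/(cocone_d f 0) abE mcompDl -!mcompA.
by rewrite [eqm (esym _) \oc (eqm _ \oc _)]mcompA eqmK mcomp1m.
Qed.

Lemma dlast_cone (A D A' D' : C) (X : cplx n A D) (Y : cplx n A' D') (f : chain_map X Y) :
  exists (a : hom (cone f n) D) (b : hom (cone f n) (Y n)),
    dlast (cone f) = cm_last f \oc a + dlast Y \oc b.
Proof.
have [a [b abE]] : exists (a : hom (cone f n) (X n.+1)) (b : hom (cone f n) (Y n)),
    dlast (cone f) = eqm (cob_last Y) \oc (f n.+1 \oc a + cd Y n \oc b).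
  rewrite /dlast; move: (cob_last (cone f)); rewrite /=.
  case: n n_gt0 X Y f => [//|m] _ X Y f /=.
  move: (cob_last Y); rewrite /cone_dS.
  case: (m.+1 < m.+1)%N (ltnn m.+1) => // _; case: (m < m.+1)%N (ltnSn m) => // _.
  move=> e e'; rewrite (Prop_irrelevance e' e).
  by exists (prl _ _), (prr _ _).
exists (eqm (cob_last X) \oc a), b; rewrite abE mcompDr /cm_last /dlast -!mcompA.
by rewrite [eqm (esym _) \oc (eqm _ \oc _)]mcompA eqmK mcomp1m.
Qed.

(** Let d be the last morphism and d^*eps = 0. Put rho = (delta, eps) in E(D, A + B), so
    that d^*rho = 0. The mapping cocone of a lift of the projection onto A realizes
    d^*rho = 0, so its first morphism, which is made of that projection and of the first
    morphism of a realization of rho, has a retraction h. So the identity of A + B is a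
    morphism through the projection onto A plus one that kills rho; hence rho, and with
    it eps, is a pushout of delta. *)
Lemma distinguished_deflation (D A : C) (X : cplx n A D) (delta : S D A) :
  distinguished X delta -> is_deflation delta (dlast X).
Proof.
move=> dX; have rS := nex_realP S.
have [d0 dn [_ exl] [_ exr]] := real_R1 rS dX.
split=> [W g|B eps deps]; first exact: exl.
pose rho := push (inl_ A B) delta + push (inr_ A B) eps.
have rhol : push (prl A B) rho = delta.
  by rewrite push_add -!pushM prl_inl prl_inr push1 push_zero addr0.
have rhor : push (prr A B) rho = eps.
  by rewrite push_add -!pushM prr_inl prr_inr push1 push_zero add0r.
have [W rW] := real_ex rS rho.
have [|f [[f1 f2]]] := @nex_EA2op _ _ _ _ S _ _ _ rho (prl A B) W X rW; first by rewrite rhol.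
have -> : pull (dlast X) rho = 0 by rewrite pull_add -!push_pull dn deps !push0 addr0.
move=> rc; have [_ _ _ [_ exc]] := real_R1 rS rc.
have [h hE] := proj1 (exc _ (idm _)) (push0 _ _ _).
have [a [b abE]] := dfirst_cocone f; rewrite abE f1 in hE.
have [W0 _ _ _] := real_R1 rS rW.
move: (dfirst W) hE W0 => dW hE W0.
exists (prr A B \oc h \oc a).
rewrite -[LHS]rhor -[prr A B in LHS]mcompm1 hE !mcompDr pushD.
rewrite !mcompA [X in _ + X]pushM W0 push0 addr0 pushM.
by rewrite rhol.
Qed.

(** The argument of [distinguished_deflation] with the mapping cone of a lift of the
    inclusion of D into D + B. *)
Lemma distinguished_inflation (D A : C) (X : cplx n A D) (delta : S D A) :
  distinguished X delta -> is_inflation delta (dfirst X).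
Proof.
move=> dX; have rS := nex_realP S.
have [d0 dn [_ exl] [_ exr]] := real_R1 rS dX.
split=> [W g|B eps deps]; first exact: exr.
pose rho := pull (prl D B) delta + pull (prr D B) eps.
have rhol : pull (inl_ D B) rho = delta.
  by rewrite pull_add -!pullM prl_inl prr_inl pull1 pull_zero addr0.
have rhor : pull (inr_ D B) rho = eps.
  by rewrite pull_add -!pullM prl_inr prr_inr pull1 pull_zero add0r.
have [Y rY] := real_ex rS rho.
have [|f [[f1 f2]]] := @nex_EA2 _ _ _ _ S _ _ _ rho (inl_ D B) X Y _ rY; first by rewrite rhol.
have -> : push (dfirst X) rho = 0 by rewrite push_add !push_pull d0 deps !pull0 addr0.
move=> rc; have [_ _ [_ exc] _] := real_R1 rS rc.
have [h hE] := proj1 (exc _ (idm _)) (pull0 _ _ _).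
have [a [b abE]] := dlast_cone f; rewrite abE f2 in hE.
have [_ Y0 _ _] := real_R1 rS rY.
move: (dlast Y) b abE hE Y0 => dY b _ hE Y0.
exists (a \oc h \oc inr_ D B).
rewrite -[LHS]rhor -[inr_ D B in LHS]mcomp1m hE !mcompDl pullD.
rewrite -!mcompA [X in _ + X]pullM Y0 pull0 addr0 pullM.
by rewrite rhol.
Qed.

Lemma projective_ext (P B : C) (eps : S P B) : projective S P -> eps = 0.
Proof.
move=> PP; have rS := nex_realP S; have [X rX] := real_ex rS eps.
have [g gE] := PP _ _ _ _ rX (idm P).
have [_ dn _ _] := real_R1 rS rX.
by rewrite -[eps]pull1 gE pullM dn pull0.
Qed.

Lemma injective_ext (I B : C) (eps : S B I) : injective_ob S I -> eps = 0.
Proof.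
move=> II; have rS := nex_realP S; have [X rX] := real_ex rS eps.
have [g gE] := II _ _ _ _ rX (idm I).
have [d0 _ _ _] := real_R1 rS rX.
by rewrite -[eps]push1 gE pushM d0 push0.
Qed.

Hypothesis enoughP : enough_projectives S.
Hypothesis enoughI : enough_injectives S.

(** If X^n is projective, then E(X^n,-) vanishes, so the last morphism kills all of
    E(W,-), whose elements are therefore pushouts of the class of the n-exangle. Dually
    if X^1 is injective. *)
Lemma nexangulated_exact : exact_bifunctor S.
Proof.
have rS := nex_realP S; split=> [D A delta|D A delta|W|X].
- have [X rX] := real_ex rS delta; exists (X n), (dlast X).
  exact: distinguished_deflation.
- have [X rX] := real_ex rS delta; exists (X 1%N), (dfirst X).
  exact: distinguished_inflation.
- have [A [X [delta [dX PX]]]] := enoughP W; exists A, delta => B eps.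
  apply: (proj2 (distinguished_deflation dX)); apply: projective_ext.
  by apply: PX; rewrite n_gt0 leqnn.
- have [D [Y [delta [dY IY]]]] := enoughI X; exists D, delta => B eps.
  apply: (proj2 (distinguished_inflation dY)); apply: injective_ext.
  by apply: IY; rewrite n_gt0.
Qed.

Lemma proj_idealP (Y W : C) (f : hom Y W) : proj_ideal S Y W f <-> pull_null S f.
Proof.
split=> [[P [h [g [PP ->]]]] A eps|nf].
  by rewrite pullM (projective_ext (pull h eps) PP) pull0.
have [A [X [delta [dX PX]]]] := enoughP W.
have [h hE] := proj1 (proj1 (distinguished_deflation dX) _ f) (nf _ delta).
by exists (X n), (dlast X), h; split=> //; apply: PX; rewrite n_gt0 leqnn.
Qed.

Lemma inj_idealP (A B : C) (g : hom A B) : inj_ideal S A B g <-> push_null S g.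
Proof.
split=> [[I [h [f [II ->]]]] D eps|ng].
  by rewrite pushM (injective_ext (push f eps) II) push0.
have [D [Y [delta [dY IY]]]] := enoughI A.
have [h hE] := proj1 (proj1 (distinguished_inflation dY) _ g) (ng _ delta).
by exists (Y 1%N), h, (dfirst Y); split=> //; apply: IY; rewrite n_gt0.
Qed.

End Exangles.

(** * Perfect pairings at a prescribed object *)

Section TwoSided.
Variables (k : comPzRingType) (J : lmodType k) (C : lincat k) (E : bifunctor C).
Hypothesis ak : artinian_mod k^o.
Hypothesis envJ : injective_envelope_of_residue_ring J.
Hypothesis aC : forall A B : C, artinian_mod (hom A B).
Hypothesis bipC : has_biproducts C.
Hypothesis splitC : idempotents_split C.
Hypothesis dualC : dual_presented J C.
Hypothesis dualCop : dual_presented J (op C).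
Hypothesis exE : exact_bifunctor E.

Lemma pairing_left (X : C) : exists (Y : C) (w : E Y X -> J),
  represents_pull w /\ represents_push w.
Proof.
have [Y [w rw]] := ext_pull_functional_representable ak envJ aC bipC splitC dualC dualCop exE X.
by exists Y, w; split=> //; apply: (represents_pull_push ak envJ aC exE).
Qed.

(** Scalars commute with the deflation d of delta, so d kills b delta, which is then a
    pushout of delta. *)
Lemma deflation_cyclic (D A : C) (delta : E D A) b :
  exists e, pull (b *: idm D) delta = push e delta.
Proof.
have [defl _ _ _] := exE; have [B [d [dk dx]]] := defl _ _ delta.
apply: dx; rewrite -pullM mcompZl mcomp1m -[d]mcompm1 -mcompZr pullM.
have -> : pull d delta = 0 by apply/dk; exists (idm _); rewrite mcompm1.
exact: pull0.
Qed.

Definition cyclic_delta (D A : C) (delta : E D A) : cyclic_ext E :=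
  CyclicExt (@deflation_cyclic D A delta).

Lemma twist_delta (D A : C) (delta : E D A) :
  exists T T', @functional_twisting _ _ _ (cyclic_delta delta) J T T'.
Proof.
apply: functional_twist => //=; first exact: ext_artinian.
have aCop (A' B' : op C) : artinian_mod (hom A' B') by apply: aC.
exact: (@ext_artinian k (op C) (op_ext E) aCop (exact_bifunctor_op exE)).
Qed.

Lemma universal_functional (D A : C) (pi : E D A) B (phi : hom A B -> J) :
  (forall B (eps : E D B), exists g, eps = push g pi) ->
  (forall g g', phi (g + g') = phi g + phi g') ->
  (forall g, push g pi = 0 -> phi g = 0) ->
  exists psi : E D B -> J, forall g, psi (push g pi) = phi g.
Proof.
move=> piU phiD phi0; have [ch chE] := choice (piU B).
exists (fun e => phi (ch e)) => g; rewrite -[ch _](subrK g) phiD phi0 ?add0r //.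
by rewrite pushB -chE subrr.
Qed.

(** Representability in the opposite category, where the linear structure is the action
    of k through the second argument. *)
Lemma ext_push_functional_representable (Y : C) : exists (X : C) (w : E Y X -> J),
  [/\ (forall x y, w (x + y) = w x + w y) /\ (forall a x, w (push (a *: idm X) x) = a *: w x),
      forall B (g : hom B X), (forall e : E Y B, w (push g e) = 0) -> push_null E g
    & forall B (psi : E Y B -> J), (forall x y, psi (x + y) = psi x + psi y) ->
        (forall a x, psi (push (a *: idm B) x) = a *: psi x) ->
      exists g : hom B X, forall e, psi e = w (push g e)].
Proof.
have aCop (A' B' : op C) : artinian_mod (hom A' B') by apply: aC.
have [X [w [lw winj wsurj]]] := @ext_pull_functional_representable k J (op C) (op_ext E) ak envJ
  aCop (has_biproducts_op bipC) (idempotents_split_op splitC) dualCop dualC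
  (exact_bifunctor_op exE) Y.
exists X, w; split; [exact: lw | by move=> B g h D eps; apply: (winj B g) |].
by move=> B psi h1 h2; apply: (wsurj B psi).
Qed.

(** Duality gives X and a functional w0 on E(Y,X) that is linear for the action of k
    through X and represents D E(Y,-) for that action. Twisting it along an element pi
    universal for E(Y,-) yields a functional linear for the action through Y, and
    naturality of the twist transfers representability. *)
Lemma pairing_right (Y : C) : exists (X : C) (w : E Y X -> J),
  represents_pull w /\ represents_push w.
Proof.
have [X [w0 [lw0 w0inj w0surj]]] := ext_push_functional_representable Y.
have [_ _ proj _] := exE; have [A [pi piU]] := proj Y.
have [T [T' tw]] := twist_delta pi; have [TC T'C _ _ [TN _]] := tw.
have psi00 B (psi : E Y B -> J) : (forall x y, psi (x + y) = psi x + psi y) -> psi 0 = 0.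
  by move=> psiD; apply: (addrI (psi 0)); rewrite -psiD !addr0.
pose phi (g : hom A X) := w0 (push g pi).
have cphi B (g : hom B X) : @push_functional _ _ _ (cyclic_delta pi) J B (fun h => phi (g \oc h)).
  rewrite /phi; split=> [h h'|h /= h0|a h].
  - by rewrite mcompDr pushD (proj1 lw0).
  - by rewrite pushM h0 push0 psi00 //; case: lw0.
  - by rewrite mcompZr -(proj2 lw0) -pushM mcompZl mcomp1m.
have cphi1 : @push_functional _ _ _ (cyclic_delta pi) J X phi.
  have -> : phi = (fun h => phi (idm X \oc h)) by apply/funext => h; rewrite mcomp1m.
  exact: cphi.
have [[TD1 T01 TZ1] _] := TC _ _ cphi1.
have [w wE] := universal_functional piU TD1 T01.
suff rw : represents_push w.
  by exists X, w; split=> //; apply: (represents_push_pull ak envJ aC exE).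
have lw : pull_linear w.
  split=> [x y|a x].
    by have [g ->] := piU _ x; have [g' ->] := piU _ y; rewrite -pushD !wE TD1.
  have [g ->] := piU _ x; have [g' g'E] := piU _ (pull (a *: idm Y) (push g pi)).
  by rewrite g'E !wE; apply: TZ1; rewrite -g'E.
split=> // [B g wg|B psi [psiD psiZ]].
  apply: w0inj => e; have [g0 ->] := piU _ e; rewrite -pushM -[LHS]/(phi (g \oc g0)).
  have [_ /(congr1 (fun f => f g0)) /= <-] := TC _ _ (cphi _ g).
  have -> : T B (fun h => phi (g \oc h)) = (fun=> 0).
    by rewrite TN //; apply/funext => h; rewrite -wE pushM wg.
  by rewrite (proj2 (functional_twisting0 B tw)).
have cpsi : @pull_functional _ _ _ (cyclic_delta pi) J B (fun g => psi (push g pi)).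
  split=> [g g'|g /= ->|b g g' /= ->] //; first by rewrite pushD psiD.
  exact: psi00.
have [[T'D1 T'01 T'Z1] T'K] := T'C _ _ cpsi.
have [psi2 psi2E] := universal_functional piU T'D1 T'01.
have [||g gE] := w0surj _ psi2.
- by move=> x y; have [h ->] := piU _ x; have [h' ->] := piU _ y; rewrite -pushD !psi2E T'D1.
- move=> a x; have [h ->] := piU _ x; rewrite -pushM mcompZl mcomp1m !psi2E.
  exact: T'Z1.
exists g => e; have [h ->] := piU _ e.
move/(congr1 (fun f => f h)): T'K => /= <-.
have -> : T' B (fun g => psi (push g pi)) = (fun h => phi (g \oc h)).
  by apply/funext => x; rewrite -psi2E gE /phi pushM.
by rewrite TN // -wE pushM.
Qed.

End TwoSided.

(** * The translations as transposes *)

(** An isomorphism is often easier to describe as a relation than as a map; additivity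
    reduces single-valuedness and injectivity to the case of zero. *)
Lemma ab_iso_rel (k : comPzRingType) (C : lincat k) (F G : abfun C)
    (R : forall A, F A -> G A -> Prop) :
  (forall A x, exists y, R A x y) -> (forall A y, exists x, R A x y) ->
  (forall A x x' y y', R A x y -> R A x' y' -> R A (x + x') (y + y')) ->
  (forall A x y, R A x y -> (x = 0 <-> y = 0)) ->
  (forall A B (f : hom A B) x y, R A x y -> R B (amap f x) (amap f y)) ->
  ab_iso F G.
Proof.
move=> tot sur add zero nat.
have func A x y y' : R A x y -> R A x y' -> y = y'.
  move=> xy xy'; have [z xz] := tot A (- x).
  have /zero [/(_ (subrr x)) yz _] := add _ _ _ _ _ xy xz.
  have /zero [/(_ (subrr x)) y'z _] := add _ _ _ _ _ xy' xz.
  by apply: (addIr z); rewrite yz y'z.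
have inj A x x' y : R A x y -> R A x' y -> x = x'.
  move=> xy x'y; have [z xz] := tot A (- x').
  have /zero [/(_ (subrr x')) yz _] := add _ _ _ _ _ x'y xz.
  have /zero [_ /(_ yz) /eqP] := add _ _ _ _ _ xy xz.
  by rewrite subr_eq0 => /eqP.
pose eta A x := projT1 (cid (tot A x)).
have etaR A x : R A x (eta A x) by apply: (projT2 (cid (tot A x))).
pose the A y := projT1 (cid (sur A y)).
have theR A y : R A (the A y) y by apply: (projT2 (cid (sur A y))).
exists eta; split.
- by move=> A x y; apply: func (etaR _ _) _; apply: add.
- move=> A; exists (the A) => x.
    by apply: inj (theR _ _) _; apply: etaR.
  by apply: func (etaR _ _) _; apply: theR.
- by move=> A B f x; apply: func (etaR _ _) _; apply: nat.
Qed.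

Section Translates.
Variables (k : comPzRingType) (J : lmodType k) (C : lincat k) (E : bifunctor C).
Variables (PI II : cat_ideal C).
Hypothesis PIP : forall Y W (f : hom Y W), PI Y W f <-> pull_null E f.
Hypothesis IIP : forall A B (g : hom A B), II A B g <-> push_null E g.

Lemma pull_repr Y W B (f : hom Y W) (e : E W B) : pull (qrepr (qclass (PI Y W) f)) e = pull f e.
Proof.
apply/eqP; rewrite -subr_eq0 -pullB; apply/eqP.
by have /PIP := qrepr_class (PI Y W) f; apply.
Qed.

Lemma push_repr D A B (g : hom A B) (e : E D A) : push (qrepr (qclass (II A B) g)) e = push g e.
Proof.
apply/eqP; rewrite -subr_eq0 -pushB; apply/eqP.
by have /IIP := qrepr_class (II A B) g; apply.
Qed.

(** Morphisms adjoint to each other for the two pairings. *)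
Definition transpose (Y X Y' X' : C) (w : E Y X -> J) (w' : E Y' X' -> J)
    (F : quot_hom PI Y Y') (G : quot_hom II X X') : Prop :=
  forall e : E Y' X, w (pull (qrepr F) e) = w' (push (qrepr G) e).

Section Two.
Variables (Y X Y' X' : C) (w : E Y X -> J) (w' : E Y' X' -> J).

Lemma transpose_left (G : quot_hom II X X') : represents_pull w -> pull_linear w' ->
  exists F : quot_hom PI Y Y', transpose w w' F G.
Proof.
case=> _ _ wsurj lw'; have [f fE] := wsurj _ _ (pull_linear_push (qrepr G) lw').
by exists (qclass _ f) => e; rewrite pull_repr fE.
Qed.

Lemma transpose_right (F : quot_hom PI Y Y') : represents_push w' -> pull_linear w ->
  exists G : quot_hom II X X', transpose w w' F G.
Proof.
case=> _ _ wsurj lw; have [g gE] := wsurj _ _ (pull_linear_pull (qrepr F) lw).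
by exists (qclass _ g) => e; rewrite push_repr gE.
Qed.

Lemma transpose_left_inj (F F' : quot_hom PI Y Y') (G : quot_hom II X X') : represents_pull w ->
  transpose w w' F G -> transpose w w' F' G -> F = F'.
Proof.
case=> lw winj _ FG F'G; rewrite -[F]qreprK -[F']qreprK; apply/qclass_eq/PIP.
by apply: winj => e; rewrite pullB pull_linearB // FG F'G subrr.
Qed.

Lemma transpose_right_inj (F : quot_hom PI Y Y') (G G' : quot_hom II X X') : represents_push w' ->
  transpose w w' F G -> transpose w w' F G' -> G = G'.
Proof.
case=> lw winj _ FG FG'; rewrite -[G]qreprK -[G']qreprK; apply/qclass_eq/IIP.
by apply: winj => e; rewrite pushB pull_linearB // -FG -FG' subrr.
Qed.

Lemma transpose_add (F F' : quot_hom PI Y Y') (G G' : quot_hom II X X') :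
  pull_linear w -> pull_linear w' ->
  transpose w w' F G -> transpose w w' F' G' -> transpose w w' (F + F') (G + G').
Proof.
move=> lw lw' FG F'G' e; rewrite -[F]qreprK -[F']qreprK -[G]qreprK -[G']qreprK -!qclassD.
by rewrite pull_repr push_repr pullD pushD (proj1 lw) (proj1 lw') FG F'G'.
Qed.

End Two.

Lemma transpose_id (Y X : C) (w : E Y X -> J) :
  transpose w w (@idm _ (quot_cat PI) Y) (@idm _ (quot_cat II) X).
Proof. by move=> e; rewrite pull_repr push_repr pull1 push1. Qed.

Lemma transpose_comp (Y X Y' X' Y2 X2 : C) (w : E Y X -> J) (w' : E Y' X' -> J) (w2 : E Y2 X2 -> J)
    (F : quot_hom PI Y Y') (G : quot_hom II X X')
    (F' : quot_hom PI Y' Y2) (G' : quot_hom II X' X2) :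
  transpose w w' F G -> transpose w' w2 F' G' ->
  transpose w w2 (@mcomp _ (quot_cat PI) _ _ _ F' F) (@mcomp _ (quot_cat II) _ _ _ G' G).
Proof.
move=> FG F'G' e; rewrite /= /quot_comp pull_repr push_repr pullM pushM.
by rewrite FG push_pull F'G'.
Qed.

Definition perfect (Y X : C) (w : E Y X -> J) : Prop := represents_pull w /\ represents_push w.

Lemma perfect_lin (Y X : C) (w : E Y X -> J) : perfect w -> pull_linear w.
Proof. by case=> -[]. Qed.

Lemma translate_inverse : (forall X, exists (Y : C) (w : E Y X -> J), perfect w) ->
  exists (T : functor (quot_cat II) (quot_cat PI)) (w : forall X : C, E (T X) X -> J),
    (forall X, perfect (w X)) /\
    forall X X' (G : quot_hom II X X'), transpose (w X) (w X') (fmap T G) G.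
Proof.
move=> ex; have [t tE] := choice ex; pose w X := projT1 (cid (tE X)).
have wP X : perfect (w X) by apply: (projT2 (cid (tE X))).
have mex X X' (G : quot_hom II X X') : exists F, transpose (w X) (w X') F G.
  by apply: transpose_left; [case: (wP X) | apply: perfect_lin (wP X')].
pose m X X' (G : quot_hom II X X') := projT1 (cid (mex X X' G)).
have mE X X' (G : quot_hom II X X') : transpose (w X) (w X') (m X X' G) G.
  exact: (projT2 (cid (mex X X' G))).
unshelve eexists (@Functor k (quot_cat II) (quot_cat PI) t m _ _ _).
- move=> A B f g; apply: transpose_left_inj (proj1 (wP A)) (mE _ _ _) _.
  by apply: transpose_add; try exact: mE; apply: perfect_lin.
- by move=> A; apply: transpose_left_inj (proj1 (wP A)) (mE _ _ _) _; apply: transpose_id.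
- move=> A B D g f; apply: transpose_left_inj (proj1 (wP A)) (mE _ _ _) _.
  by apply: transpose_comp; apply: mE.
by exists w.
Qed.

Lemma translate : (forall Y, exists (X : C) (w : E Y X -> J), perfect w) ->
  exists (T : functor (quot_cat PI) (quot_cat II)) (w : forall Y : C, E Y (T Y) -> J),
    (forall Y, perfect (w Y)) /\
    forall Y Y' (F : quot_hom PI Y Y'), transpose (w Y) (w Y') F (fmap T F).
Proof.
move=> ex; have [t tE] := choice ex; pose w Y := projT1 (cid (tE Y)).
have wP Y : perfect (w Y) by apply: (projT2 (cid (tE Y))).
have mex Y Y' (F : quot_hom PI Y Y') : exists G, transpose (w Y) (w Y') F G.
  by apply: transpose_right; [case: (wP Y') | apply: perfect_lin (wP Y)].
pose m Y Y' (F : quot_hom PI Y Y') := projT1 (cid (mex Y Y' F)).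
have mE Y Y' (F : quot_hom PI Y Y') : transpose (w Y) (w Y') F (m Y Y' F).
  exact: (projT2 (cid (mex Y Y' F))).
unshelve eexists (@Functor k (quot_cat PI) (quot_cat II) t m _ _ _).
- move=> A B f g; apply: transpose_right_inj (proj2 (wP B)) (mE _ _ _) _.
  by apply: transpose_add; try exact: mE; apply: perfect_lin.
- by move=> A; apply: transpose_right_inj (proj2 (wP A)) (mE _ _ _) _; apply: transpose_id.
- move=> A B D g f; apply: transpose_right_inj (proj2 (wP D)) (mE _ _ _) _.
  by apply: transpose_comp; apply: mE.
by exists w.
Qed.

Section QuasiInverse.
Variables (tau : functor (quot_cat PI) (quot_cat II)) (w : forall Y : C, E Y (tau Y) -> J).
Variables (tauV : functor (quot_cat II) (quot_cat PI)) (v : forall X : C, E (tauV X) X -> J).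
Arguments w : clear implicits.
Arguments v : clear implicits.
Hypothesis wP : forall Y, perfect (w Y).
Hypothesis vP : forall X, perfect (v X).
Hypothesis tauE : forall Y Y' (F : quot_hom PI Y Y'), transpose (w Y) (w Y') F (fmap tau F).
Hypothesis tauVE : forall X X' (G : quot_hom II X X'), transpose (v X) (v X') (fmap tauV G) G.

(** The pairings v at (tau^-1 tau Y, tau Y) and w at (Y, tau Y) both represent, so the
    identity of tau Y has transposes in both directions; uniqueness of transposes makes
    them mutually inverse and natural. *)
Lemma translates_quasi_inverse : quasi_inverse tau tauV.
Proof.
split.
- have eex (Y : C) : exists F : quot_hom PI (tauV (tau Y)) Y,
      transpose (v (tau Y)) (w Y) F (@idm _ (quot_cat II) (tau Y)).
    by apply: transpose_left; [case: (vP (tau Y)) | apply: perfect_lin].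
  have tex (Y : C) : exists F : quot_hom PI Y (tauV (tau Y)),
      transpose (w Y) (v (tau Y)) F (@idm _ (quot_cat II) (tau Y)).
    by apply: transpose_left; [case: (wP Y) | apply: perfect_lin].
  exists (fun Y : C => projT1 (cid (eex Y))), (fun Y : C => projT1 (cid (tex Y))).
  have eE Y := projT2 (cid (eex Y)); have tE Y := projT2 (cid (tex Y)).
  split=> [A B f|A|A].
  + apply: (transpose_left_inj (w' := w B) (G := fmap tau f) (proj1 (vP (tau A)))).
      rewrite -[fmap tau f](@mcomp1m _ (quot_cat II)).
      by apply: transpose_comp (eE B); apply: tauVE.
    rewrite -[fmap tau f](@mcompm1 _ (quot_cat II)).
    by apply: transpose_comp (eE A) _; apply: tauE.
  + apply: (transpose_left_inj (proj1 (vP (tau A)))); last exact: transpose_id.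
    rewrite -[X in transpose _ _ _ X](@mcomp1m _ (quot_cat II)).
    exact: transpose_comp (eE A) (tE A).
  + apply: (transpose_left_inj (proj1 (wP A))); last exact: transpose_id.
    rewrite -[X in transpose _ _ _ X](@mcomp1m _ (quot_cat II)).
    exact: transpose_comp (tE A) (eE A).
- have eex (X : C) : exists G : quot_hom II (tau (tauV X)) X,
      transpose (w (tauV X)) (v X) (@idm _ (quot_cat PI) (tauV X)) G.
    by apply: transpose_right; [case: (vP X) | apply: perfect_lin].
  have tex (X : C) : exists G : quot_hom II X (tau (tauV X)),
      transpose (v X) (w (tauV X)) (@idm _ (quot_cat PI) (tauV X)) G.
    by apply: transpose_right; [case: (wP (tauV X)) | apply: perfect_lin].
  exists (fun X : C => projT1 (cid (eex X))), (fun X : C => projT1 (cid (tex X))).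
  have eE X := projT2 (cid (eex X)); have tE X := projT2 (cid (tex X)).
  split=> [A B f|A|A].
  + apply: (transpose_right_inj (w := w (tauV A)) (F := fmap tauV f) (proj2 (vP B))).
      rewrite -[fmap tauV f](@mcomp1m _ (quot_cat PI)).
      by apply: transpose_comp (eE B); apply: tauE.
    rewrite -[fmap tauV f](@mcompm1 _ (quot_cat PI)).
    by apply: transpose_comp (eE A) _; apply: tauVE.
  + apply: (transpose_right_inj (proj2 (wP (tauV A)))); last exact: transpose_id.
    rewrite -[X in transpose _ _ X](@mcomp1m _ (quot_cat PI)).
    exact: transpose_comp (eE A) (tE A).
  + apply: (transpose_right_inj (proj2 (vP A))); last exact: transpose_id.
    rewrite -[X in transpose _ _ X](@mcomp1m _ (quot_cat PI)).
    exact: transpose_comp (tE A) (eE A).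
Qed.

End QuasiInverse.

End Translates.

(** * Dual functors from pairings *)

Section PairingIso.
Variables (k : comPzRingType) (J : lmodType k).

(** H and G are identified when they give rise to the same functions on V, through the
    pairings e and b that have no kernel on their side. *)
Lemma ab_iso_of_pairing (C : lincat k) (H G : abfun C) (V : C -> Type)
    (e : forall A, H A -> V A -> J) (b : forall A, G A -> V A -> J) :
  (forall A x x' v, e A (x + x') v = e A x v + e A x' v) ->
  (forall A y y' v, b A (y + y') v = b A y v + b A y' v) ->
  (forall A x, (forall v, e A x v = 0) -> x = 0) ->
  (forall A y, (forall v, b A y v = 0) -> y = 0) ->
  (forall A x, exists y, forall v, e A x v = b A y v) ->
  (forall A y, exists x, forall v, e A x v = b A y v) ->
  (forall A B (f : hom A B) (v : V B), exists v0 : V A,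
     (forall x, e B (amap f x) v = e A x v0) /\ (forall y, b B (amap f y) v = b A y v0)) ->
  ab_iso H G.
Proof.
move=> eD bD e0 b0 eb be nat.
have e00 A v : e A 0 v = 0 by apply: (addrI (e A 0 v)); rewrite -eD !addr0.
have b00 A v : b A 0 v = 0 by apply: (addrI (b A 0 v)); rewrite -bD !addr0.
apply: (@ab_iso_rel k C H G (fun A x y => forall v, e A x v = b A y v)) => //.
- by move=> A x x' y y' xy x'y' v; rewrite eD bD xy x'y'.
- move=> A x y xy; split=> [x0|y0]; [apply: b0 | apply: e0] => v.
    by rewrite -xy x0 e00.
  by rewrite xy y0 b00.
- by move=> A B f x y xy v; have [v0 [-> ->]] := nat A B f v.
Qed.

(** The form needed for duals of quotients: V B stands for a module of representatives
    of F B, so that G B has to be matched with the functionals on V B that vanish where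
    cl does. *)
Lemma kdual_of_pairing (C : lincat k) (F : abfun C) (G : abfun (op C)) (V : C -> lmodType k)
    (cl : forall B : C, V B -> F B) (b : forall B : C, G B -> V B -> J) :
  (forall B, linear (cl B : V B -> kmod F B)) -> (forall B x, exists v, x = cl B v) ->
  (forall B y, linear (b B y)) ->
  (forall B y y' v, b B (y + y') v = b B y v + b B y' v) ->
  (forall B y v, cl B v = 0 -> b B y v = 0) ->
  (forall B y, (forall v, b B y v = 0) -> y = 0) ->
  (forall B (psi : lhom (V B) J), (forall v, cl B v = 0 -> psi v = 0) ->
     exists y, forall v, psi v = b B y v) ->
  (forall (B B' : C) (f : hom B' B) (v : V B'), exists v0 : V B,
     cl B v0 = amap f (cl B' v) /\
     (forall y, b B' (@amap _ _ G B B' f y) v = b B y v0)) ->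
  ab_iso (kdual J F) G.
Proof.
move=> clL clS bL bD b0 nondeg rep nat.
have clE B := linear_lhom (clL B).
apply: (@ab_iso_of_pairing (op C) (kdual J F) G V
  (fun B (phi : lhom (kmod F B) J) v => lfun_of phi (cl B v)) b) => //.
- by move=> B phi h; apply: lhomP => x; have [v ->] := clS _ x; apply: h.
- move=> B phi; have [q qE] := clE B.
  have [psi psiE] : exists psi : lhom (V B) J, forall v, psi v = lfun_of phi (cl B v).
    by apply: linear_lhom => a v v'; rewrite -!qE !lhE.
  have [|y yE] := rep _ psi; last by exists y => v; rewrite -yE psiE.
  by move=> v v0; rewrite psiE v0; apply: lh0.
- move=> B y; have [q qE] := clE B; have [r rE] := linear_lhom (bL B y).
  have [g gE] := choice (clS B).
  have rg x v : x = cl B v -> r (g x) = r v.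
    move=> xv; apply/eqP; rewrite -subr_eq0 -lhB rE; apply/eqP/b0.
    by rewrite -qE lhB !qE -gE xv subrr.
  have [|phi phiE] := @linear_lhom _ (kmod F B) J (fun x => r (g x)).
    move=> a x x'; rewrite -lhZ -lhD; apply: rg.
    by rewrite -qE lhD lhZ !qE -!gE.
  by exists phi => v; rewrite phiE (rg _ v) // rE.
- move=> B B' f v; have [v0 [v0E bE]] := nat B B' f v.
  by exists v0; split=> // phi; rewrite v0E.
Qed.

Lemma unop_kdual_of_pairing (C : lincat k) (F : abfun (op C)) (G : abfun C) (V : C -> lmodType k)
    (cl : forall B : C, V B -> F B) (b : forall B : C, G B -> V B -> J) :
  (forall B, linear (cl B : V B -> kmod F B)) -> (forall B x, exists v, x = cl B v) ->
  (forall B y, linear (b B y)) ->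
  (forall B y y' v, b B (y + y') v = b B y v + b B y' v) ->
  (forall B y v, cl B v = 0 -> b B y v = 0) ->
  (forall B y, (forall v, b B y v = 0) -> y = 0) ->
  (forall B (psi : lhom (V B) J), (forall v, cl B v = 0 -> psi v = 0) ->
     exists y, forall v, psi v = b B y v) ->
  (forall (B B' : C) (f : hom B B') (v : V B'), exists v0 : V B,
     cl B v0 = @amap _ _ F B' B f (cl B' v) /\
     (forall y, b B' (amap f y) v = b B y v0)) ->
  ab_iso (unop (kdual J F)) G.
Proof.
move=> clL clS bL bD b0 nondeg rep nat.
pose G' := @AbFun k (op (op C)) G (fun A B f => @amap _ _ G A B f) (@amap_add _ _ G)
  (@amapD _ _ G) (@amap1 _ _ G) (@amapM _ _ G).
have [eta [etaD etab etaN]] := @kdual_of_pairing (op C) F G' V cl b clL clS bL bD b0 nondeg rep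
  (fun B B' f v => nat B B' f v).
by exists eta.
Qed.

End PairingIso.

(** * Duals of the extension functors and of the defects *)

Section ExtFormula.
Variables (k : comPzRingType) (J : lmodType k) (C : lincat k) (E : bifunctor C).
Hypothesis ak : artinian_mod k^o.
Hypothesis envJ : injective_envelope_of_residue_ring J.
Hypothesis aC : forall A B : C, artinian_mod (hom A B).
Hypothesis exE : exact_bifunctor E.
Variables (PI II : cat_ideal C).
Hypothesis PIP : forall Y W (f : hom Y W), PI Y W f <-> pull_null E f.
Hypothesis IIP : forall A B (g : hom A B), II A B g <-> push_null E g.

Lemma ext_contra_dual (Y X : C) (v : E Y X -> J) : perfect v ->
  ab_iso (unop (kdual J (ext_contra E X))) (abcomp (@corep k (quot_cat PI) Y) (quotfun PI)).
Proof.
case=> -[lv vinj vsurj] _.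
apply: (@unop_kdual_of_pairing k J C (ext_contra E X)
  (abcomp (@corep k (quot_cat PI) Y) (quotfun PI))
  (fun W => kmod (ext_contra E X) W) (fun W (e : E W X) => e)
  (fun W (F : quot_hom PI Y W) (e : E W X) => v (pull (qrepr F) e))).
- by [].
- by move=> W e; exists e.
- move=> W F a e e'; have [lD lZ] := pull_linear_pull (qrepr (F : quot_hom PI Y W)) lv.
  by rewrite lD -lZ.
- move=> W F F' e; rewrite -[F](qreprK (F : quot_hom PI Y W)) -[F'](qreprK (F' : quot_hom PI Y W)).
  by rewrite -qclassD !(pull_repr PIP) pullD (proj1 lv).
- by move=> W F e /= ->; rewrite pull0 pull_linear0.
- move=> W F h; rewrite -[F](qreprK (F : quot_hom PI Y W)).
  exact/qclass_eq0/PIP/vinj.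
- move=> W psi _; have [f fE] := vsurj _ _ (lhom_pull_linear psi).
  by exists (qclass _ f) => e; rewrite (pull_repr PIP) -fE.
- move=> W W' f e; exists (pull f e); split=> // F.
  by rewrite /= /quot_comp (pull_repr PIP) pullM (pull_repr PIP).
Qed.

(** The dual of E(Y,-) uses the action of k through the second argument, while w
    represents the functionals linear for the action through Y; the two are exchanged by
    the twist T along an element pi universal for E(Y,-). *)
Lemma ext_co_dual (Y X : C) (w : E Y X -> J) : perfect w ->
  ab_iso (kdual J (ext_co E Y)) (abcomp (@corep k (op (quot_cat II)) X) (opfun (quotfun II))).
Proof.
case=> _ [lw winj wsurj]; have [_ _ proj _] := exE; have [A [pi piU]] := proj Y.
have [T [T' tw]] := twist_delta ak envJ aC exE pi; have [TC T'C _ T'D [_ T'N]] := tw.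
pose psi B (G : quot_hom II B X) (g : hom A B) := w (push (qrepr G) (push g pi)).
have psiC B (G : quot_hom II B X) : @pull_functional _ _ _ (cyclic_delta exE pi) J B (@psi B G).
  rewrite /psi; split=> [g g'|g /= ->|b g g' /= ->]; first by rewrite pushD push_add (proj1 lw).
    by rewrite push0 pull_linear0.
  by rewrite push_pull (proj2 lw).
apply: (@kdual_of_pairing k J C (ext_co E Y)
  (abcomp (@corep k (op (quot_cat II)) X) (opfun (quotfun II)))
  (fun B => hom A B) (fun B g => push g pi) (fun B (G : quot_hom II B X) g => T' B (psi B G) g)).
- move=> B a g g'; rewrite pushD; congr (_ + _).
  by rewrite -[RHS]/(push (a *: idm B) (push g pi)) -pushM mcompZl mcomp1m.
- by move=> B; apply: piU.
- by move=> B G a g g'; have [[bD _ bZ] _] := T'C _ _ (psiC B G); rewrite bD bZ.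
- move=> B G G' g.
  rewrite -[RHS]/((fun g => T' B (psi B G) g + T' B (psi B G') g) g) -T'D //.
  congr (T' B _ g); apply/funext => h; rewrite /psi.
  rewrite -[G](qreprK (G : quot_hom II B X)) -[G'](qreprK (G' : quot_hom II B X)).
  by rewrite -qclassD !(push_repr IIP) pushD (proj1 lw).
- by move=> B G g g0; have [[_ b0 _] _] := T'C _ _ (psiC B G); apply: b0.
- move=> B G h; rewrite -[G](qreprK (G : quot_hom II B X)).
  apply/qclass_eq0/IIP/winj => e; have [g ->] := piU _ e.
  have [_ /(congr1 (fun f => f g)) /= eT] := T'C _ _ (psiC B G).
  rewrite -[LHS]/(psi B G g) -eT.
  have -> : T' B (psi B G) = (fun=> 0) by apply/funext.
  by rewrite (proj1 (functional_twisting0 B tw)).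
- move=> B phi phi0.
  have cphi : @push_functional _ _ _ (cyclic_delta exE pi) J B phi.
    by split=> [g g'|g g0|a g]; [exact: lhD | exact: phi0 | exact: lhZ].
  have [[TD1 T01 TZ1] TK] := TC _ _ cphi.
  have [chi chiE] := universal_functional piU TD1 T01.
  have [|G GE] := wsurj _ chi.
    split=> [x y|a x].
      by have [g ->] := piU _ x; have [g' ->] := piU _ y; rewrite -pushD !chiE TD1.
    have [g ->] := piU _ x; have [g' g'E] := piU _ (pull (a *: idm Y) (push g pi)).
    by rewrite g'E !chiE; apply: TZ1; rewrite -g'E.
  exists (qclass _ G) => g; rewrite -[LHS](congr1 (fun f => f g) TK); congr (T' B _ g).
  by apply/funext => h; rewrite /psi (push_repr IIP) -GE chiE.
- move=> B B' f g; exists (f \oc g); split=> [|G]; first by rewrite pushM.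
  rewrite -[RHS]/((fun h => T' B (psi B G) (f \oc h)) g) -T'N //; congr (T' B' _ g).
  apply/funext => h; rewrite /psi /= /quot_comp (push_repr IIP) [in LHS]pushM (push_repr IIP).
  by rewrite pushM.
Qed.

End ExtFormula.

Section DefectFormula.
Variables (k : comPzRingType) (J : lmodType k) (C : addcat k) (n : nat) (n_gt0 : (0 < n)%N).
Variable S : nexangulated C n_gt0.
Hypothesis ak : artinian_mod k^o.
Hypothesis envJ : injective_envelope_of_residue_ring J.
Variables (A D : C) (X : cplx n A D) (delta : S D A).
Hypothesis dX : distinguished X delta.

Local Notation PI := (proj_ideal S).
Local Notation II := (inj_ideal S).
Local Notation cls B g := (qclass (precomp_image (dfirst X) B) g).
Local Notation clsop W f := (qclass (@precomp_image k (op C) D (X n) (dlast X) W) f).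

(** A representative in the category itself rather than its opposite. *)
Definition contra_repr (W : C)
    (x : lquot (@precomp_image k (op C) D (X n) (dlast X) W)) : hom W D := qrepr x.

Lemma contra_reprK (W : C) x : clsop W (@contra_repr W x) = x.
Proof. exact: (@qreprK _ _ (@precomp_image k (op C) D (X n) (dlast X) W) x). Qed.

Lemma co_class0 (B : C) (g : hom A B) : cls B g = 0 <-> push g delta = 0.
Proof. by rewrite qclass_eq0; have [h _] := distinguished_inflation dX; split=> /h. Qed.

Lemma contra_class0 (W : C) (f : hom W D) : clsop W f = 0 <-> pull f delta = 0.
Proof. by rewrite qclass_eq0; have [h _] := distinguished_deflation dX; split=> /h. Qed.

Lemma co_class_repr (B : C) (g : hom A B) : push (qrepr (cls B g)) delta = push g delta.
Proof.
apply/eqP; rewrite -subr_eq0 -pushB; apply/eqP/co_class0/qclass_eq0.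
exact: qrepr_class.
Qed.

Lemma contra_class_repr (W : C) (f : hom W D) : pull (contra_repr (clsop W f)) delta = pull f delta.
Proof.
apply/eqP; rewrite -subr_eq0 -pullB; apply/eqP/contra_class0/qclass_eq0.
exact: (@qrepr_class _ _ (@precomp_image k (op C) D (X n) (dlast X) W)).
Qed.

Lemma co_defect_scale (B : C) (a : k) (g : hom A B) :
  a *: (cls B g : kmod (costable_co_defect dX) B) =
  cls B (a *: g) :> kmod (costable_co_defect dX) B.
Proof.
rewrite -[LHS]/(@amap _ _ (co_defect X) B B (qrepr (a *: qclass (II B B) (idm B))) (cls B g)).
rewrite -qclassZ (amap_qrepr (co_defect0 dX)).
by apply: etrans (coker_mapE _ _ _) _; rewrite mcompZl mcomp1m.
Qed.

Lemma contra_defect_scale (W : C) (a : k) (f : hom W D) :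
  a *: (clsop W f : kmod (stable_contra_defect dX) W) =
  clsop W (a *: f) :> kmod (stable_contra_defect dX) W.
Proof.
rewrite -[LHS]/(@amap _ _ (contra_defect X) W W (qrepr (a *: qclass (PI W W) (idm W))) (clsop W f)).
rewrite -qclassZ (amap_qrepr_op (contra_defect0 dX)).
apply: etrans (@coker_mapE k (op C) D (X n) (dlast X) W W (a *: idm W) f) _ => /=.
by rewrite mcompZr mcompm1.
Qed.

Lemma co_defect_map (B B' : C) (G : quot_hom II B B') (g : hom A B) :
  @amap _ _ (costable_co_defect dX) B B' G (cls B g) = cls B' (qrepr G \oc g).
Proof. exact: coker_mapE. Qed.

Lemma contra_defect_map (W W' : C) (F : quot_hom PI W' W) (f : hom W D) :
  @amap _ _ (stable_contra_defect dX) W W' F (clsop W f) = clsop W' (f \oc qrepr F).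
Proof. exact: (@coker_mapE k (op C) D (X n) (dlast X) W W' (qrepr F) f). Qed.

Lemma co_defect_linear (B : C) :
  linear ((fun g : hom A B => cls B g) : hom A B -> kmod (costable_co_defect dX) B).
Proof. by move=> a g g'; rewrite qclassD -co_defect_scale. Qed.

Lemma contra_defect_linear (W : C) :
  linear ((fun f : hom W D => clsop W f) : hom W D -> kmod (stable_contra_defect dX) W).
Proof.
move=> a f f'; rewrite -[RHS]/((a *: (clsop W f : kmod (stable_contra_defect dX) W)) + clsop W f').
by rewrite contra_defect_scale; apply: (@qclassD _ _ (@precomp_image k (op C) D (X n) (dlast X) W)).
Qed.

(** The value of the contravariant defect at Y is the set of f^*delta in E(Y,A), and the
    functionals on this submodule extend to E(Y,A), where they are e -> w(g_*e) with g :
    A -> tau Y. On f^*delta this is w(f^*g_*delta), which depends on g_*delta only, an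
    element of the covariant defect at tau Y. *)
Lemma contra_defect_dual (tau : functor (stable S) (costable S))
    (w : forall Y : C, S Y (tau Y) -> J) :
  (forall Y, perfect (@w Y)) ->
  (forall Y Y' (F : quot_hom PI Y Y'), transpose (@w Y) (@w Y') F (fmap tau F)) ->
  ab_iso (unop (kdual J (stable_contra_defect dX))) (abcomp (costable_co_defect dX) tau).
Proof.
move=> wP tauE.
pose b (Y : C) (x : lquot (precomp_image (dfirst X) (tau Y))) (f : @hom k C Y D) :=
  @w Y (push (qrepr x) (pull f delta)).
have bL (Y : C) x : linear (@b Y x).
  move=> a f f'; have [_ [lw _ _]] := wP Y.
  rewrite /b pullD push_add (proj1 lw); congr (_ + _).
  by rewrite -(proj2 lw) -[a *: f]mcompm1 mcompZl -mcompZr pullM push_pull.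
have bD (Y : C) x x' f : @b Y (x + x') f = b Y x f + b Y x' f.
  have [_ [lw _ _]] := wP Y; rewrite /b -(proj1 lw) -[x]qreprK -[x']qreprK -qclassD.
  by rewrite !push_pull !co_class_repr pushD pull_add.
have b0 (Y : C) x f : clsop Y f = 0 -> @b Y x f = 0.
  move/contra_class0 => f0; have [_ [lw _ _]] := wP Y.
  by rewrite /b f0 push0 pull_linear0.
have nondeg (Y : C) x : (forall f, @b Y x f = 0) -> x = 0.
  move=> h; have [[_ _ wsurj] [lw _ _]] := wP Y.
  rewrite -[x]qreprK; apply/co_class0; apply: contrapT.
  move/(ext_cogenerator ak envJ) => [psi [lpsi]]; apply; have [f ->] := wsurj _ _ lpsi.
  by rewrite -push_pull; apply: h.
have rep (Y : C) (q : lhom (@hom k C Y D) J) : (forall f, clsop Y f = 0 -> q f = 0) ->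
    exists x, forall f, q f = @b Y x f.
  move=> q0; have [_ [lw _ wsurj]] := wP Y.
  have [p pE] : exists p : lhom (@hom k C Y D) (kmod (ext_contra S A) Y),
      forall f, p f = pull f delta.
    apply: (@linear_lhom _ (@hom k C Y D) (kmod (ext_contra S A) Y)) => a f f'.
    rewrite pullD; congr (_ + _).
    by rewrite -[RHS]/(pull (a *: @idm k C Y) (pull f delta)) -pullM mcompZr mcompm1.
  have [|psi psiE] := @functional_ext _ J envJ _ _ p q.
    by move=> f; rewrite pE => /contra_class0; apply: q0.
  have [g gE] := wsurj _ _ (lhom_pull_linear psi).
  by exists (qclass _ g) => f; rewrite /b push_pull co_class_repr -push_pull -gE -psiE pE.
have nat (Y Y' : C) (F : quot_hom PI Y Y') (f : @hom k C Y' D) x :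
    b Y' (cls (tau Y') (qrepr (fmap tau F) \oc qrepr x)) f = b Y x (f \oc qrepr F).
  rewrite /b pullM [in RHS]push_pull tauE -pushM !push_pull; congr (@w Y' (pull f _)).
  exact: co_class_repr.
apply: (@unop_kdual_of_pairing k J (stable S) (stable_contra_defect dX)
  (abcomp (costable_co_defect dX) tau) (fun Y : C => @hom k C Y D)
  (fun (Y : C) f => clsop Y f) b contra_defect_linear _ bL bD b0 nondeg rep).
- by move=> Y x; exists (contra_repr x); apply: (esym (contra_reprK x)).
- move=> Y Y' F f; exists (f \oc qrepr (F : quot_hom PI Y Y')).
  by split; [apply: (esym (contra_defect_map F f)) | move=> x; apply: nat].
Qed.

Hypothesis aC : forall A B : C, artinian_mod (hom A B).
Hypothesis exE : exact_bifunctor S.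

(** Dual to [contra_defect_dual]: functionals on the set of g_*delta in E(D,B) are given
    by f : tau^-1 B -> D through v(f^*g_*delta). The dual of the covariant defect uses
    the action of k through B, and v is linear for the action through the first
    argument, so the twist along delta intervenes. *)
Lemma co_defect_dual (tauV : functor (costable S) (stable S))
    (v : forall X : C, S (tauV X) X -> J) :
  (forall X, perfect (@v X)) ->
  (forall X X' (G : quot_hom II X X'), transpose (@v X) (@v X') (fmap tauV G) G) ->
  ab_iso (kdual J (costable_co_defect dX)) (abcomp (stable_contra_defect dX) (opfun tauV)).
Proof.
move=> vP tauVE.
have [T [T' tw]] := twist_delta ak envJ aC exE delta; have [TC T'C _ T'D [_ T'N]] := tw.
pose psi (B : C) (x : lquot (@precomp_image k (op C) D (X n) (dlast X) (tauV B))) (g : hom A B) :=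
  @v B (pull (contra_repr x) (push g delta)).
have psiC B x : @pull_functional _ _ _ (cyclic_delta exE delta) J B (@psi B x).
  have [[lv _ _] _] := vP B; rewrite /psi; split=> [g g'|g /= ->|b g g' /= ->].
  - by rewrite pushD pull_add (proj1 lv).
  - by rewrite pull0 pull_linear0.
  - rewrite -(proj2 lv) -!pullM; congr (@v B (pull _ _)).
    by rewrite mcompZl mcompZr mcomp1m mcompm1.
pose b (B : C) x (g : @hom k C A B) := T' B (@psi B x) g.
have bL (B : C) x : linear (@b B x).
  by move=> a g g'; have [[bD _ bZ] _] := T'C _ _ (psiC B x); rewrite /b bD bZ.
have bD (B : C) x x' g : @b B (x + x') g = b B x g + b B x' g.
  have [[lv _ _] _] := vP B.
  rewrite /b -[RHS]/((fun g => T' B (psi B x) g + T' B (psi B x') g) g) -T'D //.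
  congr (T' B _ g); apply/funext => h; rewrite /psi -(proj1 lv).
  rewrite -[x]contra_reprK -[x']contra_reprK -qclassD -!push_pull !contra_class_repr.
  by rewrite pullD push_add.
have b0 (B : C) x g : cls B g = 0 -> @b B x g = 0.
  by move/co_class0 => g0; have [[_ b0 _] _] := T'C _ _ (psiC B x); apply: b0.
have nondeg (B : C) x : (forall g, @b B x g = 0) -> x = 0.
  move=> h; have [_ [lv _ vsurj]] := vP B.
  rewrite -[x]contra_reprK; apply/contra_class0; apply: contrapT.
  move/(ext_cogenerator ak envJ) => [chi [lchi]]; apply; have [g ->] := vsurj _ _ lchi.
  have [_ /(congr1 (fun f => f g)) /= eT] := T'C _ _ (psiC B x).
  rewrite push_pull -[LHS]/(psi B x g) -eT.
  have -> : T' B (psi B x) = (fun=> 0) by apply/funext; apply: h.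
  by rewrite (proj1 (functional_twisting0 B tw)).
have rep (B : C) (phi : lhom (@hom k C A B) J) : (forall g, cls B g = 0 -> phi g = 0) ->
    exists x, forall g, phi g = @b B x g.
  move=> phi0; have [[lv _ vsurj] _] := vP B.
  have cphi : @push_functional _ _ _ (cyclic_delta exE delta) J B phi.
    by split=> [g g'|g /co_class0|a g]; [exact: lhD | exact: phi0 | exact: lhZ].
  have [[TD1 T01 TZ1] TK] := TC _ _ cphi.
  (* the twisted functional T phi as a function of g_*delta; 0 is a filler outside this
     submodule *)
  pose chi (e : S D B) : J :=
    if pselect (exists g, e = push g delta) is left h then T B phi (projT1 (cid h)) else 0.
  have chiE (g : @hom k C A B) : chi (push g delta) = T B phi g.
    rewrite /chi; case: pselect => [h|]; last by case; exists g.
    rewrite -[projT1 (cid h)](subrK g) TD1 T01 ?add0r //=.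
    by rewrite pushB -(projT2 (cid h)) subrr.
  have scl a (g : @hom k C A B) : exists g', pull (a *: idm D) (push g delta) = push g' delta.
    have [e eE] := deflation_cyclic exE delta a.
    by exists (g \oc e); rewrite -push_pull eE pushM.
  have [I hI] : exists I : submodule (kmod (ext_contra S B) D), forall e,
      I e <-> exists g : @hom k C A B, e = push g delta.
    apply: submodule_ex => [|_ _ [g ->] [g' ->]|a _ [g ->]]; first by exists 0; rewrite push_zero.
      by exists (g + g'); rewrite pushD.
    exact: scl.
  have [||rho rhoE] := @submodule_functional k J (kmod (ext_contra S B) D) I chi envJ.
  + by move=> x y /hI [g ->] /hI [g' ->]; rewrite -pushD !chiE TD1.
  + move=> a x /hI [g ->]; have [g' g'E] := scl a g.
    rewrite -[a *: _]/(pull (a *: idm D) (push g delta)) g'E !chiE.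
    by apply: TZ1; rewrite -g'E.
  have [f fE] := vsurj _ _ (lhom_pull_linear rho).
  exists (clsop (tauV B) f) => g; rewrite /b -[LHS](congr1 (fun f => f g) TK); congr (T' B _ g).
  apply/funext => h; rewrite /psi -push_pull contra_class_repr push_pull -fE rhoE ?chiE //.
  by apply/hI; exists h.
have nat (B B' : C) (G : quot_hom II B' B) (g : @hom k C A B') x :
    let F : quot_hom PI (tauV B') (tauV B) := fmap tauV G in
    b B' (clsop (tauV B') (contra_repr x \oc qrepr F)) g = b B x (qrepr G \oc g).
  move=> F; have e : psi B' (clsop (tauV B') (contra_repr x \oc qrepr F)) =
      (fun h => psi B x (qrepr G \oc h)).
    apply/funext => h; rewrite /psi pushM -push_pull contra_class_repr push_pull pullM tauVE.
    by rewrite push_pull.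
  by rewrite /b e T'N.
apply: (@kdual_of_pairing k J (costable S) (costable_co_defect dX)
  (abcomp (stable_contra_defect dX) (opfun tauV)) (fun B : C => @hom k C A B)
  (fun (B : C) g => cls B g) b co_defect_linear _ bL bD b0 nondeg rep).
- by move=> B x; exists (qrepr (x : lquot _)); apply: (esym (qreprK (x : lquot _))).
- move=> B B' G g; exists (qrepr (G : quot_hom II B' B) \oc g).
  by split; [apply: (esym (co_defect_map G g)) | move=> x; apply: nat].
Qed.

End DefectFormula.

Section MutualTranslates.
Variables (k : comPzRingType) (J : lmodType k) (C : addcat k) (n : nat) (n_gt0 : (0 < n)%N).
Variable S : nexangulated C n_gt0.
Hypothesis artk : artinian k.
Hypothesis envJ : injective_envelope_of_residue_ring J.
Hypothesis dualC : dualizing_variety J C.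
Hypothesis enoughP : enough_projectives S.
Hypothesis enoughI : enough_injectives S.

Lemma dualizing_artinian (A B : C) : artinian_mod (hom A B).
Proof. by have [fin _ _ _] := dualC; apply: hom_finite_artinian. Qed.

Lemma mutual_translates : exists (tau : functor (stable S) (costable S))
  (w : forall Y : C, S Y (tau Y) -> J) (tauV : functor (costable S) (stable S))
  (v : forall X : C, S (tauV X) X -> J),
  [/\ forall Y, perfect (@w Y), forall X, perfect (@v X),
      forall Y Y' (F : quot_hom (proj_ideal S) Y Y'), transpose (@w Y) (@w Y') F (fmap tau F),
      forall X X' (G : quot_hom (inj_ideal S) X X'), transpose (@v X) (@v X') (fmap tauV G) G
    & quasi_inverse tau tauV].
Proof.
have [_ KS _ _] := dualC; have ak := artinianW artk; have aC := dualizing_artinian.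
have exE := nexangulated_exact enoughP enoughI.
have bC := @addcat_biproducts k C; have sC := krull_schmidt_split KS.
have dC := dualizing_presented dualC; have dCop := dualizing_presented_op dualC.
have [tau [w [wP tauE]]] := @translate k J C S (proj_ideal S) (inj_ideal S)
  (proj_idealP enoughP) (inj_idealP enoughI) (pairing_right ak envJ aC bC sC dC dCop exE).
have [tauV [v [vP tauVE]]] := @translate_inverse k J C S (proj_ideal S) (inj_ideal S)
  (proj_idealP enoughP) (inj_idealP enoughI) (pairing_left ak envJ aC bC sC dC dCop exE).
exists tau, w, tauV, v; split=> //.
exact: (translates_quasi_inverse (proj_idealP enoughP) (inj_idealP enoughI) wP vP tauE tauVE).
Qed.

End MutualTranslates.

Theorem theorem1p1 (k : comPzRingType) (J : lmodType k) (C : addcat k) (n : nat)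
    (n_gt0 : (0 < n)%N) (S : nexangulated C n_gt0) :
  artinian k -> injective_envelope_of_residue_ring J ->
  dualizing_variety J C -> enough_projectives S -> enough_injectives S ->
  exists (tau : functor (stable S) (costable S)) (tauV : functor (costable S) (stable S)),
    quasi_inverse tau tauV /\
    (forall (A D : C) (X : cplx n A D) (delta : S D A) (dX : distinguished X delta),
       ab_iso (kdual J (costable_co_defect dX))
              (abcomp (stable_contra_defect dX) (opfun tauV)) /\
       ab_iso (unop (kdual J (stable_contra_defect dX)))
              (abcomp (costable_co_defect dX) tau)) /\
    (forall X : C,
       ab_iso (unop (kdual J (ext_contra S X)))
              (abcomp (@corep k (stable S) (tauV X)) (quotfun (proj_ideal S))) /\
       ab_iso (kdual J (ext_co S X))
              (abcomp (@corep k (op (costable S)) (tau X))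
                      (opfun (quotfun (inj_ideal S))))).
Proof.
move=> artk envJ dualC eP eI.
have [tau [w [tauV [v [wP vP tauE tauVE qi]]]]] := mutual_translates artk envJ dualC eP eI.
have ak := artinianW artk; have aC := dualizing_artinian artk dualC.
have exE := nexangulated_exact eP eI.
exists tau, tauV; split; first exact: qi.
split=> [A D X delta dX|X]; split.
- exact: (co_defect_dual ak envJ dX aC exE vP tauVE).
- exact: (contra_defect_dual ak envJ dX wP tauE).
- exact: (ext_contra_dual (proj_idealP eP) (vP X)).
- exact: (ext_co_dual ak envJ aC exE (inj_idealP eI) (wP X)).
Qed.
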